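(* Let $M\in\mathrm{Mod}_\Sigma^\varphi$. (1) There are short exact sequences in $\mathrm{Mod}_\Sigma^\varphi$ $$0\to M^{\mathrm m}\to M\to M^{\mathrm{nil}}\to0,\qquad 0\to M^{\mathrm{uni}}\to M\to M^{\mathrm{et}}\to0,$$ where $M^{\mathrm m}$ is multiplicative, $M^{\mathrm{nil}}$ nilpotent, $M^{\mathrm{uni}}$ unipotent and $M^{\mathrm{et}}$ étale; the second sequence is the Cartier dual of the first sequence for $M^\vee$, i.e. $M^{\mathrm{uni}}=((M^\vee)^{\mathrm{nil}})^\vee$ and $M^{\mathrm{et}}=((M^\vee)^{\mathrm m})^\vee$; and $M^{\mathrm m}$ is the maximal multiplicative submodule of $M$. (2) $M$ is étale (resp. unipotent) if and only if $M^\vee$ is multiplicative (resp. nilpotent), and vice versa.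
   Context: $p$ prime, $0\le r\le p-1$, $k$ perfect of characteristic $p$, $E(u)\in W(k)[u]$ the Eisenstein polynomial of a uniformizer of a finite totally ramified extension of $W(k)[1/p]$. $S$ is the $p$-adic completion of the divided power envelope of $W(k)[u]$ w.r.t. $(E(u))$, $\mathrm{Fil}^jS$ the $p$-adic completion of the ideal generated by $E(u)^i/i!$ ($i\ge j$), Frobenius $\varphi$ (arithmetic Frobenius on $W(k)$, $u\mapsto u^p$), $c=\varphi(E(u))/p$. $\Sigma=W(k)[[Y]][u]/(E(u)^p-pY)\subset S$ via $Y\mapsto E(u)^p/p$; $\varphi$-stable, $\mathrm{Fil}^i\Sigma=\Sigma\cap\mathrm{Fil}^iS$, $c\in\Sigma^\times$, $\varphi_r=p^{-r}\varphi$ on $\mathrm{Fil}^r\Sigma$. $\mathrm{Mod}_\Sigma^\varphi$: triples $(M,\mathrm{Fil}^rM,\varphi_r)$, $M$ finite free over $\Sigma$, $\mathrm{Fil}^r\Sigma\cdot M\subseteq\mathrm{Fil}^rM\subseteq M$, $\varphi_r:\mathrm{Fil}^rM\to M$ $\varphi$-semilinear with $\varphi_r(sx)=c^{-r}\varphi_r(s)\varphi_r(E(u)^rx)$, $\varphi_r(\mathrm{Fil}^rM)$ generating $M$, $M/\mathrm{Fil}^rM$ $p$-torsion free; morphisms $\Sigma$-linear preserving $\mathrm{Fil}^r$ and commuting with $\varphi_r$. A sequence $0\to M_1\to M\to M_2\to0$ is short exact if exact as $\Sigma$-modules and on $\mathrm{Fil}^r$; then $M_1$ is a submodule and $M_2$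 a quotient of $M$. $M$ is étale if $\mathrm{Fil}^rM=M$, multiplicative if $\mathrm{Fil}^rM=\mathrm{Fil}^r\Sigma\cdot M$, nilpotent if it has no nonzero multiplicative submodule, unipotent if it has no nonzero étale quotient. Cartier dual: $M^\vee=\mathrm{Hom}_\Sigma(M,\Sigma)$, $\mathrm{Fil}^rM^\vee=\{f:f(\mathrm{Fil}^rM)\subseteq\mathrm{Fil}^r\Sigma\}$, $\varphi_r^\vee(f)(\varphi_r(x))=\varphi_r(f(x))$ for $f\in\mathrm{Fil}^rM^\vee$, $x\in\mathrm{Fil}^rM$. *)

(* Defs.v *)
From HB Require Import structures.
From mathcomp Require Import all_boot all_order all_algebra.
From mathcomp Require Import boolp classical_sets functions.

Set Implicit Arguments.
Unset Strict Implicit.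
Unset Printing Implicit Defensive.

Import GRing.Theory.

Local Open Scope ring_scope.

Definition dvd_ppow (p : nat) (A : comNzRingType) (n : nat) (x : A) : Prop :=
  exists y : A, x = p%:R ^+ n * y.

Definition padically_complete (p : nat) (A : comNzRingType) : Prop :=
  (forall x : A, (forall n, dvd_ppow p n x) -> x = 0) /\
  (forall a : nat -> A, (forall n, dvd_ppow p n (a n.+1 - a n)) ->
     exists l : A, forall n, dvd_ppow p n (l - a n)).

(* B is the p-adic completion of A along f: B is p-adically complete and
   separated, and f induces isomorphisms A / p^n A -> B / p^n B. *)
Definition is_padic_completion (p : nat) (A B : comNzRingType)
    (f : {rmorphism A -> B}) : Prop :=
  [/\ padically_complete p B,
      forall n (a : A), dvd_ppow p n (f a) -> dvd_ppow p n a
    & forall n (b : B), exists a : A, dvd_ppow p n (b - f a)].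

Definition perfect_field (p : nat) (k : fieldType) : Prop :=
  forall x : k, exists y : k, y ^+ p = x.

(* For k perfect of characteristic p, W(k) is, up to unique isomorphism, the
   strict p-ring with residue ring k: p-torsion free, p-adically complete and
   separated, with W / pW = k. *)
Definition is_witt_vectors (p : nat) (k : fieldType) (W : idomainType)
    (res : {rmorphism W -> k}) : Prop :=
  [/\ p%:R != 0 :> W,
      padically_complete p W,
      forall x : k, exists w : W, res w = x
    & forall w : W, res w = 0 <-> exists v : W, w = p%:R * v].

Definition eisenstein (p : nat) (W : idomainType) (E : {poly W}) : Prop :=
  [/\ E \is monic,
      (1 < size E)%N,
      forall i, (i < (size E).-1)%N -> dvd_ppow p 1 E`_i
    & ~ dvd_ppow p 2 E`_0].

Section DividedPowerEnvelope.
Variables (W : idomainType) (E : {poly W}).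

Let K := {fraction W}.

Definition frac_poly (a : {poly W}) : {poly K} := map_poly (@tofrac W) a.

Definition dpow (n : nat) : {poly K} := (n`!%:R)^-1 *: frac_poly E ^+ n.

Definition subring_set (A : {poly K} -> Prop) : Prop :=
  [/\ A 1, forall x y, A x -> A y -> A (x - y)
    & forall x y, A x -> A y -> A (x * y)].

(* The divided power envelope of (E) in W[u], for W = W(k) and E Eisenstein.
   Since W[u] and W[u]/(E) are torsion free, it is the W[u]-subalgebra of
   W[1/p][u] generated by the E^n / n!.  *)
Definition pd_pred : pred {poly K} := fun x =>
  `[< forall A : {poly K} -> Prop, subring_set A ->
        (forall a, A (frac_poly a)) -> (forall n, A (dpow n)) -> A x >].

Record pdenv : Type := PDEnv { pdval :> {poly K}; _ : pd_pred pdval }.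

HB.instance Definition _ := [isSub for pdval].
HB.instance Definition _ := [Choice of pdenv by <:].

Fact pd_subring_closed : subring_closed pd_pred.
Proof.
split.
- by apply/asboolP => A [].
- move=> x y /asboolP hx /asboolP hy; apply/asboolP => A hA h1 h2.
  by case: (hA) => _ hB _; apply: hB; [apply: hx | apply: hy].
- move=> x y /asboolP hx /asboolP hy; apply/asboolP => A hA h1 h2.
  by case: (hA) => _ _ hM; apply: hM; [apply: hx | apply: hy].
Qed.

HB.instance Definition _ :=
  GRing.isSubringClosed.Build {poly K} pd_pred pd_subring_closed.
HB.instance Definition _ := [SubChoice_isSubComNzRing of pdenv by <:].

Fact pd_of_proof (a : {poly W}) : pd_pred (frac_poly a).
Proof. by apply/asboolP => A _ h _; apply: h. Qed.

Definition pd_of (a : {poly W}) : pdenv := PDEnv (pd_of_proof a).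

Fact pd_dpow_proof (n : nat) : pd_pred (dpow n).
Proof. by apply/asboolP => A _ _ h; apply: h. Qed.

Definition pd_dpow (n : nat) : pdenv := PDEnv (pd_dpow_proof n).

Definition fil_pd (j : nat) (x : pdenv) : Prop :=
  exists (n : nat) (a : nat -> pdenv), x = \sum_(j <= i < n) a i * pd_dpow i.

End DividedPowerEnvelope.

(* R[[Y]], a series being given by its sequence of coefficients. *)
Definition fps (R : Type) : Type := nat -> R.

Section PowerSeries.
Variable R : comNzRingType.

HB.instance Definition _ := GRing.Zmodule.copy (fps R) (nat -> R).

Definition fps_mul (f g : fps R) : fps R :=
  fun n => \sum_(i < n.+1) f i * g (n - i)%N.

Definition fpsC (a : R) : fps R := fun n => if n == 0%N then a else 0.

Definition fpsY : fps R := fun n => (n == 1%N)%:R.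

Let tr (N : nat) (f : fps R) : {poly R} := \poly_(i < N) f i.

Let trM N f g i : (i < N)%N -> (tr N f * tr N g)`_i = fps_mul f g i.
Proof.
move=> iN; rewrite coefM; apply: eq_bigr => j _; rewrite !coef_poly.
rewrite (leq_ltn_trans _ iN) ?(leq_ltn_trans _ iN) ?leq_subr //.
by rewrite -ltnS ltn_ord.
Qed.

Let coefM_lt (N : nat) (a a' b b' : {poly R}) i : (i < N)%N ->
  (forall j, (j < N)%N -> a`_j = a'`_j) ->
  (forall j, (j < N)%N -> b`_j = b'`_j) -> (a * b)`_i = (a' * b')`_i.
Proof.
move=> iN ha hb; rewrite !coefM; apply: eq_bigr => j _.
rewrite ha ?hb // ?(leq_ltn_trans _ iN) ?leq_subr //.
by rewrite -ltnS ltn_ord.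
Qed.

Let tr_mul N f g i : (i < N)%N -> (tr N (fps_mul f g))`_i = (tr N f * tr N g)`_i.
Proof. by move=> iN; rewrite trM // coef_poly iN. Qed.

Fact fps_mulC : commutative fps_mul.
Proof.
by move=> f g; apply/funext => n; rewrite -!(@trM n.+1) // mulrC.
Qed.

Fact fps_mulA : associative fps_mul.
Proof.
move=> f g h; apply/funext => n; rewrite -!(@trM n.+1) //.
rewrite (@coefM_lt n.+1 _ (tr n.+1 f) _ (tr n.+1 g * tr n.+1 h)) //;
  last by move=> j; apply: tr_mul.
rewrite mulrA; apply/esym; apply: (@coefM_lt n.+1) => // j; exact: tr_mul.
Qed.

Fact fps_mul1 : left_id (fpsC 1) fps_mul.
Proof.
move=> f; apply/funext => n; rewrite /fps_mul big_ord_recl /= subn0.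
by rewrite {1}/fpsC eqxx mul1r big1 ?addr0 // => i _; rewrite /fpsC /= mul0r.
Qed.

Fact fps_mulDl : left_distributive fps_mul +%R.
Proof.
move=> f g h; apply/funext => n.
rewrite [RHS](_ : _ = fps_mul f h n + fps_mul g h n) // -big_split /=.
by apply: eq_bigr => i _; rewrite -mulrDl.
Qed.

Fact fps_1_neq0 : fpsC 1 != 0 :> fps R.
Proof.
by apply/eqP => /(congr1 (fun f : fps R => f 0%N)) /eqP; rewrite oner_eq0.
Qed.

HB.instance Definition _ := GRing.Zmodule_isComNzRing.Build (fps R)
  fps_mulA fps_mulC fps_mul1 fps_mulDl fps_1_neq0.

End PowerSeries.

Section SigmaRing.
Variables (p : nat) (W : idomainType) (E : {poly W}).

Definition fps_poly (a : {poly W}) : {poly fps W} := map_poly (@fpsC W) a.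

Definition Sigma_modulus : {poly fps W} :=
  fps_poly E ^+ p - (p%:R * fpsY W)%:P.

(* Sigma_modulus is monic of positive degree when E is Eisenstein and p > 0,
   so that {poly %/ Sigma_modulus} is the quotient by it. *)
Definition Sigma : comNzRingType := {poly %/ Sigma_modulus}.

Definition Sigma_of (a : {poly W}) : Sigma :=
  in_qpoly Sigma_modulus (fps_poly a).

Definition Sigma_Y : Sigma := in_qpoly Sigma_modulus (fpsY W)%:P.

End SigmaRing.

(* W(k), S and Sigma with their Frobenius maps.  The equations determine all the
   maps: S is p-torsion free, embS is injective, every ring endomorphism of S is
   p-adically continuous, and embS respects infinite sums in Y because
   embS(Y)^n = ((pn)! / p^n) * (E^(pn) / (pn)!) tends to 0. *)
Record breuil_data (p : nat) (k : fieldType) := BreuilData {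
  Wk : idomainType;
  residue : {rmorphism Wk -> k};
  residueP : is_witt_vectors p residue;
  frobW : {rmorphism Wk -> Wk};
  frobW_residue : forall w, residue (frobW w) = residue w ^+ p;
  Eu : {poly Wk};
  Eu_eisenstein : eisenstein p Eu;
  Sring : comNzRingType;
  envS : {rmorphism pdenv Eu -> Sring};
  envS_completion : is_padic_completion p envS;
  phiS : {rmorphism Sring -> Sring};
  phiS_W : forall w : Wk, phiS (envS (pd_of Eu w%:P)) = envS (pd_of Eu (frobW w)%:P);
  phiS_u : phiS (envS (pd_of Eu 'X)) = envS (pd_of Eu 'X) ^+ p;
  embS : {rmorphism Sigma p Eu -> Sring};
  embS_Wu : forall a : {poly Wk}, embS (Sigma_of p Eu a) = envS (pd_of Eu a);
  embS_Y : p%:R * embS (Sigma_Y p Eu) = envS (pd_of Eu Eu) ^+ p;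
  phi_Sigma : {rmorphism Sigma p Eu -> Sigma p Eu};
  phi_SigmaP : forall s, embS (phi_Sigma s) = phiS (embS s)
}.

Section BreuilModules.
Variables (p : nat) (k : fieldType) (B : breuil_data p k) (r : nat).

Local Notation Sg := (Sigma p (Eu B)).

(* Closure of the image of Fil^j of the envelope, i.e. its p-adic completion
   (the quotient of the envelope by it is p-torsion free). *)
Definition fil_S (j : nat) (s : Sring B) : Prop :=
  forall n, exists2 d : pdenv (Eu B), fil_pd j d & dvd_ppow p n (s - envS B d).

Definition fil_Sigma (j : nat) : set Sg := [set s | fil_S j (embS B s)].

Definition Sigma_E : Sg := Sigma_of p (Eu B) (Eu B).

(* p^-n * s; Sigma is p-torsion free, and the default value 0 is only taken
   when p^n does not divide s. *)
Definition pdiv_Sigma (n : nat) (s : Sg) : Sg :=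
  xget 0 [set t | p%:R ^+ n * t = s].

Definition c_Sigma : Sg := pdiv_Sigma 1 (phi_Sigma B Sigma_E).

Definition c_inv : Sg := xget 0 [set t | c_Sigma * t = 1].

Definition phi_r (s : Sg) : Sg := pdiv_Sigma r (phi_Sigma B s).

(* Raw data (M, Fil^r M, phi_r).  mod_phi is total; only its values on mod_fil
   are meaningful. *)
Record premod := PreMod {
  mod_sort :> lmodType Sg;
  mod_fil : set mod_sort;
  mod_phi : mod_sort -> mod_sort
}.

Implicit Types M N : premod.

(* Fil^r Sigma . M *)
Definition fil_Sigma_span M : set M :=
  [set x | exists (n : nat) (s : 'I_n -> Sg) (y : 'I_n -> M),
     (forall i, fil_Sigma r (s i)) /\ x = \sum_i s i *: y i].

Record is_Mod M : Prop := IsMod {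
  mod_free : exists (n : nat) (e : 'I_n -> M),
    forall x : M, exists! a : 'rV[Sg]_n, x = \sum_i a 0 i *: e i;
  mod_fil_submod : forall (a : Sg) (x y : M),
    mod_fil x -> mod_fil y -> mod_fil (a *: x + y);
  mod_fil_ge : forall x : M, fil_Sigma_span x -> mod_fil x;
  mod_phiD : forall x y : M, mod_fil x -> mod_fil y ->
    mod_phi (x + y) = mod_phi x + mod_phi y;
  mod_phiZ : forall (a : Sg) (x : M), mod_fil x ->
    mod_phi (a *: x) = phi_Sigma B a *: mod_phi x;
  mod_phi_compat : forall (s : Sg) (x : M), fil_Sigma r s ->
    mod_phi (s *: x) = (c_inv ^+ r * phi_r s) *: mod_phi (Sigma_E ^+ r *: x);
  mod_phi_gen : forall x : M,
    exists (n : nat) (a : 'I_n -> Sg) (y : 'I_n -> M),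
      (forall i, mod_fil (y i)) /\ x = \sum_i a i *: mod_phi (y i);
  mod_fil_tf : forall x : M, mod_fil (p%:R *: x) -> mod_fil x
}.

Definition is_mod_morphism M N (f : {linear M -> N}) : Prop :=
  (forall x : M, mod_fil x -> mod_fil (f x)) /\
  (forall x : M, mod_fil x -> f (mod_phi x) = mod_phi (f x)).

Record short_exact (M1 M M2 : premod)
    (f : {linear M1 -> M}) (g : {linear M -> M2}) : Prop := ShortExact {
  se_Mod1 : is_Mod M1;
  se_Mod : is_Mod M;
  se_Mod2 : is_Mod M2;
  se_morl : is_mod_morphism f;
  se_morr : is_mod_morphism g;
  se_inj : injective f;
  se_mid : forall x : M, g x = 0 <-> exists y : M1, f y = x;
  se_surj : forall z : M2, exists x : M, g x = z;
  se_fil_mid : forall x : M, mod_fil x -> g x = 0 ->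
    exists2 y : M1, mod_fil y & f y = x;
  se_fil_surj : forall z : M2, mod_fil z -> exists2 x : M, mod_fil x & g x = z
}.

Definition is_etale M : Prop := forall x : M, mod_fil x.

Definition is_multiplicative M : Prop :=
  forall x : M, mod_fil x <-> fil_Sigma_span x.

Definition is_nilpotent M : Prop :=
  forall (M1 M2 : premod) (f : {linear M1 -> M}) (g : {linear M -> M2}),
    short_exact f g -> is_multiplicative M1 -> forall x : M1, x = 0.

Definition is_unipotent M : Prop :=
  forall (M1 M2 : premod) (f : {linear M1 -> M}) (g : {linear M -> M2}),
    short_exact f g -> is_etale M2 -> forall x : M2, x = 0.

(* The image of f is the largest multiplicative submodule of M. *)
Definition maximal_multiplicative M1 M (f : {linear M1 -> M}) : Prop :=
  forall (N1 N2 : premod) (f' : {linear N1 -> M}) (g' : {linear M -> N2}),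
    short_exact f' g' -> is_multiplicative N1 ->
    forall y : N1, exists x : M1, f x = f' y.

(* 0 -> M1 -> M -> M2 -> 0 is the sequence 0 -> M^m -> M -> M^nil -> 0. *)
Definition mult_nil_sequence (M1 M M2 : premod)
    (f : {linear M1 -> M}) (g : {linear M -> M2}) : Prop :=
  [/\ short_exact f g, is_multiplicative M1, is_nilpotent M2
    & maximal_multiplicative f].

Section CartierDual.
Variable M : premod.

Definition dual_pred : pred (M -> Sg^o) := fun f => `[< linear f >].

Record dual_sort : Type := Dual { dual_fun :> M -> Sg^o; _ : dual_pred dual_fun }.

HB.instance Definition _ := [isSub for dual_fun].
HB.instance Definition _ := [Choice of dual_sort by <:].

Fact dual_submod_closed : submod_closed dual_pred.
Proof.
split=> [|a f g /asboolP hf /asboolP hg].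
  by apply/asboolP => b x y; rewrite /= scaler0 addr0.
apply/asboolP => b x y.
rewrite [LHS](_ : _ = a *: f (b *: x + y) + g (b *: x + y)) //.
rewrite [RHS](_ : _ = b *: (a *: f x + g x) + (a *: f y + g y)) //.
rewrite hf hg !scalerDr !scalerA [b * a]mulrC -!addrA; congr (_ + _).
by rewrite addrCA.
Qed.

HB.instance Definition _ :=
  GRing.isSubmodClosed.Build Sg (M -> Sg^o) dual_pred dual_submod_closed.
HB.instance Definition _ := [SubChoice_isSubLmodule of dual_sort by <:].

Definition dual_fil : set dual_sort :=
  [set f | forall x : M, mod_fil x -> fil_Sigma r (f x)].

(* Unique, as phi_r(Fil^r M) generates M; the default value 0 is irrelevant. *)
Definition dual_phi (f : dual_sort) : dual_sort :=
  xget (0 : dual_sort)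
    [set g : dual_sort | forall x : M, mod_fil x -> g (mod_phi x) = phi_r (f x)].

Definition cartier_dual : premod := PreMod dual_fil dual_phi.

End CartierDual.

(* 0 -> M2^v -> M -> M1^v -> 0 is the Cartier dual of 0 -> M1 -> M^v -> M2 -> 0,
   M being identified with its bidual by evaluation. *)
Definition dual_sequence (M1 M M2 : premod)
    (f : {linear M1 -> cartier_dual M}) (g : {linear cartier_dual M -> M2})
    (a : {linear cartier_dual M2 -> M}) (b : {linear M -> cartier_dual M1}) :
    Prop :=
  (forall (h : cartier_dual M2) (l : cartier_dual M), l (a h) = h (g l)) /\
  (forall (x : M) (y : M1), b x y = f y x).

End BreuilModules.

(* Main.v *)
(* On a Breuil module M put F(x) = phi_r(E^r x).  Fil^r M is spanned modulo Y by
   the rows of a matrix A with A B = B A = E^r, because Fil^r M modulo (p, Y) is a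
   submodule of a free module over k[u]/(u^(ep)) and lifts p-adically.  If phi_r
   sends these rows to the rows of an invertible X, then F has matrix phi(B) X,
   and the dual of M is obtained by exchanging A and B and transposing.

   Modulo the maximal ideal, the row space of a high iterate of F is the largest
   subspace on which F is bijective; it lifts to a direct summand of M by a
   fixed-point iteration that converges p-adically, since phi^n maps the maximal
   ideal into (p).  On that summand B is invertible, so that it splits off as a
   filtered module.  It is M^m, and on the quotient F is topologically nilpotent,
   which leaves no room for a nonzero morphism from a multiplicative module.  As
   the splitting respects Fil^r, dualizing preserves exactness, and the assertions
   on unipotent and etale modules are those on nilpotent and multiplicative ones
   for the dual. *)

From HB Require Import structures.
Require Import Defs.
From mathcomp Require Import all_boot all_order all_algebra.
From mathcomp Require Import boolp classical_sets functions.
From mathcomp Require Import ring zify.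

Set Implicit Arguments.
Unset Strict Implicit.
Unset Printing Implicit Defensive.

Import GRing.Theory.

Local Open Scope ring_scope.

(** * The divided power envelope *)

(** The filtration of $\Sigma$ is defined through $S$, so it has to be made explicit. The key fact
    is $W[u]\cap\mathrm{Fil}^jS=E^jW[u]$, which survives $p$-adic closure because $j!$ bounds the
    denominators of remainders modulo $E^j$. It yields the injectivity of $\Sigma\to S$, the formula
    $\mathrm{Fil}^r\Sigma=(E^r,Y)$ and $W[u]\cap Y\Sigma=E^pW[u]$. The bound $r<p$ is felt twice:
    $\varphi(Y)=p^{p-1}c^p$ is divisible by $p^r$, and a factorization of $E^r$ known modulo $Y$
    between matrices over $W[u]$ holds up to a factor $1+E^{p-r}G$, which is invertible. Nilpotency
    is defined by short exact sequences, which are hard to produce from a given morphism. It is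
    handled through the vanishing of all morphisms from multiplicative modules, a condition that
    composes well. The projection of $M$ onto $M^{\mathrm m}$ respects $\mathrm{Fil}^r$ but in
    general not $\varphi_r$. This suffices for duality, where it only serves to extend functionals
    within the filtration. *)

Section DvdPpow.
Variables (p : nat) (A : comNzRingType).
Implicit Types (n m : nat) (x y : A).

Lemma dvd_ppowD n x y : dvd_ppow p n x -> dvd_ppow p n y -> dvd_ppow p n (x + y).
Proof. by move=> [a ->] [b ->]; exists (a + b); rewrite mulrDr. Qed.

End DvdPpow.

Section Envelope.
Import Pdiv.CommonRing Pdiv.RingMonic.

Variables (p : nat) (W : idomainType) (E : {poly W}).
Hypothesis E_monic : E \is monic.
Hypothesis W_nat : forall n, (0 < n)%N -> n%:R != 0 :> W.

Local Notation K := {fraction W}.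

HB.instance Definition _ := GRing.RMorphism.copy (@frac_poly W) (map_poly (@tofrac W)).

Lemma tofrac_inj : injective (@tofrac W).
Proof. by move=> x y /eqP; rewrite tofrac_eq => /eqP. Qed.

Lemma frac_poly_inj : injective (@frac_poly W).
Proof. exact: (map_inj_poly tofrac_inj (rmorph0 _)). Qed.

Lemma fracK_nat n : (0 < n)%N -> n%:R != 0 :> K.
Proof.
by move=> n0; rewrite -(rmorph_nat (@tofrac W)) tofrac_eq0 W_nat.
Qed.

Lemma fact_dpow n : n`!%:R * dpow E n = frac_poly E ^+ n.
Proof.
rewrite /dpow -scalerAr mulr_natl -scaler_nat scalerA mulVf ?scale1r //.
by rewrite fracK_nat ?fact_gt0.
Qed.

Lemma polyK_nat n : (0 < n)%N -> n%:R != 0 :> {poly K}.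
Proof. by move=> n0; rewrite -polyC_natr polyC_eq0 fracK_nat. Qed.

Lemma dpowM i j : dpow E i * dpow E j = 'C(i + j, i)%:R * dpow E (i + j).
Proof.
apply: (mulfI (polyK_nat (fact_gt0 i))); apply: (mulfI (polyK_nat (fact_gt0 j))).
rewrite [LHS](_ : _ = (i`!%:R * dpow E i) * (j`!%:R * dpow E j)); last by ring.
rewrite !fact_dpow -exprD -fact_dpow.
have := @bin_fact (i + j) i (leq_addr _ _); rewrite addKn => <-.
by rewrite !natrM; ring.
Qed.

(** The envelope is defined as an intersection of subrings; this description as a $W[u]$-span of
    divided powers allows induction on its elements. It is a subring because a product of two
    divided powers is a binomial multiple of a third. *)
Inductive dpow_span : {poly K} -> Prop :=
| dpow_span_gen a i : dpow_span (frac_poly a * dpow E i)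
| dpow_spanD x y : dpow_span x -> dpow_span y -> dpow_span (x + y).

Lemma dpow_span_subring : subring_set dpow_span.
Proof.
have spM0 a i x : dpow_span x -> dpow_span (frac_poly a * dpow E i * x).
  elim=> [b j|y z _ hy _ hz]; last by rewrite mulrDr; apply: dpow_spanD.
  have -> : frac_poly a * dpow E i * (frac_poly b * dpow E j) =
    frac_poly a * frac_poly b * (dpow E i * dpow E j) by ring.
  rewrite dpowM mulrA -(rmorph_nat (@frac_poly W)) -!rmorphM.
  exact: dpow_span_gen.
have dpow0 : dpow E 0 = 1 by rewrite /dpow expr0 fact0 invr1 scale1r.
split=> [|x y hx hy|x y].
- by have := dpow_span_gen 1 0; rewrite rmorph1 mul1r dpow0.
- apply: dpow_spanD => //.
  have := spM0 (-1) 0%N _ hy; by rewrite dpow0 mulr1 rmorphN1 mulN1r.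
- move=> hx hy; elim: hx => [a i|u v _ hu _ hv]; first exact: spM0.
  by rewrite mulrDl; apply: dpow_spanD.
Qed.

Lemma pd_span (x : pdenv E) : dpow_span (pdval x).
Proof.
case: x => x /= /asboolP hx; apply: hx; first exact: dpow_span_subring.
- move=> a; have := dpow_span_gen a 0.
  by rewrite /dpow expr0 fact0 invr1 scale1r mulr1.
- by move=> n; have := dpow_span_gen 1 n; rewrite rmorph1 mul1r.
Qed.

Lemma dpow_leq j n : (j <= n)%N -> exists q, dpow E n = q * frac_poly E ^+ j.
Proof.
move=> jn; exists ((n`!%:R)^-1 *: frac_poly E ^+ (n - j)).
by rewrite -scalerAl -exprD subnK.
Qed.

(** Divided powers of index at most $j$ have denominators dividing $j!$, and those of larger index
    are multiples of $E^j$ over the fraction field. So the remainder modulo $E^j$ has a denominator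
    bounded independently of the element. *)
Lemma pd_bounded_denominator j (x : pdenv E) :
  exists (w : {poly W}) (q : {poly K}),
    j`!%:R * pdval x = frac_poly w + q * frac_poly E ^+ j.
Proof.
elim: (pd_span x) => [a i|y z _ [w [q hw]] _ [w' [q' hw']]]; last first.
  by exists (w + w'), (q + q'); rewrite mulrDr hw hw' rmorphD mulrDl addrACA.
have [ij|ji] := leqP i j; last first.
  have [q ->] := dpow_leq (ltnW ji).
  by exists 0, (j`!%:R * frac_poly a * q); rewrite rmorph0 add0r !mulrA.
exists ((j ^_ (j - i))%:R * a * E ^+ i), 0; rewrite mul0r addr0.
rewrite !rmorphM rmorph_nat rmorphXn /= -fact_dpow.
have -> : j`! = (j ^_ (j - i) * i`!)%N by rewrite -[in i`!](subKn ij) ffact_fact ?leq_subr.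
by rewrite natrM; ring.
Qed.

Lemma monic_frac : frac_poly E \is monic.
Proof. by rewrite /frac_poly monic_map. Qed.

Lemma frac_multiple_small j (w : {poly W}) (q : {poly K}) :
  (size w < size (E ^+ j))%N -> frac_poly w = q * frac_poly E ^+ j -> w = 0.
Proof.
move=> sw hw; apply: frac_poly_inj; rewrite rmorph0 hw.
have [->|q0] := eqVneq q 0; first by rewrite mul0r.
move: sw; rewrite ltnNge => /negP[].
have m : frac_poly E ^+ j \is monic by rewrite monic_exp ?monic_frac.
have sz (a : {poly W}) : size (frac_poly a) = size a.
  by rewrite /frac_poly size_map_inj_poly ?rmorph0 //; apply: tofrac_inj.
rewrite -(sz w) -(sz (E ^+ j)) rmorphXn hw size_Mmonic //.
by move: q0; rewrite -size_poly_gt0; case: (size q) => // n _; rewrite addSn leq_addl.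
Qed.

Lemma fil_pdP j (d : pdenv E) :
  fil_pd j d -> exists q : {poly K}, pdval d = q * frac_poly E ^+ j.
Proof.
move=> [n [a ->]]; rewrite big_nat_cond; elim/big_rec: _ => [|i x /andP[/andP[ji _] _] [q hq]].
  by exists 0; rewrite mul0r.
have [q' hq'] := dpow_leq ji.
by exists (pdval (a i) * q' + q); rewrite /= hq hq' mulrDl mulrA.
Qed.

Lemma fil_pdD j (d e : pdenv E) : fil_pd j d -> fil_pd j e -> fil_pd j (d + e).
Proof.
have pad n (a : nat -> pdenv E) N : (n <= N)%N ->
    \sum_(j <= i < n) a i * pd_dpow E i =
    \sum_(j <= i < N) (if (i < n)%N then a i else 0) * pd_dpow E i.
  move=> nN; rewrite (big_nat_widen _ _ _ _ _ nN) big_mkcond /=.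
  by apply: eq_bigr => i _; case: ifP; rewrite ?mul0r.
move=> [n [a ->]] [m [b ->]].
rewrite (pad n a (maxn n m)) ?leq_maxl // (pad m b (maxn n m)) ?leq_maxr //.
rewrite -big_split /=; eexists (maxn n m), _.
by under eq_bigr => i _ do rewrite -mulrDl.
Qed.

Lemma fil_pdM j (d e : pdenv E) : fil_pd j d -> fil_pd j (e * d).
Proof.
move=> [n [a ->]]; rewrite mulr_sumr; exists n, (fun i => e * a i).
by apply: eq_bigr => i _; rewrite mulrA.
Qed.

Lemma fil_pd_dpow j n : (j <= n)%N -> fil_pd j (pd_dpow E n).
Proof.
move=> jn; exists n.+1, (fun i => (i == n)%:R).
rewrite big_nat_recr //= eqxx mul1r big_nat big1 ?add0r // => i /andP[_ ilt].
by rewrite (ltn_eqF ilt) mul0r.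
Qed.

Lemma pd_nat n (x : pdenv E) : (0 < n)%N -> n%:R * x = 0 -> x = 0.
Proof.
move=> n0 /(congr1 val); rewrite rmorphM rmorph_nat rmorph0 => /eqP.
by rewrite mulf_eq0 (negPf (polyK_nat n0)) /= => /eqP h; apply: val_inj.
Qed.

Lemma pd_of_is_zmod : zmod_morphism (@pd_of W E).
Proof. by move=> a b; apply: val_inj; rewrite /= rmorphB. Qed.

Lemma pd_of_is_monoid : monoid_morphism (@pd_of W E).
Proof.
by split=> [|a b]; apply: val_inj; rewrite /= ?rmorph1 ?rmorphM.
Qed.

HB.instance Definition _ :=
  GRing.isZmodMorphism.Build {poly W} (pdenv E) (@pd_of W E) pd_of_is_zmod.
HB.instance Definition _ :=
  GRing.isMonoidMorphism.Build {poly W} (pdenv E) (@pd_of W E) pd_of_is_monoid.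

Lemma pd_factX n : pd_of E (E ^+ n) = n`!%:R * pd_dpow E n.
Proof. by apply: val_inj; rewrite [RHS]rmorphM rmorph_nat /= fact_dpow rmorphXn. Qed.

(* A residue modulo E^j of degree < deg E^j, multiplied by j!, is determined in
   W[u]; so it vanishes when it is divisible by all powers of p. *)
Lemma pd_fil_closure j (a : {poly W}) :
  (forall w : W, (forall n, dvd_ppow p n w) -> w = 0) ->
  (forall n, exists2 d : pdenv E, fil_pd j d & dvd_ppow p n (pd_of E a - d)) ->
  exists b, a = b * E ^+ j.
Proof.
move=> sepW h; have Ej : E ^+ j \is monic by rewrite monic_exp.
have divE x := rdivp_eq Ej x; have szE x : (size (rmodp x (E ^+ j)) < size (E ^+ j))%N.
  by rewrite ltn_rmodp monic_neq0.
exists (rdivp a (E ^+ j)); rewrite [LHS]divE; set w := rmodp _ _.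
suff -> : w = 0 by rewrite addr0.
apply/polyP => i; rewrite coef0.
suff : j`!%:R * w`_i = 0.
  by move/eqP; rewrite mulf_eq0 (negPf (W_nat (fact_gt0 j))) => /eqP.
apply: sepW => n; have [d /fil_pdP[q hq] [y hy]] := h n.
have [w' [q' hw']] := pd_bounded_denominator j y.
move: hy => /(congr1 val); rewrite [RHS]rmorphM rmorphXn rmorph_nat /= hq.
move=> /eqP; rewrite subr_eq => /eqP ha.
have eqK : frac_poly (j`!%:R * w - p%:R ^+ n * rmodp w' (E ^+ j)) =
   (p%:R ^+ n * q' + p%:R ^+ n * frac_poly (rdivp w' (E ^+ j)) + j`!%:R * q
    - j`!%:R * frac_poly (rdivp a (E ^+ j))) * frac_poly E ^+ j.
  have ha2 := divE a; have hw2 := divE w'.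
  rewrite -/w in ha2; set w2 := rmodp w' _ in hw2 *.
  have ha3 : frac_poly w = frac_poly a - frac_poly (rdivp a (E ^+ j)) * frac_poly E ^+ j.
    by rewrite [in frac_poly a]ha2 rmorphD rmorphM rmorphXn /= addrC addKr.
  have hw3 : frac_poly w2 = frac_poly w' - frac_poly (rdivp w' (E ^+ j)) * frac_poly E ^+ j.
    by rewrite [in frac_poly w']hw2 rmorphD rmorphM rmorphXn /= addrC addKr.
  rewrite rmorphB !rmorphM rmorphXn !rmorph_nat /= ha3 hw3 ha.
  rewrite (_ : frac_poly w' = j`!%:R * pdval y - q' * frac_poly E ^+ j); last first.
    by rewrite hw' addrK.
  by ring.
move: eqK => /frac_multiple_small; rewrite (leq_ltn_trans (size_polyD _ _)); last first.
  have szN (x : {poly W}) b : (size x < b)%N -> forall m, (size (m%:R * x : {poly W})%R < b)%N.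
    move=> hx m; rewrite mulr_natl -scaler_nat; exact: leq_ltn_trans (size_scale_leq _ _) hx.
  by rewrite size_polyN -natrX gtn_max !szN ?szE.
move=> /(_ isT) /eqP; rewrite subr_eq0 => /eqP /(congr1 (fun x : {poly W} => x`_i)).
rewrite mulr_natl -natrX mulr_natl !coefMn -[in X in X = _]mulr_natl => ->.
by exists (rmodp w' (E ^+ j))`_i; rewrite -natrX mulr_natl.
Qed.

End Envelope.

(** * The ring Sigma *)

(** Stated for an arbitrary element, since both $p$ and $Y$ are used; at [p%:R] this and the next
    definition are convertible to [dvd_ppow] and [padically_complete]. *)
Definition adic_div (A : comNzRingType) (x : A) (n : nat) (y : A) : Prop :=
  exists z, y = x ^+ n * z.

Definition adically_complete (A : comNzRingType) (x : A) : Prop :=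
  (forall y, (forall n, adic_div x n y) -> y = 0) /\
  (forall a : nat -> A, (forall n, adic_div x n (a n.+1 - a n)) ->
     exists l, forall n, adic_div x n (l - a n)).

Lemma adic_series (A : comNzRingType) (x : A) (a : nat -> A) :
  adically_complete x ->
  exists l, forall n, adic_div x n (l - \sum_(i < n) x ^+ i * a i).
Proof.
move=> [_ cv]; apply: cv => n; exists (a n).
by rewrite big_ord_recr /= addrAC subrr add0r.
Qed.

(** The inverse is the geometric series $\sum_i(-xt)^i$, which converges $x$-adically. *)
Lemma adic_unit (A : comNzRingType) (x t : A) : adically_complete x ->
  exists y, (1 + x * t) * y = 1.
Proof.
move=> cA; have [l hl] := adic_series (fun i => (- t) ^+ i) cA.
exists l; apply/eqP; rewrite -subr_eq0; apply/eqP; apply: cA.1 => n.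
have [z hz] := hl n.
exists ((1 + x * t) * z - (- t) ^+ n).
have -> : l = x ^+ n * z + \sum_(i < n) (- (x * t)) ^+ i.
  move/eqP: hz; rewrite subr_eq => /eqP ->; congr (_ + _).
  by apply: eq_bigr => i _; rewrite -mulrN exprMn.
have := subrX1 (- (x * t)) n => hs.
have -> : (- t) ^+ n = (-1) ^+ n * t ^+ n by rewrite -exprMn mulN1r.
have {}hs : (1 + x * t) * \sum_(i < n) (- (x * t)) ^+ i = 1 - (- (x * t)) ^+ n.
  by rewrite -[RHS]opprB hs -[RHS]mulNr; congr (_ * _); ring.
rewrite mulrDr hs.
have -> : (- (x * t)) ^+ n = (-1) ^+ n * (x ^+ n * t ^+ n).
  by rewrite -!exprMn mulN1r.
by ring.
Qed.

(** * Formal power series: regularity and completeness for $p$ and $Y$ *)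

Section FormalPowerSeries.
Variable R : comNzRingType.
Implicit Types f g : fps R.

Lemma fpsD f g i : (f + g) i = f i + g i. Proof. by []. Qed.
Lemma fpsN f i : (- f) i = - f i. Proof. by []. Qed.
Lemma fpsC_is_zmod : zmod_morphism (@fpsC R).
Proof.
move=> a b; apply/funext => i; rewrite fpsD fpsN /fpsC.
by case: ifP => _; rewrite ?subr0.
Qed.

Lemma fpsCM a f i : (fpsC a * f) i = a * f i.
Proof.
rewrite [LHS](_ : _ = \sum_(j < i.+1) fpsC a j * f (i - j)%N) //.
rewrite big_ord_recl /= subn0 big1 ?addr0 // => j _.
by rewrite /fpsC /= mul0r.
Qed.

Lemma fpsC_is_monoid : monoid_morphism (@fpsC R).
Proof.
split=> // a b; apply/funext => i; rewrite fpsCM /fpsC.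
by case: ifP; rewrite ?mulr0.
Qed.

HB.instance Definition _ :=
  GRing.isZmodMorphism.Build R (fps R) (@fpsC R) fpsC_is_zmod.
HB.instance Definition _ :=
  GRing.isMonoidMorphism.Build R (fps R) (@fpsC R) fpsC_is_monoid.

Lemma fps_natXM m n f i : (m%:R ^+ n * f) i = m%:R ^+ n * f i.
Proof. by rewrite -(rmorph_nat (@fpsC R)) -rmorphXn /= fpsCM. Qed.

Lemma fpsYM f i : (fpsY R * f) i = if i is j.+1 then f j else 0.
Proof.
rewrite [LHS](_ : _ = \sum_(j < i.+1) fpsY R j * f (i - j)%N) //.
case: i => [|i]; first by rewrite big_ord1 /fpsY mul0r.
rewrite big_ord_recl {1}/fpsY mul0r add0r big_ord_recl /fpsY /= mul1r.
by rewrite big1 ?addr0 ?subSS ?subn0 // => j _; rewrite mul0r.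
Qed.

Lemma fpsYXM n f i : (fpsY R ^+ n * f) i = if (n <= i)%N then f (i - n)%N else 0.
Proof.
elim: n i => [|n IH] i; first by rewrite mul1r subn0.
by rewrite exprS -mulrA fpsYM; case: i => // i; rewrite IH ltnS subSS.
Qed.

Definition fps0 f : R := f 0%N.

Lemma fps0_is_zmod : zmod_morphism fps0. Proof. by []. Qed.
Lemma fps0_is_monoid : monoid_morphism fps0.
Proof.
split=> // f g; rewrite [LHS](_ : _ = \sum_(j < 1) f j * g (0 - j)%N) //.
by rewrite big_ord1.
Qed.

HB.instance Definition _ := GRing.isZmodMorphism.Build (fps R) R fps0 fps0_is_zmod.
HB.instance Definition _ :=
  GRing.isMonoidMorphism.Build (fps R) R fps0 fps0_is_monoid.

Definition fps_shift f : fps R := fun i => f i.+1.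

Lemma fps_shiftE f : f = fpsC (fps0 f) + fpsY R * fps_shift f.
Proof.
by apply/funext => i; rewrite fpsD fpsYM /fpsC; case: i => [|i]; rewrite ?addr0 ?add0r.
Qed.

Lemma fpsY_complete : adically_complete (fpsY R).
Proof.
split=> [f hf|a ha].
  apply/funext => i; have [g ->] := hf i.+1.
  by rewrite fpsYXM ltnn.
(* Consecutive terms from index $i+1$ on differ by multiples of $Y^{i+1}$, so the coefficient of
   index $i$ is stable from there. *)
exists (fun i => a i.+1 i) => n.
set l : fps R := (fun i => a i.+1 i); exists (fun i => (l - a n) (n + i)%N).
apply/funext => i; rewrite fpsYXM; case: leqP => [ni|ltin]; first by rewrite subnKC.
rewrite fpsD fpsN; apply/eqP; rewrite subr_eq0 /l eq_sym; apply/eqP.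
elim: n ltin => // n IH; rewrite ltnS leq_eqVlt => /predU1P[->//|ltin].
rewrite -IH //; apply/eqP; rewrite -subr_eq0; have [g hg] := ha n.
by have := congr1 (fun f : fps R => f i) hg; rewrite fpsD fpsN fpsYXM leqNgt ltin => ->.
Qed.

Lemma fps_padically_complete p : padically_complete p R -> padically_complete p (fps R).
Proof.
move=> [sepR cvR]; split=> [f hf|a ha].
  apply/funext => i; apply: sepR => n; have [g ->] := hf n.
  by exists (g i); rewrite fps_natXM.
have /choice[l hl] : forall i, exists l, forall n, dvd_ppow p n (l - a n i).
  move=> i; apply: cvR => n; have [g hg] := ha n.
  by exists (g i); rewrite -fps_natXM -hg.
exists l => n; have /choice[g hg] : forall i, exists z, l i - a n i = p%:R ^+ n * z.
  by move=> i; apply: hl.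
by exists g; apply/funext => i; rewrite fps_natXM fpsD fpsN hg.
Qed.

Lemma fps_nat_reg (n : nat) : (forall x : R, n%:R * x = 0 -> x = 0) ->
  forall f, n%:R * f = 0 -> f = 0.
Proof.
move=> h f hf; apply/funext => i; apply: h.
by rewrite -[n%:R]expr1 -fps_natXM expr1 hf.
Qed.

Lemma fpsY_reg f : fpsY R * f = 0 -> f = 0.
Proof.
move=> h; apply/funext => i.
by have := congr1 (fun f : fps R => f i.+1) h; rewrite fpsYM.
Qed.

End FormalPowerSeries.

(** * Transfer of regularity and completeness to polynomial quotients *)

Section QuotientPolynomials.
Import Pdiv.CommonRing Pdiv.RingMonic.

Variables (R : comNzRingType) (h : {poly R}).
Local Notation Q := {poly %/ h}.

Lemma in_qpolyK (s : Q) : in_qpoly h (s : {poly R}) = s.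
Proof. by apply: val_inj; rewrite /= rmodp_small ?size_mk_monic. Qed.

Lemma in_qpolyCM (c : R) (s : Q) : in_qpoly h c%:P * s = c *: s.
Proof.
by rewrite -[in LHS](in_qpolyK s) -in_qpolyM mul_polyC in_qpolyZ in_qpolyK.
Qed.

Lemma in_qpolyCM_coef (c : R) (s : Q) i : (in_qpoly h c%:P * s : Q)`_i = c * s`_i.
Proof. by rewrite in_qpolyCM poly_of_qpolyZ coefZ. Qed.

Lemma in_qpolyCXM_coef (c : R) n (s : Q) i :
  (in_qpoly h c%:P ^+ n * s : Q)`_i = c ^+ n * s`_i.
Proof. by rewrite -rmorphXn -polyC_exp in_qpolyCM_coef. Qed.

Lemma in_qpolyC_reg (c : R) : (forall x, c * x = 0 -> x = 0) ->
  forall s : Q, in_qpoly h c%:P * s = 0 -> s = 0.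
Proof.
move=> hc s hs; apply: val_inj; apply/polyP => i; rewrite /= coef0.
by apply: hc; rewrite -in_qpolyCM_coef hs coef0.
Qed.

(** A constant acts coefficientwise on reduced representatives, which have bounded degree, so limits
    can be taken coefficient by coefficient. *)
Lemma in_qpolyC_complete (c : R) : adically_complete c ->
  adically_complete (in_qpoly h c%:P : Q).
Proof.
move=> [sepR cvR].
have coefB (s t : Q) i : (s - t)`_i = s`_i - t`_i by rewrite -coefB.
split=> [s hs|a ha].
  apply: val_inj; apply/polyP => i; rewrite /= coef0; apply: sepR => n.
  by have [z ->] := hs n; exists z`_i; rewrite in_qpolyCXM_coef.
have /choice[l hl] : forall i, exists l, forall n, adic_div c n (l - (a n)`_i).
  move=> i; apply: cvR => n; have [z hz] := ha n.
  by exists z`_i; rewrite -coefB hz in_qpolyCXM_coef.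
pose d := (size (mk_monic h)).-1.
exists (npolyp d (\poly_(i < d) l i)) => n.
have /choice[z hz] : forall i, exists z, l i - (a n)`_i = c ^+ n * z.
  by move=> i; apply: hl.
exists (npolyp d (\poly_(i < d) z i)).
apply: val_inj; apply/polyP => i /=.
rewrite in_qpolyCXM_coef coefB !coef_npolyp !coef_poly.
case: ltnP => [lti|lei]; first exact: hz.
by rewrite mulr0 sub0r big_coef_npoly ?oppr0.
Qed.

End QuotientPolynomials.

(** Makes $E^{pn}/p^n$, the image of $Y^n$ in $S$, an integral multiple of the divided power of
    index $pn$. *)
Lemma dvdn_exp_fact p n : (0 < p)%N -> (p ^ n %| (p * n)`!)%N.
Proof.
move=> p0; elim: n => [|n IH]; first by rewrite dvd1n.
rewrite mulnS addnC -(prednK p0) addnS factS expnS prednK //.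
apply: dvdn_mul; first by rewrite -addnS prednK // dvdn_add ?dvdn_mulr.
apply: dvdn_trans IH _; rewrite -(bin_fact (leq_addr p.-1 (p * n))).
by rewrite dvdn_mull // dvdn_mulr.
Qed.

(** * The embedding of $\Sigma$ in $S$ and the induced filtration *)

Section SigmaRing.
Import Pdiv.CommonRing Pdiv.RingMonic.

Variables (p : nat) (k : fieldType) (B : breuil_data p k).
Hypothesis p_prime : prime p.
Hypothesis k_char : p \in [pchar k].

Local Notation W := (Wk B).
Local Notation E := (Eu B).
Local Notation Sg := (Sigma p E).
Local Notation of_W := (Sigma_of p E).
Local Notation Y := (Sigma_Y p E).
Local Notation modulus := (Sigma_modulus p E).
Local Notation res := (residue B).
Local Notation env a := (envS B (pd_of E a)).

Let p0 : (0 < p)%N. Proof. exact: prime_gt0. Qed.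

Let W_sep (w : W) : (forall n, dvd_ppow p n w) -> w = 0.
Proof. by have [_ [h _] _ _] := residueP B; apply: h. Qed.

Let W_p : p%:R != 0 :> W. Proof. by have [] := residueP B. Qed.

Lemma res_eq0 (w : W) : res w = 0 <-> exists v : W, w = p%:R * v.
Proof. by have [_ _ _] := residueP B. Qed.

Lemma W_nat_neq0 n : (0 < n)%N -> n%:R != 0 :> W.
Proof.
move=> n0; have := pfactor_coprime p_prime n0 => -[m cm ->].
rewrite natrM mulf_neq0 // ?natrX ?expf_neq0 //.
apply/eqP => m0; have /eqP : res m%:R = 0 by rewrite m0 rmorph0.
rewrite rmorph_nat -(dvdn_pcharf k_char) => /dvdnP[q mq].
by move: cm; rewrite mq prime_coprime // dvdn_mull.
Qed.

Let E_monic : E \is monic. Proof. by have [] := Eu_eisenstein B. Qed.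

Lemma res_E0 : res E`_0 = 0.
Proof.
have [_ s1 h _] := Eu_eisenstein B; apply/res_eq0.
have [|v] := h 0%N; first by case: (size E) s1 => [|[]].
by rewrite expr1; exists v.
Qed.

Let env_dvd n a : dvd_ppow p n (envS B a) -> dvd_ppow p n a.
Proof. by have [_ h _] := envS_completion B; apply: h. Qed.

Let env_approx n s : exists a, dvd_ppow p n (s - envS B a).
Proof. by have [_ _ h] := envS_completion B; apply: h. Qed.

(** Torsion freeness of the envelope passes to the completion: if $a$ approximates $s$ modulo
    $p^{n+1}$, then $pa$ is divisible by $p^{n+1}$ in $S$, hence in the envelope, so $p^n$ divides
    $a$ and $s$. *)
Lemma S_p_reg (s : Sring B) : p%:R * s = 0 -> s = 0.
Proof.
move=> ps; have [[sep _] _ _] := envS_completion B; apply: sep => n.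
have [a [z hz]] := env_approx n.+1 s.
have [|a' ha'] := @env_dvd n.+1 (p%:R * a).
  exists (- (p%:R * z)); rewrite rmorphM rmorph_nat.
  move/eqP: hz; rewrite subr_eq => /eqP hs.
  apply/eqP; rewrite -subr_eq0 mulrN opprK addrC mulrCA -mulrDr -hs; exact/eqP.
have {}ha' : a = p%:R ^+ n * a'.
  apply/eqP; rewrite -subr_eq0; apply/eqP.
  apply: (pd_nat W_nat_neq0 p0).
  by rewrite mulrBr ha' exprS mulrA subrr.
exists (p%:R * z + envS B a'); move/eqP: hz; rewrite subr_eq => /eqP ->.
by rewrite ha' rmorphM rmorphXn rmorph_nat exprSr mulrDr mulrA.
Qed.

Lemma S_pX_reg n (s : Sring B) : p%:R ^+ n * s = 0 -> s = 0.
Proof.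
by elim: n => [|n IH]; rewrite ?mul1r // exprS -mulrA => /S_p_reg.
Qed.

Lemma fil_SD j (s t : Sring B) : fil_S j s -> fil_S j t -> fil_S j (s + t).
Proof.
move=> hs ht n; have [d hd ds] := hs n; have [e he et] := ht n.
exists (d + e); first exact: fil_pdD.
by rewrite rmorphD opprD addrACA; apply: dvd_ppowD.
Qed.

Lemma fil_SM j (s t : Sring B) : fil_S j s -> fil_S j (t * s).
Proof.
move=> hs n; have [d hd [z hz]] := hs n; have [e [y hy]] := env_approx n t.
exists (e * d); first exact: fil_pdM.
exists (t * z + y * envS B d).
have -> : t * s - envS B (e * d) = t * (s - envS B d) + (t - envS B e) * envS B d.
  by rewrite rmorphM; ring.
by rewrite hz hy; ring.
Qed.

Lemma fil_S_env_pd j d : fil_pd j d -> fil_S j (envS B d).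
Proof. by move=> hd n; exists d => //; rewrite subrr; exists 0; rewrite mulr0. Qed.

(** Turns membership questions in $S$ into divisibility in $W[u]$. Congruences modulo $p^n$ in $S$
    descend to the envelope, where [pd_fil_closure] applies. *)
Lemma fil_S_base j (a : {poly W}) : fil_S j (env a) <-> exists b, a = b * E ^+ j.
Proof.
split=> [h|[b ->]]; last first.
  rewrite !rmorphM /=; apply: fil_SM; rewrite (pd_factX _ W_nat_neq0) rmorphM.
  by apply: fil_SM; apply: fil_S_env_pd; apply: fil_pd_dpow.
apply: (pd_fil_closure E_monic W_nat_neq0 W_sep) => n.
have [d hd hd'] := h n; exists d => //; apply: env_dvd.
by rewrite rmorphB.
Qed.

(** The multiplier is $(pn)!/p^n$; the identity is checked after multiplication by $p^n$, where
    $pY=E^p$ can be used. *)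
Lemma embS_YX n : exists q : nat, embS B Y ^+ n = q%:R * envS B (pd_dpow E (p * n)).
Proof.
have /dvdnP[q hq] := dvdn_exp_fact n p0; exists q.
apply/eqP; rewrite -subr_eq0; apply/eqP; apply: (@S_pX_reg n).
rewrite mulrBr -exprMn embS_Y mulrA -natrX -natrM mulnC -hq.
rewrite -[X in _ - X * _](rmorph_nat (envS B)) -rmorphM -(pd_factX _ W_nat_neq0).
by rewrite -exprM !rmorphXn subrr.
Qed.

Lemma fil_S_YX j n t : (j <= p * n)%N -> fil_S j (embS B (Y ^+ n * t)).
Proof.
move=> jn; have [q hq] := embS_YX n; rewrite rmorphM rmorphXn hq mulrC.
by do 2!apply: fil_SM; apply: fil_S_env_pd; apply: fil_pd_dpow.
Qed.

Let fpsE_monic : fps_poly E \is monic.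
Proof. by rewrite /fps_poly monic_map. Qed.

Let size_fpsE : (1 < size (fps_poly E))%N.
Proof.
have [_ s1 _ _] := Eu_eisenstein B.
rewrite /fps_poly size_map_poly_id0 // (eqP E_monic) rmorph1.
exact: oner_neq0.
Qed.

Let size_fpsEX m : (0 < m)%N -> (1 < size (fps_poly E ^+ m))%N.
Proof.
case: m => // n _; rewrite exprS size_Mmonic ?monic_exp ?monic_neq0 //.
have := size_fpsE; have : (0 < size (fps_poly E ^+ n))%N.
  by rewrite size_poly_gt0 monic_neq0 ?monic_exp.
by lia.
Qed.

Lemma modulus_monic : (1 < size modulus)%N && (modulus \is monic).
Proof.
have h : (size (- (p%:R * fpsY W)%:P : {poly fps W})%R < size (fps_poly E ^+ p))%N.
  by rewrite size_polyN (leq_ltn_trans (size_polyC_leq1 _)) ?size_fpsEX.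
by rewrite size_polyDl // size_fpsEX // monicE lead_coefDl // -monicE monic_exp.
Qed.

Let mk_modulus : mk_monic modulus = modulus.
Proof. by rewrite /mk_monic modulus_monic. Qed.

Lemma of_W_is_zmod : zmod_morphism of_W.
Proof. by move=> a b; rewrite /Sigma_of /fps_poly !rmorphB. Qed.

Lemma of_W_is_monoid : monoid_morphism of_W.
Proof.
by split=> [|a b]; rewrite /Sigma_of /fps_poly ?rmorph1 ?rmorphM.
Qed.

HB.instance Definition _ := GRing.isZmodMorphism.Build {poly W} Sg of_W of_W_is_zmod.
HB.instance Definition _ := GRing.isMonoidMorphism.Build {poly W} Sg of_W of_W_is_monoid.

Lemma Sigma_natE n : (n%:R : Sg) = in_qpoly modulus (n%:R)%:P.
Proof. by rewrite polyC_natr rmorph_nat. Qed.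

Lemma Sigma_E_pY : of_W E ^+ p = p%:R * Y.
Proof.
have : in_qpoly modulus (fps_poly E ^+ p - (p%:R * fpsY W)%:P) = 0.
  apply: val_inj; rewrite /= mk_modulus rmodpp //.
  by case/andP: modulus_monic.
rewrite rmorphB rmorphXn polyCM rmorphM polyC_natr rmorph_nat => /eqP.
by rewrite subr_eq0 => /eqP.
Qed.

Lemma Sigma_p_reg (s : Sg) : p%:R * s = 0 -> s = 0.
Proof.
rewrite Sigma_natE; apply: in_qpolyC_reg; apply: fps_nat_reg => w.
by move=> /eqP; rewrite mulf_eq0 (negPf W_p) => /eqP.
Qed.

Lemma Sigma_Y_reg (s : Sg) : Y * s = 0 -> s = 0.
Proof. by apply: in_qpolyC_reg; apply: fpsY_reg. Qed.

Lemma Sigma_p_complete : padically_complete p Sg.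
Proof.
have h : padically_complete p (fps W).
  by apply: fps_padically_complete; have [] := residueP B.
have := in_qpolyC_complete modulus (h : adically_complete (p%:R : fps W)).
by rewrite -Sigma_natE.
Qed.

Lemma Sigma_Y_complete : adically_complete (Y : Sg).
Proof. exact/in_qpolyC_complete/fpsY_complete. Qed.

Lemma Sigma_decomp (s : Sg) : exists a t, s = of_W a + Y * t.
Proof.
(* The constant terms in $Y$ of the coefficients of [s] form [a]. *)
exists (map_poly (@fps0 W) s).
exists (in_qpoly modulus (map_poly (@fps_shift W) s)).
rewrite -[LHS]in_qpolyK /Sigma_of /Sigma_Y -rmorphM -rmorphD; congr in_qpoly.
apply/polyP => i; rewrite coefD coefCM !coef_map /= coef_map_id0 //.
exact: fps_shiftE.
Qed.

(** An element of the kernel is divisible by every power of $Y$. If it equals $Y^n(a+Yt')$ with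
    $a\in W[u]$, multiplying by $p^n$ shows that $E^{pn}a$ lies in $\mathrm{Fil}^{p(n+1)}S$. Hence
    $E^p$ divides $a$, and $E^p=pY$ provides one more factor $Y$. *)
Lemma embS_inj : injective (embS B).
Proof.
suff ker s : embS B s = 0 -> s = 0.
  by move=> s t /eqP; rewrite -subr_eq0 -rmorphB => /eqP/ker/eqP; rewrite subr_eq0 => /eqP.
move=> hs; apply: Sigma_Y_complete.1; elim=> [|n [t ht]]; first by exists s; rewrite mul1r.
have [a [t' ht']] := Sigma_decomp t; rewrite ht ht' in hs *.
have [|b] := (fil_S_base (p * n.+1) (a * E ^+ (p * n))).1.
  rewrite -embS_Wu rmorphM rmorphXn exprM Sigma_E_pY.
  have -> : of_W a * (p%:R * Y) ^+ n =
      p%:R ^+ n * (Y ^+ n * (of_W a + Y * t')) - Y ^+ n.+1 * (p%:R ^+ n * t').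
    by rewrite exprMn exprSr; ring.
  rewrite rmorphB rmorphM hs mulr0 sub0r -rmorphN -mulrN; exact: fil_S_YX.
rewrite mulnS exprD mulrA => hb; have {hb}-> : a = b * E ^+ p := monic_rreg (monic_exp _ E_monic) hb.
exists (of_W b * p%:R + t').
rewrite rmorphM rmorphXn Sigma_E_pY exprSr; ring.
Qed.

(** Multiples of $Y$ lie in $\mathrm{Fil}^pS$, to which [fil_S_base] applies. *)
Lemma Sigma_base_Y (a : {poly W}) t : of_W a = Y * t -> exists b, a = b * E ^+ p.
Proof.
move=> h; apply/fil_S_base; rewrite -embS_Wu h -[Y]expr1.
by apply: fil_S_YX; rewrite muln1.
Qed.

(** Since $Y\in\mathrm{Fil}^pS\subseteq\mathrm{Fil}^rS$, only the $W[u]$-part of [s] matters, and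
    [fil_S_base] decides it. *)
Lemma fil_SigmaP r (s : Sg) : (r < p)%N ->
  fil_Sigma r s <-> exists a b, s = a * Sigma_E B ^+ r + b * Y.
Proof.
move=> rp; have filY t : fil_S r (embS B (t * Y)).
  by rewrite mulrC -[Y]expr1; apply: fil_S_YX; rewrite muln1 ltnW.
split=> [|[a [b ->]]].
  have [a [t ->]] := Sigma_decomp s => hs.
  have [|b ->] := (fil_S_base r a).1.
    have -> : env a = embS B ((of_W a + Y * t) + (- t) * Y).
      by rewrite -embS_Wu; congr (embS B _); ring.
    by rewrite rmorphD; apply: fil_SD.
  by exists (of_W b), t; rewrite rmorphM rmorphXn [Y * t]mulrC.
rewrite /fil_Sigma /= rmorphD; apply: fil_SD => //.
rewrite rmorphM; apply: fil_SM; rewrite rmorphXn embS_Wu -!rmorphXn.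
by apply/fil_S_base; exists 1; rewrite mul1r.
Qed.

(** Reduces to $W[u]$, where division by the monic polynomial $E^r$ commutes with multiplication by
    $p$, so the remainder vanishes. *)
Lemma fil_Sigma_tf r (s : Sg) : (r < p)%N -> fil_Sigma r (p%:R * s) -> fil_Sigma r s.
Proof.
move=> rp; have [a [t ->]] := Sigma_decomp s => /(fil_SigmaP _ rp) [x [y h]].
suff [b hb] : exists b, a = b * E ^+ r.
  apply/fil_SigmaP => //; exists (of_W b), t.
  by rewrite hb rmorphM rmorphXn mulrC [Y * t]mulrC.
have [|b hb] := (fil_S_base r (p%:R * a)).1.
  rewrite -embS_Wu rmorphM rmorph_nat.
  have -> : p%:R * of_W a = x * Sigma_E B ^+ r + (y - p%:R * t) * Y.
    by rewrite mulrBl addrA -h; ring.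
  by apply/(fil_SigmaP _ rp); exists x, (y - p%:R * t).
have Er := monic_exp r E_monic; exists (rdivp a (E ^+ r)).
have ha := rdivp_eq Er a; suff hm : rmodp a (E ^+ r) = 0 by rewrite hm addr0 in ha.
have pm : rmodp (p%:R * a) (E ^+ r) = 0 by rewrite hb rmodp_mull.
move: pm; rewrite -polyC_natr mul_polyC rmodpZ // => /eqP.
by rewrite -mul_polyC mulf_eq0 polyC_eq0 (negPf W_p) => /eqP.
Qed.

End SigmaRing.

(* What the proof uses of Sigma: fres is the residue map to k, fbase the image of
   W[u], and f_chain reflects Sigma/(p, Y) = k[u]/(u^(ep)). *)
Record frame (p : nat) (k : fieldType) (A : comNzRingType) := Frame {
  fphi : {rmorphism A -> A};
  fres : {rmorphism A -> k};
  fE : A;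
  fY : A;
  fc : A;
  fcinv : A;
  fbase : A -> Prop;
  f_p_reg : forall x : A, p%:R * x = 0 -> x = 0;
  f_Y_reg : forall x : A, fY * x = 0 -> x = 0;
  f_EX : fE ^+ p = p%:R * fY;
  f_complete : padically_complete p A;
  f_res_surj : forall x : k, exists a, fres a = x;
  f_res_unit : forall a, fres a != 0 -> exists b, a * b = 1;
  f_res_phi : forall a, fres (fphi a) = fres a ^+ p;
  f_phi_nil : exists n, forall a, fres a = 0 -> exists b, iter n fphi a = p%:R * b;
  f_phiE : fphi fE = p%:R * fc;
  f_cK : fc * fcinv = 1;
  f_base1 : fbase 1;
  f_baseB : forall a b, fbase a -> fbase b -> fbase (a - b);
  f_baseM : forall a b, fbase a -> fbase b -> fbase (a * b);
  f_baseE : fbase fE;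
  f_base_decomp : forall a, exists2 b, fbase b & exists t, a = b + fY * t;
  f_base_Y : forall a t, fbase a -> a = fY * t ->
    exists2 b, fbase b & a = b * fE ^+ p;
  f_chain : exists u, forall x, (exists a b, x = p%:R * a + fY * b) \/
    exists i v w a b, v * w = 1 /\ x = v * u ^+ i + p%:R * a + fY * b;
  f_fil_tf : forall r x, (r < p)%N ->
    (exists a b, p%:R * x = a * fE ^+ r + b * fY) ->
    exists a b, x = a * fE ^+ r + b * fY
}.

(** * Frobenius, residue map and units of $\Sigma$ *)

Section Frobenius.
Import Pdiv.CommonRing Pdiv.RingMonic.

Variables (p : nat) (k : fieldType) (B : breuil_data p k).
Hypothesis p_prime : prime p.
Hypothesis k_char : p \in [pchar k].

Local Notation W := (Wk B).
Local Notation E := (Eu B).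
Local Notation Sg := (Sigma p E).
Local Notation of_W := (Sigma_of p E).
Local Notation Y := (Sigma_Y p E).
Local Notation modulus := (Sigma_modulus p E).
Local Notation res := (residue B).

Let p0 : (0 < p)%N. Proof. exact: prime_gt0. Qed.

Let p1E : p.-1 = p.-2.+1. Proof. by have := prime_gt1 p_prime; lia. Qed.

Definition frob_poly (a : {poly W}) : {poly W} := map_poly (frobW B) a \Po 'X^p.

Lemma frob_poly_is_zmod : zmod_morphism frob_poly.
Proof. by move=> a b; rewrite /frob_poly !rmorphB. Qed.

Lemma frob_poly_is_monoid : monoid_morphism frob_poly.
Proof. by split=> [|a b]; rewrite /frob_poly ?rmorph1 ?rmorphM. Qed.

HB.instance Definition _ :=
  GRing.isZmodMorphism.Build {poly W} {poly W} frob_poly frob_poly_is_zmod.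
HB.instance Definition _ :=
  GRing.isMonoidMorphism.Build {poly W} {poly W} frob_poly frob_poly_is_monoid.

Lemma frob_polyC w : frob_poly w%:P = (frobW B w)%:P.
Proof. by rewrite /frob_poly map_polyC comp_polyC. Qed.

Lemma frob_polyX : frob_poly 'X = 'X^p.
Proof. by rewrite /frob_poly map_polyX comp_polyX. Qed.

(** The Frobenius of $\Sigma$ is only given through $S$; there its values on $W$ and $u$ settle the
    identity, which injectivity of [embS] brings back. *)
Lemma phi_Sigma_of (a : {poly W}) : phi_Sigma B (of_W a) = of_W (frob_poly a).
Proof.
apply: (embS_inj p_prime k_char); rewrite phi_SigmaP !embS_Wu.
elim/poly_ind: a => [|a c IH]; first by rewrite !rmorph0.
rewrite !rmorphD !rmorphM IH phiS_W phiS_u /= frob_polyC frob_polyX.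
by rewrite !rmorphXn.
Qed.

Lemma res_poly_eq0 (a : {poly W}) : map_poly res a = 0 -> exists b, a = p%:R * b.
Proof.
move=> h; have /choice[f hf] : forall i, exists v, a`_i = p%:R * v.
  by move=> i; apply/res_eq0; rewrite -coef_map h coef0.
exists (\poly_(i < size a) f i); apply/polyP => i.
rewrite mulr_natl coefMn coef_poly; case: ltnP => hi; last by rewrite nth_default // mul0rn.
by rewrite hf mulr_natl.
Qed.

Lemma frob_poly_modp (a : {poly W}) : exists b, frob_poly a = a ^+ p + p%:R * b.
Proof.
suff /res_poly_eq0[b hb] : map_poly res (frob_poly a - a ^+ p) = 0.
  by exists b; rewrite -hb addrC subrK.
apply/eqP; rewrite rmorphB subr_eq0 rmorphXn; apply/eqP.
have pk : p \in [pchar {poly k}] by rewrite pchar_poly.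
elim/poly_ind: a => [|a c IH]; first by rewrite !rmorph0 expr0n eqn0Ngt p0.
rewrite !rmorphD !rmorphM /= IH frob_polyC frob_polyX map_polyXn map_polyX !map_polyC /=.
rewrite frobW_residue -[RHS](pFrobenius_autE pk) pFrobenius_autD_comm; last exact: mulrC.
by rewrite !pFrobenius_autE exprMn polyC_exp.
Qed.

(** Reduction modulo $(p,u,Y)$. Multiplicativity comes from [res0], a ring morphism on all
    polynomials that kills the modulus because $p$ divides the constant coefficient of $E$. *)
Definition Sigma_res (s : Sg) : k := res (fps0 (s : {poly fps W})`_0).

Let res0 : {rmorphism {poly fps W} -> k} := res \o (@fps0 W \o horner_eval 0).

Let res0E (P : {poly fps W}) : res0 P = res (fps0 P`_0).
Proof. by rewrite /= horner_evalE horner_coef0. Qed.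

Let res0_modulus : res0 modulus = 0.
Proof.
rewrite rmorphB rmorphXn !res0E coef_map coefC /=.
rewrite {1}/fps0 /fpsC /= res_E0 expr0n eqn0Ngt p0 sub0r.
by rewrite mulrC /fps0 /= [X in res X](_ : _ = 0) ?rmorph0 ?oppr0 // fpsYM.
Qed.

Lemma Sigma_res_in (P : {poly fps W}) : Sigma_res (in_qpoly modulus P) = res0 P.
Proof.
have /andP[s1 m1] := modulus_monic B p_prime k_char.
rewrite /Sigma_res -res0E.
have -> : in_qpoly modulus P = rmodp P modulus :> {poly _}.
  by rewrite /= /mk_monic s1 m1.
by rewrite [in RHS](rdivp_eq m1 P) (rmorphD res0) (rmorphM res0) res0_modulus mulr0 add0r.
Qed.

Lemma Sigma_res_is_zmod : zmod_morphism Sigma_res.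
Proof.
by move=> s t; rewrite /Sigma_res [X in res (fps0 X)]coefB !rmorphB.
Qed.

Lemma Sigma_res_is_monoid : monoid_morphism Sigma_res.
Proof.
split=> [|s t].
  by rewrite /Sigma_res [X in res (fps0 X)]coefC eqxx rmorph1.
rewrite -[in LHS](in_qpolyK s) -[in LHS](in_qpolyK t).
rewrite [X in Sigma_res X](_ : _ = in_qpoly modulus ((s : {poly fps W}) * (t : {poly fps W}))).
  by rewrite Sigma_res_in (rmorphM res0) !res0E.
by rewrite in_qpolyM.
Qed.

HB.instance Definition _ :=
  GRing.isZmodMorphism.Build Sg k Sigma_res Sigma_res_is_zmod.
HB.instance Definition _ :=
  GRing.isMonoidMorphism.Build Sg k Sigma_res Sigma_res_is_monoid.

Lemma Sigma_res_of (a : {poly W}) : Sigma_res (of_W a) = res a`_0.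
Proof. by rewrite Sigma_res_in res0E coef_map. Qed.

Lemma Sigma_res_Y : Sigma_res Y = 0.
Proof. by rewrite Sigma_res_in res0E coefC /fps0 /= rmorph0. Qed.

Lemma k_p : p%:R = 0 :> k. Proof. exact: pcharf0. Qed.

Local Notation u := (of_W 'X).

Lemma Sigma_res_ker (s : Sg) : Sigma_res s = 0 ->
  exists a b d, s = p%:R * a + u * b + Y * d.
Proof.
have [a [t ->]] := Sigma_decomp s.
rewrite rmorphD rmorphM /= Sigma_res_of Sigma_res_Y mul0r addr0 => /res_eq0[v hv].
exists (of_W v%:P), (of_W (drop_poly 1 a)), t; congr (_ + _).
rewrite -[in LHS](poly_take_drop 1 a) rmorphD rmorphM mulrC /=.
have -> : take_poly 1 a = p%:R * v%:P.
  apply/polyP => i; rewrite coef_take_poly -polyC_natr -polyCM coefC -hv.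
  by case: i.
by rewrite rmorphM rmorph_nat mulrC.
Qed.

Let e := (size E).-1.

(** The Eisenstein condition gives $E\equiv u^e$ modulo $p$, so $u^{ep}\equiv E^p=pY\equiv0$. *)
Lemma Sigma_uX : exists z, u ^+ (e * p) = p%:R * z.
Proof.
have [E1 s1 hE _] := Eu_eisenstein B.
have [|b hb] := @res_poly_eq0 (E - 'X^e).
  apply/polyP => i; rewrite coef0 coef_map coefB coefXn /=.
  have [lti|] := ltnP i e.
    have [v ->] := hE i lti.
    by rewrite (ltn_eqF lti) subr0; apply/res_eq0; exists v; rewrite expr1.
  rewrite leq_eqVlt => /predU1P[<-|lti].
    by move: E1; rewrite monicE lead_coefE -/e => /eqP ->; rewrite eqxx subrr rmorph0.
  rewrite (gtn_eqF lti) nth_default ?subrr ?rmorph0 //.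
  by move: lti; rewrite /e; case: (size E) s1.
have hu : of_W E - u ^+ e = p%:R * of_W b.
  by rewrite -rmorphXn -rmorphB hb rmorphM rmorph_nat.
have := subrXX (of_W E) (u ^+ e) p; rewrite hu => h.
exists (Y - of_W b * \sum_(i < p) of_W E ^+ (p.-1 - i) * (u ^+ e) ^+ i).
rewrite exprM mulrBr mulrA -h Sigma_E_pY //; ring.
Qed.

(** After scaling, $s=1+pa+ub+Yd$. A finite geometric sum inverts $1+ub$ modulo $p$, because $p$
    divides $u^{ep}$; the result is corrected first $p$-adically, then $Y$-adically. *)
Lemma Sigma_res_unit (s : Sg) : Sigma_res s != 0 -> exists t, s * t = 1.
Proof.
move=> hs; have [_ _ surj _] := residueP B.
have [w hw] := surj (Sigma_res s)^-1.
have [|a [b [d hd]]] := @Sigma_res_ker (s * of_W w%:P - 1).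
  by rewrite rmorphB rmorphM rmorph1 /= Sigma_res_of coefC /= hw divff // subrr.
have [z hz] := Sigma_uX; set N := (e * p)%N in hz.
pose v : Sg := \sum_(i < N) (- (u * b)) ^+ i.
have hv : (1 + u * b) * v = 1 - p%:R * (z * (- b) ^+ N).
  have := subrX1 (- (u * b)) N; rewrite -/v -[in X in X - 1]mulrN exprMn hz => h.
  rewrite -[RHS]opprB mulrA h -[RHS]mulNr; congr (_ * _); ring.
have [y1 hy1] := @adic_unit Sg p%:R (a * v - z * (- b) ^+ N) (Sigma_p_complete B).
have [y2 hy2] := @adic_unit Sg Y (d * v * y1) (Sigma_Y_complete B).
exists (of_W w%:P * v * y1 * y2); rewrite -hy2 !mulrA; congr (_ * _).
rewrite -[X in _ = X + _]hy1.
move/eqP: hd; rewrite subr_eq => /eqP ->.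
rewrite [LHS](_ : _ = ((1 + u * b) * v + p%:R * a * v + Y * d * v) * y1); last by ring.
by rewrite hv; ring.
Qed.

(** With $\varphi(E)=E^p+pb$ in $W[u]$ and $E^p=pY$, the quotient is $c=Y+b$. If $pv$ is the
    constant coefficient of $E$, then that of $b$ is congruent to $\varphi(v)$ modulo $p$, and $v$
    has nonzero residue because $p^2$ does not divide $pv$. *)
Lemma phi_Sigma_E :
  exists2 c, phi_Sigma B (Sigma_E B) = p%:R * c & Sigma_res c != 0.
Proof.
have [b hb] := frob_poly_modp E; exists (Y + of_W b).
  by rewrite phi_Sigma_of hb rmorphD rmorphXn rmorphM rmorph_nat Sigma_E_pY // mulrDr.
rewrite rmorphD /= Sigma_res_Y add0r Sigma_res_of.
have [_ s1 hE h2] := Eu_eisenstein B.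
have [|v hv] := hE 0%N; first by case: (size E) s1 => [|[]].
rewrite expr1 in hv.
have {hb} : frobW B E`_0 = E`_0 ^+ p + p%:R * b`_0.
  move/(congr1 (fun q : {poly W} => q`_0)): hb; rewrite coefD mulr_natl coefMn.
  rewrite -!horner_coef0 horner_exp /frob_poly horner_comp hornerXn.
  by rewrite expr0n eqn0Ngt p0 !horner_coef0 coef_map mulr_natl.
rewrite hv rmorphM rmorph_nat => hb.
have -> : b`_0 = frobW B v - p%:R ^+ p.-1 * v ^+ p.
  have [W_p _ _ _] := residueP B; apply: (mulfI W_p); rewrite mulrBr hb.
  by rewrite mulrA -exprS prednK // exprMn; ring.
rewrite rmorphB rmorphM rmorphXn rmorph_nat k_p frobW_residue.
have -> : 0 ^+ p.-1 = 0 :> k by rewrite p1E expr0n.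
rewrite mul0r subr0 expf_neq0 //; apply/eqP => /res_eq0[v' hv'].
by apply: h2; exists v'; rewrite hv hv' mulrA expr2.
Qed.

Lemma c_SigmaE : phi_Sigma B (Sigma_E B) = p%:R * c_Sigma B.
Proof.
have [c hc _] := phi_Sigma_E; rewrite /c_Sigma /pdiv_Sigma.
case: xgetP => [t _ /= ht|/(_ c)]; first by rewrite -ht expr1.
by case; rewrite /= expr1 hc.
Qed.

Lemma c_invK : c_Sigma B * c_inv B = 1.
Proof.
have [c hc /Sigma_res_unit[t ct]] := phi_Sigma_E.
have hcc : c_Sigma B = c.
  apply/eqP; rewrite -subr_eq0; apply/eqP; apply: Sigma_p_reg.
  by rewrite mulrBr -hc c_SigmaE subrr.
by rewrite /c_inv; case: xgetP => [x _ //|/(_ t)]; case; rewrite /= hcc.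
Qed.

(** Apply $\varphi$ to $E^p=pY$ and cancel $p$. The exponent $p-1$ is what makes $\varphi_r(Y)$
    defined for $r<p$. *)
Lemma phi_Sigma_Y :
  phi_Sigma B Y = p%:R ^+ p.-1 * c_Sigma B ^+ p.
Proof.
apply/eqP; rewrite -subr_eq0; apply/eqP; apply: Sigma_p_reg.
rewrite mulrBr mulrA -exprS prednK // -exprMn -c_SigmaE -rmorphXn /=.
by rewrite /Sigma_E Sigma_E_pY // rmorphM rmorph_nat subrr.
Qed.

Lemma Sigma_res_phi (s : Sg) : Sigma_res (phi_Sigma B s) = Sigma_res s ^+ p.
Proof.
have [a [t ->]] := Sigma_decomp s; rewrite !(rmorphD, rmorphM) /= phi_Sigma_of.
rewrite phi_Sigma_Y !Sigma_res_of Sigma_res_Y mul0r addr0.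
have -> : p%:R ^+ p.-1 = p%:R * p%:R ^+ p.-2 :> Sg.
  by rewrite p1E exprS.
rewrite !rmorphM rmorph_nat k_p !mul0r addr0 -frobW_residue.
by rewrite -!horner_coef0 /frob_poly horner_comp hornerXn expr0n eqn0Ngt p0 !horner_coef0 coef_map.
Qed.

(** The maximal ideal is $(p,u,Y)$. One application of $\varphi$ makes the $Y$-part divisible by
    $p$, and iterates send $u$ to powers $u^{p^n}$, divisible by $p$ once $p^n\ge ep$. *)
Lemma phi_Sigma_nil : exists n, forall s,
  Sigma_res s = 0 -> exists t, iter n (phi_Sigma B) s = p%:R * t.
Proof.
have [z hz] := Sigma_uX; set N := (e * p)%N in hz.
suff h s n : Sigma_res s = 0 ->
    exists a b, iter n.+1 (phi_Sigma B) s = p%:R * a + u ^+ (p ^ n.+1) * b.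
  exists N.+1 => s /(@h _ N)[a [b ->]].
  have hN : (N <= p ^ N.+1)%N.
    by rewrite ltnW // (leq_trans _ (ltn_expl _ (prime_gt1 p_prime))).
  exists (a + z * u ^+ (p ^ N.+1 - N) * b).
  by rewrite -(subnK hN) addnK exprD hz; ring.
move=> /Sigma_res_ker[a [b [d ->]]]; elim: n => [|n [a' [b' IH]]].
  exists (phi_Sigma B a + p%:R ^+ p.-2 * c_Sigma B ^+ p * phi_Sigma B d), (phi_Sigma B b).
  rewrite /= !rmorphD !rmorphM /= phi_Sigma_of frob_polyX phi_Sigma_Y rmorph_nat rmorphXn.
  have -> : p%:R ^+ p.-1 = p%:R * p%:R ^+ p.-2 :> Sg.
    by rewrite p1E exprS.
  by rewrite expn1; ring.
exists (phi_Sigma B a'), (phi_Sigma B b').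
rewrite iterS IH !rmorphD !rmorphM !rmorphXn /= phi_Sigma_of frob_polyX rmorph_nat rmorphXn.
by rewrite -exprM -expnS.
Qed.

(** The exponent [i] is the $u$-adic order of the reduction in $k[u]$ of the $W[u]$-part; dropping
    the lower coefficients leaves an element with nonzero residue, hence a unit. *)
Lemma Sigma_chain (s : Sg) : (exists a b, s = p%:R * a + Y * b) \/
  exists i v w a b, v * w = 1 /\ s = v * u ^+ i + p%:R * a + Y * b.
Proof.
have [a [t ->]] := Sigma_decomp s.
have [/res_poly_eq0[b ->]|a0] := eqVneq (map_poly res a) 0.
  by left; exists (of_W b), t; rewrite rmorphM rmorph_nat.
have exi : exists i, res a`_i != 0.
  exists (size (map_poly res a)).-1; rewrite -coef_map.
  by rewrite -lead_coefE lead_coef_eq0.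
right; case: (ex_minnP exi) => i hi mini; exists i, (of_W (drop_poly i a)).
have [|w hw] := @Sigma_res_unit (of_W (drop_poly i a)).
  by rewrite Sigma_res_of coef_drop_poly.
have [|b hb] := @res_poly_eq0 (take_poly i a).
  apply/polyP => j; rewrite coef_map coef0 coef_take_poly /=; case: ltnP => [ltj|_].
    by apply/eqP; apply: contraTT ltj => /mini; rewrite leqNgt.
  by rewrite rmorph0.
exists w, (of_W b), t; split=> //; rewrite -[in LHS](poly_take_drop i a).
by rewrite rmorphD rmorphM rmorphXn hb rmorphM rmorph_nat [in LHS](addrC (_ * _)).
Qed.

(** Kept transparent, since its projections must later be convertible to [phi_Sigma], [Sigma_E] and
    the other data of $\Sigma$. *)
Definition Sigma_frame : frame p k Sg.
Proof.
apply: (@Frame p k Sg (phi_Sigma B) Sigma_res (Sigma_E B) Y (c_Sigma B) (c_inv B)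
  (fun s => exists a, s = of_W a)).
- exact: Sigma_p_reg.
- exact: Sigma_Y_reg.
- exact: Sigma_E_pY.
- exact: Sigma_p_complete.
- move=> x; have [_ _ surj _] := residueP B; have [w hw] := surj x.
  by exists (of_W w%:P); rewrite /= Sigma_res_of coefC.
- exact: Sigma_res_unit.
- exact: Sigma_res_phi.
- exact: phi_Sigma_nil.
- exact: c_SigmaE.
- exact: c_invK.
- by exists 1; rewrite rmorph1.
- by move=> _ _ [a ->] [b ->]; exists (a - b); rewrite rmorphB.
- by move=> _ _ [a ->] [b ->]; exists (a * b); rewrite rmorphM.
- by exists E.
- by move=> s; have [a [t ->]] := Sigma_decomp s; exists (of_W a); [exists a | exists t].
- move=> _ t [a ->] /(Sigma_base_Y p_prime k_char)[b ->].
  by exists (of_W b); [exists b | rewrite rmorphM rmorphXn].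
- by exists u; apply: Sigma_chain.
- move=> r x rp /(fil_SigmaP p_prime k_char _ rp) h.
  by apply/(fil_SigmaP p_prime k_char _ rp); apply: fil_Sigma_tf h.
Defined.

End Frobenius.

(** * Semilinear algebra *)

Section TwistedPower.
Variables (A : comNzRingType) (phi : {rmorphism A -> A}).

(* The matrix of the n-th iterate of the semilinear map v |-> phi(v) C. *)
Fixpoint tpow d (C : 'M[A]_d) n : 'M[A]_d :=
  if n is m.+1 then map_mx phi (tpow C m) *m C else 1%:M.

Lemma tpowSr d (C : 'M[A]_d) n :
  tpow C n.+1 = map_mx (iter n phi) C *m tpow C n.
Proof.
elim: n => [|n IH] /=.
  rewrite map_mx1 mul1mx mulmx1; by apply/matrixP => i j; rewrite !mxE.
rewrite -/(tpow C n.+1) {1}IH map_mxM -mulmxA; congr (_ *m _).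
by apply/matrixP => i j; rewrite !mxE.
Qed.

Lemma tpowD d (C : 'M[A]_d) n m :
  tpow C (n + m) = map_mx (iter n phi) (tpow C m) *m tpow C n.
Proof.
elim: n => [|n IH]; first by rewrite mulmx1; apply/matrixP => i j; rewrite mxE.
rewrite /= -/addn [(n + m)%N]/(n + m)%N IH map_mxM -mulmxA; congr (_ *m _).
by apply/matrixP => i j; rewrite !mxE.
Qed.

Lemma tpow_conj d m (P : 'M[A]_(m, d)) (P' : 'M[A]_(d, m)) (C : 'M[A]_d) n :
  P *m P' = 1%:M -> P' *m P = 1%:M ->
  tpow (map_mx phi P *m C *m P') n = map_mx (iter n phi) P *m tpow C n *m P'.
Proof.
move=> PP' P'P; elim: n => [|n IH] /=.
  rewrite mulmx1 -[LHS]PP'; congr (_ *m _); by apply/matrixP => i j; rewrite !mxE.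
rewrite IH !map_mxM -!mulmxA [map_mx phi P' *m _]mulmxA -map_mxM P'P map_mx1 mul1mx.
congr (_ *m _); by apply/matrixP => i j; rewrite !mxE.
Qed.

Lemma tpow_block h l (C1 : 'M[A]_h) C3 (C2 : 'M[A]_l) n : exists C4,
  tpow (block_mx C1 0 C3 C2) n = block_mx (tpow C1 n) 0 C4 (tpow C2 n).
Proof.
elim: n => [|n [C4 IH]] /=; first by exists 0; rewrite -scalar_mx_block.
rewrite IH map_block_mx map_mx0 mulmx_block !mul0mx !mulmx0 !addr0 add0r.
by eexists.
Qed.

End TwistedPower.

Lemma map_tpow (A K : comNzRingType) (phi : {rmorphism A -> A})
    (sigma : {rmorphism K -> K}) (rho : {rmorphism A -> K}) d (C : 'M[A]_d) n :
  (forall a, rho (phi a) = sigma (rho a)) ->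
  map_mx rho (tpow phi C n) = tpow sigma (map_mx rho C) n.
Proof.
move=> h; elim: n => [|n IH] /=; first by rewrite map_mx1.
rewrite map_mxM -IH; congr (_ *m _).
by apply/matrixP => i j; rewrite !mxE h.
Qed.

(* The Fitting decomposition of a semilinear endomorphism.  The row space of a
   twisted power of C of minimal rank is stable and C is bijective on it. *)
Lemma twisted_fitting (K : fieldType) (sigma : {rmorphism K -> K}) d (C : 'M[K]_d) :
  exists h l (P : 'M[K]_(h + l, d)) (P' : 'M[K]_(d, h + l)) C1 C2 C3 n,
    [/\ P *m P' = 1%:M, P' *m P = 1%:M,
        map_mx sigma P *m C *m P' = block_mx C1 0 C3 C2,
        C1 \in unitmx & tpow sigma C2 n = 0].
Proof.
have [n rk] : exists n, \rank (tpow sigma C n.+1) = \rank (tpow sigma C n).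
  apply: contrapT => /forallNP h; pose f n := \rank (tpow sigma C n).
  have lef n : (f n.+1 < f n)%N.
    rewrite ltn_neqAle; apply/andP; split; first by apply/eqP; apply: h.
    by rewrite /f tpowSr mxrankM_maxr.
  have lef2 n : (n + f n <= f 0)%N.
    elim: n => [|n IH]; first by rewrite add0n.
    by have := lef n; lia.
  by have := lef2 (f 0%N).+1; lia.
set Cn := tpow sigma C n in rk; pose R := row_base Cn.
pose P := col_mx R (row_base (Cn^C)%MS); pose P' := pinvmx P.
have Pfull : row_full P.
  rewrite -sub1mx /P -addsmxE.
  apply: submx_trans (_ : (Cn + Cn^C <= _)%MS); last by apply: addsmxS; rewrite eq_row_base.
  by rewrite sub1mx addsmx_compl_full.
have e : (\rank Cn + \rank (Cn^C)%MS)%N = d by rewrite mxrank_compl subnKC ?rank_leq_col.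
have Pfree : row_free P by rewrite /row_free (eqP Pfull) e.
have PP' : P *m P' = 1%:M by apply: mulmxVp.
have P'P : P' *m P = 1%:M by apply: mulVpmx.
have RP : R = row_mx 1%:M 0 *m P by rewrite mul_row_col mul1mx mul0mx addr0.
have RP' : R *m P' = row_mx 1%:M 0 by rewrite RP -mulmxA PP' mulmx1.
have eqR : (map_mx sigma R :=: map_mx sigma Cn)%MS.
  by apply/map_eqmx; apply: eq_row_base.
have /submxP[C1 hC1] : (map_mx sigma R *m C <= R)%MS.
  rewrite eq_row_base (eqmxMr C eqR).
  by rewrite -[X in (X <= _)%MS]/(tpow sigma C n.+1) tpowSr submxMl.
pose Z := map_mx sigma (row_base (Cn^C)%MS) *m C *m P'.
have hZ : map_mx sigma P *m C *m P' = block_mx C1 0 (lsubmx Z) (rsubmx Z).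
  rewrite map_col_mx !mul_col_mx -/Z hC1 -mulmxA RP' mul_mx_row mulmx1 mulmx0.
  by rewrite /block_mx hsubmxK.
exists (\rank Cn), (\rank (Cn^C)%MS), P, P', C1, (rsubmx Z), (lsubmx Z), n.
split=> //.
  rewrite -row_free_unit /row_free -(mxrankMfree _ (row_base_free Cn)) -hC1.
  by rewrite (eqmxMr C eqR) -[X in \rank X]/(tpow sigma C n.+1) rk.
have [C4] := tpow_block sigma C1 (lsubmx Z) (rsubmx Z) n.
have hz : col_base Cn *m R *m P' = Cn *m P' by rewrite mulmx_base.
rewrite -hZ tpow_conj // -/Cn -[X in X = _]mulmxA -hz -[col_base _ *m _ *m _]mulmxA RP'.
rewrite !mul_mx_row !mulmx0.
move=> h; apply/matrixP => i j; rewrite mxE.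
by have := congr1 (fun X : 'M_(_ + _) => X (rshift _ i) (rshift _ j)) h; rewrite block_mxEdr row_mxEr mxE => <-.
Qed.

(** * Matrices over a frame: regularity, limits, contraction *)

Section FrameMatrices.
Variables (p : nat) (k : fieldType) (A : comNzRingType) (F : frame p k A).
Hypothesis p_prime : prime p.
Hypothesis k_char : p \in [pchar k].

Local Notation phi := (fphi F).
Local Notation rho := (fres F).
Local Notation E := (fE F).
Local Notation Y := (fY F).
Local Notation sigma := (pFrobenius_aut k_char).

Let p0 : (0 < p)%N. Proof. exact: prime_gt0. Qed.

Lemma rho_p : rho p%:R = 0. Proof. by rewrite rmorph_nat pcharf0. Qed.

Lemma rho_E : rho E = 0.
Proof.
have := congr1 rho (f_EX F); rewrite rmorphXn rmorphM rho_p mul0r => /eqP.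
by rewrite expf_eq0 p0 => /eqP.
Qed.

Lemma frame_pX_reg n (x : A) : p%:R ^+ n * x = 0 -> x = 0.
Proof. by elim: n => [|n IH]; rewrite ?mul1r // exprS -mulrA => /(f_p_reg F)/IH. Qed.

(** $E$ divides $E^p=pY$, and both $p$ and $Y$ are regular. *)
Lemma frame_EX_reg n (x : A) : E ^+ n * x = 0 -> x = 0.
Proof.
elim: n => [|n IH]; rewrite ?mul1r // exprS -mulrA => h; apply: IH.
apply: (f_Y_reg (f := F)); apply: (f_p_reg F); rewrite mulrA -(f_EX F).
have -> : E ^+ p = E ^+ p.-1 * E by rewrite -exprSr prednK.
by rewrite -mulrA h mulr0.
Qed.

Lemma mx_scale_reg (c : A) m n (M N : 'M[A]_(m, n)) :
  (forall x, c * x = 0 -> x = 0) -> c *: M = c *: N -> M = N.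
Proof.
move=> hc /matrixP h; apply/matrixP => i j; apply/eqP; rewrite -subr_eq0; apply/eqP.
by apply: hc; have := h i j; rewrite !mxE mulrBr => ->; rewrite subrr.
Qed.

Lemma mx_EX_inj r m n (M N : 'M[A]_(m, n)) : E ^+ r *: M = E ^+ r *: N -> M = N.
Proof. exact/mx_scale_reg/frame_EX_reg. Qed.

Lemma mx_p_inj r m n (M N : 'M[A]_(m, n)) : p%:R ^+ r *: M = p%:R ^+ r *: N -> M = N.
Proof. exact/mx_scale_reg/frame_pX_reg. Qed.

Lemma mx_lift_unit n (X : 'M[A]_n) : map_mx rho X \in unitmx ->
  exists X', X *m X' = 1%:M /\ X' *m X = 1%:M.
Proof.
rewrite unitmxE det_map_mx unitfE => /f_res_unit[b hb].
exists (b *: \adj X); rewrite -scalemxAr -scalemxAl mul_mx_adj mul_adj_mx.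
by rewrite scale_scalar_mx mulrC hb.
Qed.

Lemma mx_unit_rho n (X X' : 'M[A]_n) : X *m X' = 1%:M -> map_mx rho X \in unitmx.
Proof. by move/(congr1 (map_mx rho)); rewrite map_mxM map_mx1 => /mulmx1_unit[]. Qed.

Lemma mx_lift m n (X : 'M[k]_(m, n)) : exists Z : 'M[A]_(m, n), map_mx rho Z = X.
Proof.
have /choice[f hf] : forall ij : 'I_m * 'I_n, exists a, rho a = X ij.1 ij.2.
  by move=> ij; apply: f_res_surj.
by exists (\matrix_(i, j) f (i, j)); apply/matrixP => i j; rewrite !mxE hf.
Qed.

Lemma mx_pred_choice m n (T : Type) (P : A -> T -> Prop) (M : 'M[A]_(m, n)) :
  (forall i j, exists t, P (M i j) t) -> exists f, forall i j, P (M i j) (f i j).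
Proof.
move=> h; have /choice[f hf] : forall ij : 'I_m * 'I_n, exists t, P (M ij.1 ij.2) t.
  by move=> ij; apply: h.
by exists (fun i j => f (i, j)) => i j; apply: (hf (i, j)).
Qed.

Lemma mx_sep m n (M : 'M[A]_(m, n)) :
  (forall j, exists N, M = p%:R ^+ j *: N) -> M = 0.
Proof.
move=> h; apply/matrixP => i j; rewrite mxE; apply: (f_complete F).1 => t.
by have [N ->] := h t; exists (N i j); rewrite mxE.
Qed.

Lemma mx_limit m n (Z : nat -> 'M[A]_(m, n)) :
  (forall j, exists N, Z j.+1 - Z j = p%:R ^+ j *: N) ->
  exists L, forall j, exists N, L - Z j = p%:R ^+ j *: N.
Proof.
move=> h.
have /choice[f hf] : forall ab : 'I_m * 'I_n, exists l,
    forall j, dvd_ppow p j (l - Z j ab.1 ab.2).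
  move=> [a b]; apply: (f_complete F).2 => j; have [N hN] := h j.
  by exists (N a b); have := congr1 (fun M : 'M_(_, _) => M a b) hN; rewrite !mxE.
exists (\matrix_(a, b) f (a, b)) => j.
have [g hg] : exists g : 'I_m -> 'I_n -> A, forall a b,
    f (a, b) - Z j a b = p%:R ^+ j * g a b.
  have /choice[g hg] : forall ab : 'I_m * 'I_n, exists z,
      f ab - Z j ab.1 ab.2 = p%:R ^+ j * z by move=> ab; apply: hf.
  by exists (fun a b => g (a, b)) => a b; apply: (hg (a, b)).
by exists (\matrix_(a, b) g a b); apply/matrixP => a b; rewrite !mxE.
Qed.

Lemma mx_phi_nil : exists n, forall m l (M : 'M[A]_(m, l)), map_mx rho M = 0 ->
  exists N, map_mx (iter n phi) M = p%:R *: N.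
Proof.
have [n hn] := f_phi_nil F; exists n => m l M hM.
have [g hg] := @mx_pred_choice m l A (fun x y => iter n phi x = p%:R * y) M
   (fun i j => hn _ (etrans (esym (mxE _ _ i j)) (etrans (congr1 (fun M : 'M_(_, _) => M i j) hM) (mxE _ _ i j)))).
by exists (\matrix_(i, j) g i j); apply/matrixP => i j; rewrite !mxE.
Qed.

Lemma iter_rmorph_scale n m l (M : 'M[A]_(m, l)) j :
  map_mx (iter n phi) (p%:R ^+ j *: M) = p%:R ^+ j *: map_mx (iter n phi) M.
Proof.
apply/matrixP => i i'; rewrite !mxE; elim: n => [|n IH] //=.
by rewrite IH rmorphM rmorphXn rmorph_nat.
Qed.

Definition topnil d (C : 'M[A]_d) := exists n, map_mx rho (tpow phi C n) = 0.

(** Once the residue vanishes, [m] further twists by $\varphi$ turn membership in the maximal ideal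
    into divisibility by $p$. *)
Lemma topnil_p d (C : 'M[A]_d) : topnil C -> exists n M, tpow phi C n = p%:R *: M.
Proof.
move=> [n hn]; have [m hm] := mx_phi_nil; have [M hM] := hm _ _ _ hn.
by exists (m + n)%N, (M *m tpow phi C m); rewrite tpowD hM scalemxAl.
Qed.

Lemma topnil_rho d (C C' : 'M[A]_d) : map_mx rho C = map_mx rho C' ->
  topnil C -> topnil C'.
Proof.
have hs a : rho (phi a) = sigma (rho a) by rewrite f_res_phi.
by move=> h [n hn]; exists n; rewrite (map_tpow _ _ hs) -h -(map_tpow _ _ hs).
Qed.

(* One application of the twisted product makes the residue vanish, and then
   powers of phi produce a factor p. *)
Lemma twisted_contraction d1 d2 (delta : nat -> 'M[A]_(d1, d2))
    (P : nat -> 'M[A]_d1) (N : nat -> 'M[A]_d2) (N0 : 'M[A]_d2) :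
  topnil N0 -> (forall n, map_mx rho (N n) = map_mx rho N0) ->
  (forall n, delta n.+1 = P n *m map_mx phi (delta n) *m N n) ->
  exists s, forall j n, (s * j <= n)%N -> exists M, delta n = p%:R ^+ j *: M.
Proof.
move=> [n0 hn0] hN hd; have [n1 hn1] := mx_phi_nil.
pose tN := fix tN n m := if m is m'.+1 then map_mx phi (tN n m') *m N (n + m')%N else 1%:M.
have tN0 n m : map_mx rho (tN n m) = map_mx rho (tpow phi N0 m).
  have hs a : rho (phi a) = sigma (rho a) by rewrite f_res_phi.
  elim: m => [|m IH] //=; rewrite !map_mxM hN.
  rewrite -!map_mx_comp; congr (_ *m _); apply/matrixP => i j; rewrite !mxE /= !hs.
  by have := congr1 (fun M : 'M_(_, _) => M i j) IH; rewrite !mxE => ->.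
have hdm n m : exists P', delta (n + m)%N = P' *m map_mx (iter m phi) (delta n) *m tN n m.
  elim: m => [|m [P' IH]].
    exists 1%:M; rewrite addn0 mul1mx mulmx1; by apply/matrixP => i j; rewrite mxE.
  exists (P (n + m)%N *m map_mx phi P').
  rewrite addnS hd IH !map_mxM /= !mulmxA; do 2!congr (_ *m _).
  congr (_ *m _); by apply/matrixP => i j; rewrite !mxE.
have step0 j n m M : delta n = p%:R ^+ j *: M -> exists M', delta (n + m)%N = p%:R ^+ j *: M'.
  move=> h; have [P' ->] := hdm n m; rewrite h iter_rmorph_scale -scalemxAr -scalemxAl.
  by eexists.
have step j n M : delta n = p%:R ^+ j *: M ->
    exists M', delta (n + (n0 + n1))%N = p%:R ^+ j.+1 *: M'.
  move=> h; have [P' hP'] := hdm n n0.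
  have [P'' hP''] := hdm (n + n0)%N n1.
  rewrite addnA hP'' hP' h iter_rmorph_scale -scalemxAr -scalemxAl iter_rmorph_scale.
  set X := P' *m _ *m _.
  have [|X' hX'] := hn1 _ _ X; first by rewrite /X map_mxM tN0 hn0 mulmx0.
  rewrite hX' -scalemxAr -scalemxAl -scalemxAr -scalemxAl scalerA -exprSr.
  by eexists.
exists (n0 + n1)%N => j n; elim: j n => [|j IH] n.
  by exists (delta n); rewrite scale1r.
rewrite mulnS => hn.
have [|M hM] := IH (n - (n0 + n1))%N; first by rewrite leq_subRL ?(leq_trans (leq_addr _ _) hn).
have := step _ _ _ hM; rewrite subnK // (leq_trans (leq_addr _ _) hn) //.
Qed.

End FrameMatrices.

(** * Lifting the Fitting decomposition and splitting off the bijective part *)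

Section FrameBlocks.
Variables (p : nat) (k : fieldType) (A : comNzRingType) (F : frame p k A).
Hypothesis p_prime : prime p.
Hypothesis k_char : p \in [pchar k].

Local Notation phi := (fphi F).
Local Notation rho := (fres F).
Local Notation E := (fE F).
Local Notation Y := (fY F).
Local Notation sigma := (pFrobenius_aut k_char).

Let rho_phi a : rho (phi a) = sigma (rho a). Proof. by rewrite f_res_phi. Qed.

Lemma map_rho_phi m n (M : 'M[A]_(m, n)) :
  map_mx rho (map_mx phi M) = map_mx sigma (map_mx rho M).
Proof. by apply/matrixP => i j; rewrite !mxE rho_phi. Qed.

Lemma map_rho_phi0 m n (M : 'M[A]_(m, n)) :
  map_mx rho M = 0 -> map_mx rho (map_mx phi M) = 0.
Proof. by move=> h; rewrite map_rho_phi h map_mx0. Qed.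

(** The equation says that the rows of $(1\;Z)$ span a submodule stable under the semilinear map
    with matrix $C$. Solved for the factor $Z$ on the right, it becomes a fixed-point equation for
    the map [T]. *)
Lemma lift_flag h l (C11 : 'M[A]_h) C12 C21 (C22 : 'M[A]_l) :
  map_mx rho C11 \in unitmx -> map_mx rho C12 = 0 -> topnil F C22 ->
  exists Z : 'M[A]_(h, l), map_mx rho Z = 0 /\
    C12 + map_mx phi Z *m C22 = (C11 + map_mx phi Z *m C21) *m Z.
Proof.
move=> u11 r12 nil22.
(* A total inverse, with default 0; it is only used at matrices congruent to [C11] modulo the
   maximal ideal. *)
have /choice[inv hinv] : forall D : 'M[A]_h, exists D', map_mx rho D \in unitmx ->
    D *m D' = 1%:M /\ D' *m D = 1%:M.
  move=> D; have [/mx_lift_unit[D' h']|nu] := boolP (map_mx rho D \in unitmx).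
    by exists D'.
  by exists 0 => h'; case/negP: nu.
pose D Z := C11 + map_mx phi Z *m C21.
pose T Z := inv (D Z) *m (C12 + map_mx phi Z *m C22).
have uD Z : map_mx rho Z = 0 -> map_mx rho (D Z) \in unitmx.
  by move=> /map_rho_phi0 hZ; rewrite map_mxD map_mxM hZ mul0mx addr0.
have DT Z : map_mx rho Z = 0 -> D Z *m T Z = C12 + map_mx phi Z *m C22.
  by move=> /uD /hinv[h1 _]; rewrite mulmxA h1 mul1mx.
have rT Z : map_mx rho Z = 0 -> map_mx rho (T Z) = 0.
  by move=> /map_rho_phi0 hZ; rewrite map_mxM map_mxD map_mxM hZ mul0mx addr0 r12 mulmx0.
(* [T] is not linear, but a difference of two values is a twisted product whose right factor has the
   residue of [C22], as [twisted_contraction] requires. *)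
have dT Z Z' : map_mx rho Z = 0 -> map_mx rho Z' = 0 ->
    T Z' - T Z = inv (D Z') *m map_mx phi (Z' - Z) *m (C22 - C21 *m T Z).
  move=> hZ hZ'; have [_ h2] := hinv _ (uD _ hZ').
  rewrite -[LHS]mul1mx -h2 -!mulmxA; congr (_ *m _).
  set dl := map_mx phi (Z' - Z).
  have hdl : map_mx phi Z' = map_mx phi Z + dl by rewrite /dl map_mxB addrC subrK.
  have DD : D Z' = D Z + dl *m C21 by rewrite /D hdl mulmxDl addrA.
  rewrite [LHS]mulmxBr (DT _ hZ') DD mulmxDl (DT _ hZ) mulmxBr hdl mulmxDl -mulmxA.
  by rewrite addrA opprD addrA [_ + dl *m C22 - _]addrAC subrr add0r.
pose Z n := iter n T 0.
have rZ n : map_mx rho (Z n) = 0 by elim: n => [|n IH]; rewrite ?map_mx0 //=; apply: rT.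
have [|n|s hs] := @twisted_contraction _ _ _ F k_char h l (fun n => Z n.+1 - Z n)
    (fun n => inv (D (Z n.+1))) (fun n => C22 - C21 *m Z n.+1) _ nil22.
- by move=> n; rewrite map_mxB map_mxM rZ mulmx0 subr0.
- by rewrite -dT.
(* Along the indices $sj$ the sequence converges at the rate that [mx_limit] asks for. *)
have Zn j m : exists M, Z (s * j + m)%N - Z (s * j)%N = p%:R ^+ j *: M.
  elim: m => [|m [M IH]]; first by exists 0; rewrite addn0 subrr scaler0.
  have [M' hM'] := hs j (s * j + m)%N (leq_addr _ _); exists (M' + M).
  by rewrite scalerDr -IH -hM' addnS addrA subrK.
have [|L hL] := @mx_limit _ _ _ F _ _ (fun j => Z (s * j)%N).
  by move=> j; rewrite mulnS addnC; apply: Zn.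
have rL : map_mx rho L = 0.
  have [M hM] := hL 1%N; rewrite -[L](subrK (Z (s * 1)%N)) hM map_mxD map_mxZ.
  by rewrite rmorphXn rho_p // expr1 scale0r rZ addr0.
exists L; split=> //; rewrite -DT // -/(D L); congr (_ *m _).
apply/eqP; rewrite -subr_eq0; apply/eqP; apply: (mx_sep F) => j.
have [M hM] := hL j; have [M' hM'] := hs j (s * j)%N (leqnn _).
have -> : T L - L = (T L - T (Z (s * j)%N)) + (Z (s * j).+1 - Z (s * j)%N) - (L - Z (s * j)%N).
  rewrite /Z /= opprB addrA; set a := T L; set b := T _; set c := iter _ _ _.
  by rewrite addrA subrK subrK.
rewrite dT // hM' hM -[p%:R ^+ j *: M in X in map_mx _ X]/(_ *: _).
rewrite map_mxZ rmorphXn rmorph_nat -scalemxAr -scalemxAl -scalerDr -scalerBr.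
by eexists.
Qed.

Lemma row_free_complete h l (V : 'M[k]_(h, h + l)) : \rank V = h ->
  exists W : 'M[k]_(l, h + l), col_mx V W \in unitmx.
Proof.
move=> rV; have e : \rank (V^C)%MS = l by rewrite mxrank_compl rV addKn.
have [W hW] : exists W : 'M[k]_(l, h + l), (W :=: V^C)%MS.
  by move: (row_base (V^C)%MS) (eq_row_base (V^C)%MS); rewrite e => W hW; exists W.
exists W; rewrite -row_full_unit -sub1mx -addsmxE.
apply: submx_trans (_ : (V + V^C <= _)%MS); last by rewrite addsmxS // hW.
by rewrite sub1mx addsmx_compl_full.
Qed.

Lemma lunit_inv h l (M : 'M[A]_(l, h)) :
  block_mx 1%:M 0 M 1%:M *m block_mx 1%:M 0 (- M) 1%:M = 1%:M :> 'M_(h + l).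
Proof.
rewrite mulmx_block !mul1mx !mulmx1 !mul0mx !mulmx0 ?addr0 ?add0r subrr.
by rewrite -scalar_mx_block.
Qed.

Lemma uunit_inv h l (M : 'M[A]_(h, l)) :
  block_mx 1%:M M 0 1%:M *m block_mx 1%:M (- M) 0 1%:M = 1%:M :> 'M_(h + l).
Proof.
rewrite mulmx_block !mul1mx !mulmx1 !mul0mx !mulmx0 ?addr0 ?add0r addNr.
by rewrite -scalar_mx_block.
Qed.

(** [P] changes the basis of the module and [Q] the generators of its filtration. The lifted flag
    makes $\varphi(B)X$ block triangular; its invertible block forces the top rows of $B$ to be part
    of a basis, which [Q] completes, and $B$ then becomes block diagonal. *)
Lemma frame_block r d (Am B X X' : 'M[A]_d) :
  Am *m B = (E ^+ r)%:M -> B *m Am = (E ^+ r)%:M -> X *m X' = 1%:M ->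
  exists h l (P Q : 'M[A]_(h + l, d)) (P' Q' : 'M[A]_(d, h + l)) A2 B2 X1 X2 X3,
    [/\ P *m P' = 1%:M, P' *m P = 1%:M, Q *m Q' = 1%:M & Q' *m Q = 1%:M] /\
    [/\ P *m B *m Q' = block_mx 1%:M 0 0 B2,
        map_mx phi Q *m X *m P' = block_mx X1 0 X3 X2,
        A2 *m B2 = (E ^+ r)%:M /\ B2 *m A2 = (E ^+ r)%:M,
        map_mx rho X1 \in unitmx /\ map_mx rho X2 \in unitmx
      & topnil F (map_mx phi B2 *m X2)].
Proof.
move=> AB BA XX'; pose C := map_mx phi B *m X.
have [h [l [Pk [Pk' [c1 [c2 [c3 [n [PPk P'Pk hC u1 nil2]]]]]]]]] :=
  twisted_fitting sigma (map_mx rho C).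
have e : d = (h + l)%N.
  by apply/eqP; rewrite eqn_leq (mulmx1_min PPk) (mulmx1_min P'Pk).
subst d; have [P0 hP0] := mx_lift F Pk.
have [|P0' [PP0 P'P0]] := @mx_lift_unit _ _ _ F _ P0.
  by rewrite hP0; have [] := mulmx1_unit PPk.
have hP0' : map_mx rho P0' = Pk'.
  rewrite -[LHS]mul1mx -P'Pk -mulmxA -[X in _ *m (X *m _)]hP0 -map_mxM PP0.
  by rewrite map_mx1 mulmx1.
pose C' := map_mx phi P0 *m C *m P0'.
have rC' : map_mx rho C' = block_mx c1 0 c3 c2.
  by rewrite 2!map_mxM map_rho_phi hP0 hP0' hC.
move: (rC'); rewrite -{1}[C']submxK map_block_mx => /eq_block_mx[r11 r12 r21 r22].
have nil22 : topnil F (drsubmx C').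
  by exists n; rewrite (map_tpow _ _ rho_phi) r22.
have u11 : map_mx rho (ulsubmx C') \in unitmx by rewrite r11.
have [Z [rZ hZ]] := lift_flag (dlsubmx C') u11 r12 nil22.
pose U := block_mx 1%:M Z 0 1%:M : 'M[A]_(h + l).
pose U' := block_mx 1%:M (- Z) 0 1%:M : 'M[A]_(h + l).
have UU' : U *m U' = 1%:M by apply: uunit_inv.
set D := (ulsubmx C' + _) in hZ; set C2 := drsubmx C' - dlsubmx C' *m Z.
have hC'' : map_mx phi U *m C' *m U' = block_mx D 0 (dlsubmx C') C2.
  rewrite -[in LHS](submxK C') map_block_mx !map_mx1 map_mx0 mulmx_block.
  rewrite !mul1mx !mul0mx !add0r -/D hZ mulmx_block !mulmx1 !mulmx0 !addr0.
  by rewrite !mulmxN addNr [X in block_mx _ _ _ X]addrC.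
pose P1 := U *m P0; pose P1' := P0' *m U'.
have PP1 : P1 *m P1' = 1%:M by rewrite mulmxA -[U *m _ *m _]mulmxA PP0 mulmx1.
have P'P1 := mulmx1C PP1.
pose B1 := P1 *m B; pose X1 := X *m P1'; pose X1' := P1 *m X'.
have XX1 : X1 *m X1' = 1%:M by rewrite mulmxA -[X *m _ *m _]mulmxA P'P1 mulmx1.
have hB1X1 : map_mx phi B1 *m X1 = block_mx D 0 (dlsubmx C') C2.
  by rewrite -hC'' /C' /C /B1 /X1 /P1 /P1' !map_mxM !mulmxA.
have rD : map_mx rho D \in unitmx.
  by rewrite /D map_mxD map_mxM (map_rho_phi0 rZ) mul0mx addr0 r11.
(* As [D] and [X1'] are invertible over $k$, the top rows of $\varphi(B_1)$ have rank $h$ there, and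
   so do those of $B_1$, since Frobenius on $k$ preserves ranks. *)
have hB1 : map_mx phi (usubmx B1) = row_mx D 0 *m X1'.
  have : map_mx phi B1 = block_mx D 0 (dlsubmx C') C2 *m X1'.
    by rewrite -hB1X1 -mulmxA XX1 mulmx1.
  by rewrite -[in LHS](vsubmxK B1) map_col_mx mul_col_mx => /eq_col_mx[].
have [|W hW] := @row_free_complete h l (map_mx rho (usubmx B1)).
  rewrite -(mxrank_map sigma) -map_rho_phi hB1 map_mxM mxrankMfree; last first.
    by rewrite row_free_unit; exact: (mx_unit_rho F (mulmx1C XX1)).
  by rewrite map_row_mx map_mx0 rank_row_mx0 mxrank_unit.
(* Since $P_1BA=E^rP_1$, this choice makes the new generators $QA$ start with $E^r$ times the first
   $h$ basis vectors. *)
have [W0 hW0] := mx_lift F W; pose Q := col_mx (usubmx B1) W0.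
have [|Q' [QQ' Q'Q]] := @mx_lift_unit _ _ _ F _ Q; first by rewrite map_col_mx hW0.
have hBQ : B1 *m Q' = block_mx 1%:M 0 (dlsubmx (B1 *m Q')) (drsubmx (B1 *m Q')).
  rewrite -[LHS]submxK.
  have : usubmx (B1 *m Q') = row_mx 1%:M 0.
    rewrite -[in LHS](vsubmxK B1) mul_col_mx col_mxKu.
    have -> : usubmx B1 = row_mx 1%:M 0 *m Q by rewrite mul_row_col mul1mx mul0mx addr0.
    by rewrite -mulmxA QQ' mulmx1.
  by rewrite -{1}[usubmx _]hsubmxK => /eq_row_mx[h1 h2]; rewrite /ulsubmx /ursubmx h1 h2.
set B21 := dlsubmx _ in hBQ; set B22 := drsubmx _ in hBQ.
(* [V] clears [B21]; being lower unitriangular, it preserves the triangular shape and the diagonal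
   blocks of $\varphi(B)X$. *)
pose V := block_mx 1%:M 0 (- B21) 1%:M : 'M[A]_(h + l).
pose V' := block_mx 1%:M 0 B21 1%:M : 'M[A]_(h + l).
have VV' : V *m V' = 1%:M by rewrite /V /V' -{2}(opprK B21) lunit_inv.
pose P := V *m P1; pose P' := P1' *m V'.
have PP' : P *m P' = 1%:M by rewrite mulmxA -[V *m _ *m _]mulmxA PP1 mulmx1.
have P'P := mulmx1C PP'.
have hPBQ : P *m B *m Q' = block_mx 1%:M 0 0 B22.
  have -> : P *m B *m Q' = V *m (B1 *m Q') by rewrite /P /B1 !mulmxA.
  rewrite hBQ mulmx_block.
  by rewrite !mul1mx !mulmx1 !mul0mx !mulmx0 !addr0 add0r addNr.
pose X4 := map_mx phi Q *m X *m P'.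
have hX4 : map_mx phi (P *m B *m Q') *m X4 =
    block_mx D 0 (dlsubmx (map_mx phi (P *m B *m Q') *m X4)) C2.
  have -> : map_mx phi (P *m B *m Q') *m X4 =
      map_mx phi V *m block_mx D 0 (dlsubmx C') C2 *m V'.
    rewrite -hB1X1 /X4 -[P *m B *m Q']mulmxA map_mxM -!mulmxA.
    rewrite [map_mx phi (B *m Q') *m _]mulmxA -map_mxM -[B *m Q' *m Q]mulmxA Q'Q mulmx1.
    by rewrite /X1 /P' /B1 /P !map_mxM !mulmxA.
  rewrite /V /V' map_block_mx !map_mx1 map_mx0 !mulmx_block block_mxKdl.
  by rewrite !mul1mx !mulmx1 !mul0mx !mulmx0 !add0r !addr0 mul0mx addr0.
pose A4 := Q *m Am *m P'.
have AB4 : A4 *m (P *m B *m Q') = (E ^+ r)%:M.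
  have -> : A4 *m (P *m B *m Q') = Q *m (Am *m (P' *m P) *m B) *m Q'.
    by rewrite /A4 !mulmxA.
  by rewrite P'P mulmx1 AB mul_mx_scalar -scalemxAl QQ' scalemx1.
have BA4 : P *m B *m Q' *m A4 = (E ^+ r)%:M.
  have -> : P *m B *m Q' *m A4 = P *m (B *m (Q' *m Q) *m Am) *m P'.
    by rewrite /A4 !mulmxA.
  by rewrite Q'Q mulmx1 BA mul_mx_scalar -scalemxAl PP' scalemx1.
have hX : X4 = block_mx (ulsubmx X4) 0 (dlsubmx X4) (drsubmx X4) /\
    map_mx phi B22 *m drsubmx X4 = C2.
  move: hX4; rewrite hPBQ map_block_mx map_mx1 !map_mx0 -{1}[X4]submxK mulmx_block.
  rewrite !mul1mx !mul0mx !addr0 !add0r => /eq_block_mx[_ h12 _ h22].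
  by split=> //; rewrite -{1}[X4]submxK h12.
exists h, l, P, Q, P', Q', (drsubmx A4), B22, (ulsubmx X4), (drsubmx X4), (dlsubmx X4).
split=> //; split=> //; first by case: hX.
- move: AB4 BA4; rewrite hPBQ -[A4]submxK !mulmx_block !mul0mx !mulmx0 !addr0 !add0r.
  rewrite !scalar_mx_block submxK => /eq_block_mx[_ _ _ ->] /eq_block_mx[_ _ _ ->].
  by [].
- have : map_mx rho X4 \in unitmx.
    apply: (@mx_unit_rho _ _ _ F _ X4 (P *m X' *m map_mx phi Q')).
    have -> : X4 *m (P *m X' *m map_mx phi Q') =
        map_mx phi Q *m (X *m (P' *m P) *m X') *m map_mx phi Q'.
      by rewrite /X4 !mulmxA.
    by rewrite P'P mulmx1 XX' mulmx1 -map_mxM QQ' map_mx1.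
  case: hX => -> _; rewrite map_block_mx map_mx0 unitmxE det_lblock unitrM.
  by rewrite block_mxKul block_mxKdr -!unitmxE => /andP[].
- case: hX => _ ->; apply: (topnil_rho (F := F) k_char _ nil22).
  by rewrite /C2 map_mxB map_mxM rZ mulmx0 subr0.
Qed.

End FrameBlocks.

(** * Generators of Fil^r *)

Section AdaptedBases.
Variables (p : nat) (k : fieldType) (A : comNzRingType) (F : frame p k A).
Hypothesis p_prime : prime p.
Hypothesis k_char : p \in [pchar k].

Local Notation phi := (fphi F).
Local Notation rho := (fres F).
Local Notation E := (fE F).
Local Notation Y := (fY F).

Definition base_mx m n (M : 'M[A]_(m, n)) := forall i j, fbase F (M i j).

Lemma base0 : fbase F 0.
Proof. by rewrite -(subrr 1); apply: f_baseB; apply: f_base1. Qed.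

Lemma baseD a b : fbase F a -> fbase F b -> fbase F (a + b).
Proof.
by move=> ha hb; rewrite -[b]opprK -[- b]sub0r; do 2!apply: f_baseB => //; apply: base0.
Qed.

Lemma baseX a n : fbase F a -> fbase F (a ^+ n).
Proof.
by move=> ha; elim: n => [|n IH]; [apply: f_base1 | rewrite exprS; apply: f_baseM].
Qed.

Lemma base_mxM m n l (M : 'M[A]_(m, n)) (N : 'M[A]_(n, l)) :
  base_mx M -> base_mx N -> base_mx (M *m N).
Proof.
move=> hM hN i j; rewrite mxE; elim/big_rec: _ => [|i' x _ hx]; first exact: base0.
by apply: baseD => //; apply: f_baseM.
Qed.

Lemma base_mxB m n (M N : 'M[A]_(m, n)) : base_mx M -> base_mx N -> base_mx (M - N).
Proof. by move=> hM hN i j; rewrite !mxE; apply: f_baseB. Qed.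

Lemma base_mxZ c m n (M : 'M[A]_(m, n)) : fbase F c -> base_mx M -> base_mx (c *: M).
Proof. by move=> hc hM i j; rewrite mxE; apply: f_baseM. Qed.

Lemma base_scalar c n : fbase F c -> base_mx (c%:M : 'M[A]_n).
Proof. by move=> hc i j; rewrite mxE; case: eqP => _ //; apply: base0. Qed.

Lemma base_EX n : fbase F (E ^+ n). Proof. exact/baseX/f_baseE. Qed.

Lemma base_mx_decomp m n (M : 'M[A]_(m, n)) :
  exists M0 N, base_mx M0 /\ M = M0 + Y *: N.
Proof.
have [f hf] := @mx_pred_choice _ m n (A * A) (fun x y => fbase F y.1 /\ x = y.1 + Y * y.2) M
  (fun i j => let: ex_intro2 b hb (ex_intro t ht) := f_base_decomp F (M i j) in
     ex_intro _ (b, t) (conj hb ht)).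
exists (\matrix_(i, j) (f i j).1), (\matrix_(i, j) (f i j).2); split.
  by move=> i j; rewrite mxE; case: (hf i j).
by apply/matrixP => i j; rewrite !mxE; case: (hf i j).
Qed.

Lemma base_mx_Y m n (M N : 'M[A]_(m, n)) : base_mx M -> M = Y *: N ->
  exists2 M', base_mx M' & M = E ^+ p *: M'.
Proof.
move=> hM hN.
have [f hf] := @mx_pred_choice _ m n A (fun x y => fbase F y /\ x = y * E ^+ p) M
  (fun i j => let: ex_intro2 b hb ht :=
      @f_base_Y _ _ _ F (M i j) (N i j) (hM i j)
       (etrans (congr1 (fun M : 'M_(_, _) => M i j) hN) (mxE _ _ i j)) in
     ex_intro _ b (conj hb ht)).
exists (\matrix_(i, j) f i j); first by move=> i j; rewrite mxE; case: (hf i j).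
by apply/matrixP => i j; rewrite !mxE mulrC; case: (hf i j).
Qed.

(** From $(AB-E^r)A=0$, the adjugate gives $\det A\cdot(AB-E^r)=0$; and $\det A$ divides the regular
    element $E^{rd}$. *)
Lemma mx_fact_comm r d (Am B : 'M[A]_d) :
  B *m Am = (E ^+ r)%:M -> Am *m B = (E ^+ r)%:M.
Proof.
move=> BA; apply/eqP; rewrite -subr_eq0; apply/eqP.
apply: (@mx_EX_inj _ _ _ F p_prime (r * d)); rewrite scaler0.
have h : (Am *m B - (E ^+ r)%:M) *m Am = 0.
  by rewrite mulmxBl -mulmxA BA mul_mx_scalar mul_scalar_mx subrr.
have {}h : \det Am *: (Am *m B - (E ^+ r)%:M) = 0.
  by rewrite -mul_mx_scalar -mul_mx_adj mulmxA h mul0mx.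
have -> : E ^+ (r * d) = \det B * \det Am by rewrite exprM -det_scalar -BA det_mulmx.
by rewrite -scalerA h scaler0.
Qed.

Lemma one_plus_EX_unit n d (H : 'M[A]_d) : (0 < n)%N ->
  exists U', (1%:M + E ^+ n *: H) *m U' = 1%:M.
Proof.
move=> n0; have [|U' [h _]] := @mx_lift_unit _ _ _ F _ (1%:M + E ^+ n *: H).
  rewrite map_mxD map_mxZ rmorphXn rho_E // expr0n eqn0Ngt n0 scale0r addr0.
  by rewrite map_mx1 unitmx1.
by exists U'.
Qed.

(** The difference $M-E^ra$ has entries in $W[u]\cap YA=E^pW[u]$, and $E^p=E^rE^{p-r}$. A congruence
    modulo $Y$ thus becomes an exact divisibility by $E^r$. *)
Lemma base_mx_EX r m n (M a N : 'M[A]_(m, n)) : (r < p)%N ->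
  base_mx M -> base_mx a -> M = E ^+ r *: a + Y *: N ->
  exists b, M = E ^+ r *: (a + E ^+ (p - r) *: b).
Proof.
move=> rp hM ha h; have [||N' _ hN'] := @base_mx_Y _ _ (M - E ^+ r *: a) N.
- by apply: base_mxB => //; apply: base_mxZ => //; apply: base_EX.
- by rewrite h addrAC subrr add0r.
exists N'; rewrite scalerDr scalerA -exprD subnKC ?(ltnW rp) // -hN'.
by rewrite addrC subrK.
Qed.

Lemma mulmx_YY m n l (M M' : 'M[A]_(m, n)) (N N' : 'M[A]_(n, l)) :
  (M + Y *: M') *m (N + Y *: N') = M *m N + Y *: (M *m N' + M' *m (N + Y *: N')).
Proof. by rewrite mulmxDl mulmxDr -scalemxAl -scalemxAr scalerDr addrA. Qed.

Lemma base_mx_fact r d (M N : 'M[A]_d) M0 N0 M1 N1 : (r < p)%N ->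
  base_mx M0 -> base_mx N0 -> M = M0 + Y *: M1 -> N = N0 + Y *: N1 ->
  M *m N = (E ^+ r)%:M ->
  exists G, M0 *m N0 = E ^+ r *: (1%:M + E ^+ (p - r) *: G).
Proof.
move=> rp bM bN hM hN; rewrite hM hN mulmx_YY => /eqP; rewrite -subr_eq0 => /eqP h.
apply: (@base_mx_EX r _ _ _ _ (- (M0 *m N1 + M1 *m (N0 + Y *: N1)))) => //.
- exact: base_mxM.
- exact/base_scalar/f_base1.
- by rewrite scalemx1 scalerN; apply/eqP; rewrite -subr_eq0 opprD opprK addrA addrAC h.
Qed.

(* Modulo Y the matrices Am and B lift to W[u], where they still form a
   factorization of E^r up to a unit, because W[u] meets Y A in E^p W[u]. *)
Lemma mx_fil_division r d (Am B : 'M[A]_d) m (v a b : 'M[A]_(m, d)) : (r < p)%N ->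
  B *m Am = (E ^+ r)%:M -> v *m B = E ^+ r *: a + Y *: b ->
  exists a' w, v = a' *m Am + Y *: w.
Proof.
move=> rp BA hv; have AB := mx_fact_comm BA.
have pr : (0 < p - r)%N by rewrite subn_gt0.
have [v0 [v1 [bv hv0]]] := base_mx_decomp v.
have [A0 [A1 [bA hA0]]] := base_mx_decomp Am.
have [B0 [B1 [bB hB0]]] := base_mx_decomp B.
have [a0 [a1 [ba ha0]]] := base_mx_decomp a.
have [G hG] := base_mx_fact rp bB bA hB0 hA0 BA.
have [G' hG'] := base_mx_fact rp bA bB hA0 hB0 AB.
have [V UV] := one_plus_EX_unit G pr; set U := _ + _ in hG UV.
have [V' UV'] := one_plus_EX_unit G' pr; set U' := _ + _ in hG' UV'.
have [a2 h1] : exists a2, v0 *m B0 = E ^+ r *: a2.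
  have [|||c hc] := @base_mx_EX r _ _ (v0 *m B0) a0
      (b + E ^+ r *: a1 - (v0 *m B1 + v1 *m (B0 + Y *: B1))) rp.
  - exact: base_mxM.
  - exact: ba.
  - move: hv; rewrite hv0 hB0 ha0 mulmx_YY; set x := v0 *m B0; set y := _ + v1 *m _.
    move=> h; apply/matrixP => i j; move/matrixP/(_ i j): h; rewrite !mxE.
    move=> /eqP; rewrite eq_sym -subr_eq => /eqP <-; ring.
  - by exists (a0 + E ^+ (p - r) *: c).
(* Both sides are $A_0B_0A_0$ divided by $E^r$. This moves the unit across $A_0$, so that [v] ends
   up as a combination of rows of $A_0$. *)
have AU : A0 *m U = U' *m A0.
  apply: (@mx_EX_inj _ _ _ F p_prime r).
  by rewrite scalemxAr -hG mulmxA hG' scalemxAl.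
have AV : A0 *m V = V' *m A0.
  by rewrite -[LHS]mul1mx -(mulmx1C UV') -mulmxA [U' *m _]mulmxA -AU -!mulmxA UV mulmx1.
have vU : v0 *m U = a2 *m A0.
  apply: (@mx_EX_inj _ _ _ F p_prime r).
  by rewrite scalemxAr -hG mulmxA h1 scalemxAl.
exists (a2 *m V'), (v1 - a2 *m V' *m A1).
have -> : v = v0 *m U *m V + Y *: v1 by rewrite -mulmxA UV mulmx1.
rewrite vU -mulmxA AV mulmxA hA0 mulmxDr -scalemxAr scalerBr.
by rewrite -addrA [Y *: _ + _]addrC subrK.
Qed.

Definition in_pY (x : A) := exists a b, x = p%:R * a + Y * b.

Lemma in_pYD x y : in_pY x -> in_pY y -> in_pY (x + y).
Proof. by move=> [a [b ->]] [c [d ->]]; exists (a + c), (b + d); ring. Qed.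

Lemma in_pYM x y : in_pY x -> in_pY (y * x).
Proof. by move=> [a [b ->]]; exists (y * a), (y * b); ring. Qed.

Lemma in_pY_mx m n (M : 'M[A]_(m, n)) : (forall i j, in_pY (M i j)) ->
  exists N N', M = p%:R *: N + Y *: N'.
Proof.
move=> h.
have [f hf] := @mx_pred_choice _ m n (A * A) (fun x y => x = p%:R * y.1 + Y * y.2) M
  (fun i j => let: ex_intro a (ex_intro b hb) := h i j in ex_intro _ (a, b) hb).
exists (\matrix_(i, j) (f i j).1), (\matrix_(i, j) (f i j).2).
by apply/matrixP => i j; rewrite !mxE.
Qed.

(* The quotient by (p, Y) is a chain ring: take g of minimal u-adic valuation. *)
Lemma ideal_principal_mod_pY (J : A -> Prop) : J 0 ->
  exists g, J g /\ forall x, J x -> exists a, in_pY (x - a * g).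
Proof.
move=> J0; have [u hu] := f_chain F.
pose Q i := exists x v w y, [/\ J x, v * w = 1, in_pY y & x = v * u ^+ i + y].
have [[i0 Qi0]|nQ] := pselect (exists i, Q i); last first.
  exists 0; split=> // x Jx; exists 0; rewrite mulr0 subr0.
  have [//|[i [v [w [a [b [vw hx]]]]]]] := hu x.
  case: nQ; exists i, x, v, w, (p%:R * a + Y * b); split=> //; last by rewrite addrA.
  by exists a, b.
have exQ : exists i, `[< Q i >] by exists i0; apply/asboolP.
case: (ex_minnP exQ) => i /asboolP[g [v [w [y [Jg vw hy hg]]]]] mini.
exists g; split=> // x Jx; have [hx|[j [v' [w' [a [b [vw' hx]]]]]]] := hu x.
  by exists 0; rewrite mul0r subr0.
have ij : (i <= j)%N.
  apply: mini; apply/asboolP; exists x, v', w', (p%:R * a + Y * b); split=> //.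
    by exists a, b.
  by rewrite addrA.
exists (v' * u ^+ (j - i) * w).
have -> : x - v' * u ^+ (j - i) * w * g = (p%:R * a + Y * b) + - (v' * u ^+ (j - i) * w) * y.
  rewrite hx hg -{1}(subnK ij) exprD.
  transitivity (v' * u ^+ (j - i) * u ^+ i * (1 - v * w) + (p%:R * a + Y * b)
     - (v' * u ^+ (j - i) * w) * y); first by ring.
  by rewrite vw; ring.
by apply: in_pYD; [exists a, b | apply: in_pYM].
Qed.

Definition submod_pred d (L : 'rV[A]_d -> Prop) :=
  L 0 /\ forall a x y, L x -> L y -> L (a *: x + y).

Lemma submod_predD d (L : 'rV[A]_d -> Prop) x y :
  submod_pred L -> L x -> L y -> L (x + y).
Proof. by move=> [_ h] hx hy; rewrite -[x]scale1r; apply: h. Qed.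

Lemma submod_predZ d (L : 'rV[A]_d -> Prop) a x : submod_pred L -> L x -> L (a *: x).
Proof. by move=> [h0 h] hx; rewrite -[_ *: _]addr0; apply: h. Qed.

Lemma submod_predB d (L : 'rV[A]_d -> Prop) x y :
  submod_pred L -> L x -> L y -> L (x - y).
Proof. by move=> hL hx hy; rewrite -scaleN1r; apply: submod_predD => //; apply: submod_predZ. Qed.

Lemma submod_pred_mul d n (L : 'rV[A]_d -> Prop) (a : 'rV_n) (G : 'M_(n, d)) :
  submod_pred L -> (forall i, L (row i G)) -> L (a *m G).
Proof.
move=> hL hG; rewrite mulmx_sum_row; elim/big_rec: _ => [|i x _ hx]; first by case: hL.
by apply: submod_predD => //; apply: submod_predZ.
Qed.

(** Gaussian elimination over the chain ring $A/(p,Y)$: the first row is a member of $L$ whose first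
    coordinate generates those of all members, and induction treats the members whose first
    coordinate vanishes there. One row per coordinate makes $G$ square. *)
Lemma submod_generators_mod_pY d (L : 'rV[A]_d -> Prop) : submod_pred L ->
  exists G : 'M[A]_d, (forall i, L (row i G)) /\
    forall x, L x -> exists a w w', x = a *m G + p%:R *: w + Y *: w'.
Proof.
suff h : submod_pred L -> exists G : 'M[A]_d, (forall i, L (row i G)) /\
    forall x, L x -> exists a, forall j, in_pY ((x - a *m G) 0 j).
  move=> /h[G [hG hG']]; exists G; split=> // x /hG'[a ha]; exists a.
  have [|N [N' hN]] := @in_pY_mx _ _ (x - a *m G); first by move=> i; rewrite ord1.
  by exists N, N'; rewrite -addrA -hN addrC subrK.
elim: d L => [|d IH]; last rewrite -[d.+1]/(1 + d)%N; move=> L hL.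
  exists 0; split=> [[]//|x _]; exists 0 => -[]//.
have [|g [[xg [Lxg hxg]] hg]] := @ideal_principal_mod_pY (fun t => exists x, L x /\ x 0 0 = t).
  by exists 0; rewrite mxE; case: hL.
pose L' (y : 'rV[A]_d) := exists x : 'rV[A]_(1 + d), [/\ L x, in_pY (x 0 0) & rsubmx x = y].
have [|G' [hG' hG'2]] := IH L'.
  split=> [|a _ _ [x [Lx hx <-]] [y [Ly hy <-]]].
    exists 0; split; first by case: hL.
    - by exists 0, 0; rewrite mxE; ring.
    - by rewrite linear0.
  exists (a *: x + y); split; first by case: hL => _; apply.
  - by rewrite !mxE; apply: in_pYD => //; apply: in_pYM.
  - by rewrite linearP.
have /choice[f hf] := hG'.
pose Gd : 'M[A]_(d, 1 + d) := \matrix_i f i.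
exists (col_mx (xg : 'rV_(1 + d)) Gd : 'M[A]_(1 + d)); split.
  move=> i; case: (@split_ordP 1 d i) => i' ->; rewrite ?rowKu ?rowKd ?rowK.
    by rewrite row_id.
  by case: (hf i').
move=> x Lx; have [|c hc] := hg (x 0 0); first by exists x.
have Ly : L (x - c *: xg) by apply: submod_predB => //; apply: submod_predZ.
have [|a ha] := hG'2 (rsubmx (x - c *: xg : 'rV_(1 + d))).
  exists (x - c *: xg); split=> //.
  by rewrite !mxE hxg.
exists (row_mx c%:M a : 'rV_(1 + d)) => j.
have -> : (row_mx c%:M a : 'rV_(1 + d)) *m col_mx (xg : 'rV_(1 + d)) Gd = c *: xg + a *m Gd.
  by rewrite (mul_row_col (c%:M : 'M_1)) mul_scalar_mx.
rewrite opprD addrA; case: (@split_ordP 1 d j) => j' hj.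
  rewrite mxE; apply: in_pYD.
    by move: hc; rewrite hj ord1 !mxE -hxg (_ : lshift d 0 = 0) //; apply: val_inj.
  rewrite mxE -mulN1r; apply: in_pYM; rewrite mxE.
  elim/big_rec: _ => [|i t _ ht]; first by exists 0, 0; ring.
  apply: in_pYD => //; apply: in_pYM; rewrite mxE hj ord1.
  by have [_ h _] := hf i; rewrite (_ : lshift d 0 = 0) //; apply: val_inj.
have := ha j'; rewrite hj.
rewrite (_ : (rsubmx (x - c *: xg : 'rV_(1 + d)) - a *m G') 0 j' =
  (x - c *: xg - a *m Gd) 0 (rshift 1 j')) //.
rewrite !mxE; congr (_ - _); apply: eq_bigr => i _; rewrite mxE.
by have [_ _ h] := hf i; have := congr1 (fun M : 'rV_d => M 0 j') h; rewrite !mxE => <-.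
Qed.

(** If $x=aG+pw+Yw'$ lies in $L$, so does $pw$, hence $w$, the quotient by $L$ being $p$-torsion
    free. The decomposition is repeated on $w$ and the coefficients are summed $p$-adically. *)
Lemma submod_generators_mod_Y d (L : 'rV[A]_d -> Prop) : submod_pred L ->
  (forall x, L (p%:R *: x) -> L x) -> (forall x, L (Y *: x)) ->
  exists G : 'M[A]_d, (forall i, L (row i G)) /\
    forall x, L x -> exists a w, x = a *m G + Y *: w.
Proof.
move=> hL tf LY; have [G [hG hG2]] := submod_generators_mod_pY hL.
exists G; split=> // x Lx.
(* The default value outside $L$ is never met, as the iterates stay in $L$. *)
have /choice[f hf] : forall y, exists t : 'rV[A]_d * 'rV[A]_d * 'rV[A]_d,
    L y -> L t.2 /\ y = t.1.1 *m G + p%:R *: t.2 + Y *: t.1.2.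
  move=> y; have [Ly|nLy] := pselect (L y); last by exists (0, 0, 0).
  have [a [w [w' hy]]] := hG2 y Ly; exists (a, w', w) => _; split=> //=.
  apply: tf; have -> : p%:R *: w = y - a *m G - Y *: w'.
    by rewrite hy addrAC addrK [_ + p%:R *: _]addrC addrK.
  by do 2!apply: submod_predB => //; apply: submod_pred_mul.
pose xs n := iter n (fun y => (f y).2) x.
have Lxs n : L (xs n) by elim: n => [//|n IH] /=; case: (hf _ IH).
have lim (g : 'rV[A]_d * 'rV[A]_d * 'rV[A]_d -> 'rV[A]_d) : exists l, forall n, exists z,
    l - \sum_(i < n) p%:R ^+ i *: g (f (xs i)) = p%:R ^+ n *: z.
  apply: (mx_limit F) => n; exists (g (f (xs n))).
  by rewrite big_ord_recr /= addrAC subrr add0r.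
have xE n : x = (\sum_(i < n) p%:R ^+ i *: (f (xs i)).1.1) *m G +
    Y *: (\sum_(i < n) p%:R ^+ i *: (f (xs i)).1.2) + p%:R ^+ n *: xs n.
  elim: n => [|n IH]; first by rewrite !big_ord0 mul0mx scaler0 !add0r scale1r.
  rewrite [LHS]IH !big_ord_recr /=; have [_ hn] := hf _ (Lxs n).
  rewrite [in X in _ + X = _]hn mulmxDl -scalemxAl.
  move: (_ *m G) ((f (xs n)).1.1 *m G) (\sum_(i < n) p%:R ^+ i *: (f (xs i)).1.2) => s1 t1 s2.
  by apply/matrixP => i j; rewrite !mxE exprS; ring.
have [a ha] := lim (fun t => t.1.1); have [w hw] := lim (fun t => t.1.2).
exists a, w; apply/eqP; rewrite -subr_eq0; apply/eqP; apply: (mx_sep F) => n.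
have [z hz] := ha n; have [z' hz'] := hw n.
exists (xs n - z *m G - Y *: z'); rewrite [in LHS](xE n).
move/eqP: hz; rewrite subr_eq => /eqP ->; move/eqP: hz'; rewrite subr_eq => /eqP ->.
rewrite mulmxDl -scalemxAl.
move: (_ *m G) (z *m G) (\sum_(i < n) p%:R ^+ i *: (f (xs i)).1.2) => s1 t1 s2.
by apply/matrixP => i j; rewrite !mxE; ring.
Qed.

(** Passing to the $W[u]$-parts changes the generators by multiples of $Y$ only. Writing $E^r$
    through them modulo $Y$ gives $B_0A=E^r(1+E^{p-r}N)$, and the inverse of the unit is absorbed
    into $B$. *)
Lemma adapted_basis r d (L : 'rV[A]_d -> Prop) : (r < p)%N -> submod_pred L ->
  (forall x, L (p%:R *: x) -> L x) -> (forall x, L (Y *: x)) ->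
  (forall x, L (E ^+ r *: x)) ->
  exists Am B : 'M[A]_d, [/\ Am *m B = (E ^+ r)%:M, B *m Am = (E ^+ r)%:M &
    forall x, L x <-> exists a w, x = a *m Am + Y *: w].
Proof.
move=> rp hL tf LY LE; have [G [hG hG2]] := submod_generators_mod_Y hL tf LY.
have [Am [G1 [bA hGA]]] := base_mx_decomp G.
have LA i : L (row i Am).
  have -> : row i Am = row i G - Y *: row i G1.
    by apply/rowP => j; rewrite hGA !mxE addrK.
  exact: submod_predB.
have LAP x : L x <-> exists a w, x = a *m Am + Y *: w.
  split=> [/hG2[a [w ->]]|[a [w ->]]]; last first.
    by apply: submod_predD => //; apply: submod_pred_mul.
  exists a, (a *m G1 + w); rewrite hGA mulmxDr -scalemxAr scalerDr addrA.
  by [].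
have /choice[f hf] : forall i, exists t : 'rV[A]_d * 'rV[A]_d,
    row i (E ^+ r)%:M = t.1 *m Am + Y *: t.2.
  move=> i; have /LAP[a [w h]] := LE (row i 1%:M); exists (a, w).
  by rewrite -h -scalemx1; apply/rowP => j; rewrite !mxE.
pose B1 := \matrix_i (f i).1; pose H := \matrix_i (f i).2.
have hE : (E ^+ r)%:M = B1 *m Am + Y *: H.
  apply/row_matrixP => i; rewrite hf linearD linearZ /= row_mul !rowK.
  by [].
have [B0 [B2 [bB hB]]] := base_mx_decomp B1.
have [|||N hN] := @base_mx_EX r _ _ (B0 *m Am) 1%:M (- (B2 *m Am + H)) rp.
- exact: base_mxM.
- exact/base_scalar/f_base1.
- rewrite scalemx1 hE hB mulmxDl -scalemxAl.
  move: (B0 *m Am) (B2 *m Am) => x y.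
  by apply/matrixP => i j; rewrite !mxE; ring.
have pr : (0 < p - r)%N by rewrite subn_gt0.
have [U hU] := one_plus_EX_unit N pr.
have BA : U *m B0 *m Am = (E ^+ r)%:M.
  by rewrite -mulmxA hN -scalemxAr (mulmx1C hU) scalemx1.
by exists Am, (U *m B0); split=> //; apply: mx_fact_comm.
Qed.

End AdaptedBases.

(** * Modules in coordinates *)

Lemma linear_exists (R : nzRingType) (U V : lmodType R) (f : U -> V) :
  linear f -> exists g : {linear U -> V}, forall x, g x = f x.
Proof.
move=> lf; pose g := HB.pack_for {linear U -> V} f (GRing.isLinear.Build R U V *:%R f lf).
by exists g.
Qed.

Lemma linear_inverse (R : nzRingType) (U V : lmodType R) (f : {linear U -> V}) :
  injective f -> (forall y, exists x, f x = y) ->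
  exists g : {linear V -> U}, cancel f g /\ cancel g f.
Proof.
move=> inj /choice[g hg]; have [|g' hg'] := @linear_exists R V U g.
  by move=> a x y; apply: inj; rewrite linearP !hg.
exists g'; split=> x; rewrite hg' ?hg //; apply: inj; exact: hg.
Qed.

Lemma row_dotC (A : comNzRingType) d (v w : 'rV[A]_d) :
  (v *m w^T) 0 0 = (w *m v^T) 0 0.
Proof. by rewrite !mxE; apply: eq_bigr => j _; rewrite !mxE mulrC. Qed.

Lemma row_dot_linear (A : comNzRingType) d (w : 'rV[A]_d) (a : A) (u v : 'rV[A]_d) :
  ((a *: u + v) *m w^T) 0 0 = a * (u *m w^T) 0 0 + (v *m w^T) 0 0.
Proof. by rewrite mulmxDl -scalemxAl !mxE. Qed.

Lemma row_dot_linearr (A : comNzRingType) d (w : 'rV[A]_d) (a : A) (u v : 'rV[A]_d) :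
  (w *m (a *: u + v)^T) 0 0 = a * (w *m u^T) 0 0 + (w *m v^T) 0 0.
Proof. by rewrite !(row_dotC w) row_dot_linear. Qed.

Lemma row_functional (A : comNzRingType) d (h : 'rV[A]_d -> A) :
  (forall a (u v : 'rV[A]_d), h (a *: u + v) = a * h u + h v) ->
  exists w : 'rV[A]_d, forall v, h v = (v *m w^T) 0 0.
Proof.
move=> lh; exists (\row_j h (delta_mx 0 j)) => v.
have h0 : h 0 = 0 by have := lh (-1) 0 0; rewrite scaler0 addr0 mulN1r addNr.
rewrite {1}(row_sum_delta v) mxE.
have hs n (a : 'I_n -> A) (u : 'I_n -> 'rV[A]_d) : h (\sum_i a i *: u i) = \sum_i a i * h (u i).
  elim: n a u => [|n IH] a u; first by rewrite !big_ord0.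
  by rewrite !big_ord_recl lh IH.
by rewrite hs; apply: eq_bigr => j _; rewrite !mxE.
Qed.

Lemma row_dot_inj (A : comNzRingType) d (u v : 'rV[A]_d) :
  (forall w : 'rV[A]_d, (w *m u^T) 0 0 = (w *m v^T) 0 0) -> u = v.
Proof.
move=> h; apply/rowP => j; have := h (delta_mx 0 j).
by rewrite -!rowE !mxE.
Qed.

Section FrameModules.
Variables (p : nat) (k : fieldType) (A : comNzRingType) (F : frame p k A) (r : nat).
Hypothesis p_prime : prime p.
Hypothesis k_char : p \in [pchar k].
Hypothesis rp : (r < p)%N.

Local Notation phi := (fphi F).
Local Notation E := (fE F).
Local Notation Y := (fY F).
Local Notation c := (fc F).
Local Notation cinv := (fcinv F).

Definition ffil (s : A) := exists a b, s = a * E ^+ r + b * Y.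

Variable phir : A -> A.
Hypothesis phirE : forall s, ffil s -> p%:R ^+ r * phir s = phi s.

Lemma ffilD s t : ffil s -> ffil t -> ffil (s + t).
Proof. by move=> [a [b ->]] [a' [b' ->]]; exists (a + a'), (b + b'); ring. Qed.

Lemma ffilM s t : ffil s -> ffil (t * s).
Proof. by move=> [a [b ->]]; exists (t * a), (t * b); ring. Qed.

Lemma ffil0 : ffil 0. Proof. by exists 0, 0; ring. Qed.
Lemma ffil_EX : ffil (E ^+ r). Proof. by exists 1, 0; ring. Qed.
Lemma ffil_Y : ffil Y. Proof. by exists 0, 1; ring. Qed.

Lemma ffil_sum (I : Type) (s : seq I) (P : pred I) (f : I -> A) :
  (forall i, P i -> ffil (f i)) -> ffil (\sum_(i <- s | P i) f i).
Proof.
move=> h; elim/big_rec: _ => [|i x Pi hx]; first exact: ffil0.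
by apply: ffilD => //; apply: h.
Qed.

Definition mfil m n (M : 'M[A]_(m, n)) := forall i j, ffil (M i j).
Definition mphir m n (M : 'M[A]_(m, n)) := map_mx phir M.

Lemma mfilD m n (M N : 'M[A]_(m, n)) : mfil M -> mfil N -> mfil (M + N).
Proof. by move=> hM hN i j; rewrite mxE; apply: ffilD. Qed.

Lemma mfilMl m n l (M : 'M[A]_(m, n)) (N : 'M[A]_(n, l)) : mfil N -> mfil (M *m N).
Proof. by move=> h i j; rewrite mxE; apply: ffil_sum => i' _; apply: ffilM. Qed.

Lemma mfilMr m n l (M : 'M[A]_(m, n)) (N : 'M[A]_(n, l)) : mfil M -> mfil (M *m N).
Proof. by move=> h i j; rewrite mxE; apply: ffil_sum => i' _; rewrite mulrC; apply: ffilM. Qed.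

Lemma mfilZ m n s (M : 'M[A]_(m, n)) : mfil M -> mfil (s *: M).
Proof. by move=> h i j; rewrite mxE; apply: ffilM. Qed.

Lemma mfil_sZ m n s (M : 'M[A]_(m, n)) : ffil s -> mfil (s *: M).
Proof. by move=> h i j; rewrite mxE mulrC; apply: ffilM. Qed.

Lemma mfil_EX m n (M : 'M[A]_(m, n)) : mfil (E ^+ r *: M).
Proof. exact/mfil_sZ/ffil_EX. Qed.

Lemma mfil_tr m n (M : 'M[A]_(m, n)) : mfil M -> mfil M^T.
Proof. by move=> h i j; rewrite mxE. Qed.

Lemma mfilE m n (M : 'M[A]_(m, n)) : mfil M <-> exists a b, M = E ^+ r *: a + Y *: b.
Proof.
split=> [h|[a [b ->]]]; last by apply: mfilD; apply: mfil_sZ; [apply: ffil_EX|apply: ffil_Y].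
have [f hf] := @mx_pred_choice _ m n (A * A) (fun x y => x = y.1 * E ^+ r + y.2 * Y) M
  (fun i j => let: ex_intro a (ex_intro b hb) := h i j in ex_intro _ (a, b) hb).
exists (\matrix_(i, j) (f i j).1), (\matrix_(i, j) (f i j).2).
by apply/matrixP => i j; rewrite !mxE hf; ring.
Qed.

Lemma mfil_tf m n (M : 'M[A]_(m, n)) : mfil (p%:R *: M) -> mfil M.
Proof. by move=> h i j; apply: (f_fil_tf rp); have := h i j; rewrite mxE. Qed.

(** The regularity of $p$ determines $\varphi_r$ on the filtration, so its identities are proved
    after multiplication by $p^r$. *)
Lemma phir_eq s t : ffil s -> p%:R ^+ r * t = phi s -> phir s = t.
Proof.
move=> hs h; apply/eqP; rewrite -subr_eq0; apply/eqP; apply: (@frame_pX_reg _ _ _ F r).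
by rewrite mulrBr phirE // h subrr.
Qed.

Lemma phir_EX : phir (E ^+ r) = c ^+ r.
Proof. by apply: phir_eq; [apply: ffil_EX | rewrite rmorphXn f_phiE exprMn]. Qed.

Lemma cX_K : c ^+ r * cinv ^+ r = 1. Proof. by rewrite -exprMn f_cK expr1n. Qed.
Lemma cinvX_K : cinv ^+ r * c ^+ r = 1. Proof. by rewrite mulrC cX_K. Qed.

Lemma mphirE m n (M : 'M[A]_(m, n)) : mfil M -> p%:R ^+ r *: mphir M = map_mx phi M.
Proof. by move=> h; apply/matrixP => i j; rewrite !mxE phirE. Qed.

Lemma mphir_eq m n (M N : 'M[A]_(m, n)) : mfil M ->
  p%:R ^+ r *: N = map_mx phi M -> mphir M = N.
Proof.
move=> hM h; apply/matrixP => i j; rewrite mxE; apply: phir_eq => //.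
by have := congr1 (fun M : 'M_(_, _) => M i j) h; rewrite !mxE.
Qed.

Lemma mphirD m n (M N : 'M[A]_(m, n)) : mfil M -> mfil N ->
  mphir (M + N) = mphir M + mphir N.
Proof.
move=> hM hN; apply: mphir_eq; first exact: mfilD.
by rewrite scalerDr !mphirE // map_mxD.
Qed.

Lemma mphirMl m n l (M : 'M[A]_(m, n)) (N : 'M[A]_(n, l)) : mfil N ->
  mphir (M *m N) = map_mx phi M *m mphir N.
Proof.
move=> h; apply: mphir_eq; first exact: mfilMl.
by rewrite scalemxAr mphirE // map_mxM.
Qed.

Lemma mphirMr m n l (M : 'M[A]_(m, n)) (N : 'M[A]_(n, l)) : mfil M ->
  mphir (M *m N) = mphir M *m map_mx phi N.
Proof.
move=> h; apply: mphir_eq; first exact: mfilMr.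
by rewrite scalemxAl mphirE // map_mxM.
Qed.

Lemma mphirZ m n s (M : 'M[A]_(m, n)) : mfil M -> mphir (s *: M) = phi s *: mphir M.
Proof.
by move=> h; rewrite -mul_scalar_mx mphirMl // map_scalar_mx mul_scalar_mx.
Qed.

Lemma mphir_sZ m n s (M : 'M[A]_(m, n)) : ffil s -> mphir (s *: M) = phir s *: map_mx phi M.
Proof.
move=> h; apply: mphir_eq; first exact: mfil_sZ.
by rewrite scalerA phirE //; apply/matrixP => i j; rewrite !mxE rmorphM.
Qed.

(** When $AB=BA=E^r$, the condition $vB\in(E^r,Y)$ says that $v$ is a combination of the rows of $A$
    modulo $Y$, by [mx_fil_division]. In this form it is a condition on entries, without existential
    coefficients. *)
Definition std_fil d (Bm : 'M[A]_d) (v : 'rV[A]_d) : Prop := mfil (v *m Bm).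
(* phi_r in terms of the coordinates v B of E^r v = (v B) A on the rows of A. *)
Definition std_phi d (Bm X : 'M[A]_d) (v : 'rV[A]_d) : 'rV[A]_d :=
  cinv ^+ r *: (mphir (v *m Bm) *m X).

Lemma std_phi_EX d (Bm X : 'M[A]_d) v :
  std_phi Bm X (E ^+ r *: v) = map_mx phi v *m (map_mx phi Bm *m X).
Proof.
rewrite /std_phi -scalemxAl mphir_sZ; last exact: ffil_EX.
by rewrite phir_EX -scalemxAl scalerA cinvX_K scale1r map_mxM mulmxA.
Qed.

Lemma std_phi_sZ d (Bm X : 'M[A]_d) s v : ffil s ->
  std_phi Bm X (s *: v) = (cinv ^+ r * phir s) *: std_phi Bm X (E ^+ r *: v).
Proof.
move=> hs; rewrite std_phi_EX /std_phi -scalemxAl mphir_sZ //.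
by rewrite -scalemxAl scalerA map_mxM mulmxA.
Qed.

(* Coordinates in which Fil^r is spanned by the rows of Am modulo Y, and phi_r
   sends these rows to those of X. *)
Record presentation (M : lmodType A) (Fil : M -> Prop) (Phi : M -> M) d
    (Am Bm X X' : 'M[A]_d) (e : {linear 'rV[A]_d -> M}) : Prop := Presentation {
  pres_AB : Am *m Bm = (E ^+ r)%:M;
  pres_BA : Bm *m Am = (E ^+ r)%:M;
  pres_X : X *m X' = 1%:M;
  pres_inj : injective e;
  pres_surj : forall x, exists v, e v = x;
  pres_fil : forall v, Fil (e v) <-> std_fil Bm v;
  pres_phi : forall v, std_fil Bm v -> Phi (e v) = e (std_phi Bm X v)
}.

(* is_Mod with Sigma replaced by an arbitrary ring with a frame. *)
Record module_axioms (M : lmodType A) (Fil : M -> Prop) (Phi : M -> M) : Prop :=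
  ModuleAxioms {
  ma_free : exists (n : nat) (e : 'I_n -> M),
    forall x : M, exists! a : 'rV[A]_n, x = \sum_i a 0 i *: e i;
  ma_fil_submod : forall (a : A) (x y : M), Fil x -> Fil y -> Fil (a *: x + y);
  ma_fil_ge : forall x : M, (exists (n : nat) (s : 'I_n -> A) (y : 'I_n -> M),
     (forall i, ffil (s i)) /\ x = \sum_i s i *: y i) -> Fil x;
  ma_phiD : forall x y : M, Fil x -> Fil y -> Phi (x + y) = Phi x + Phi y;
  ma_phiZ : forall (a : A) (x : M), Fil x -> Phi (a *: x) = phi a *: Phi x;
  ma_phi_compat : forall (s : A) (x : M), ffil s ->
    Phi (s *: x) = (cinv ^+ r * phir s) *: Phi (E ^+ r *: x);
  ma_phi_gen : forall x : M, exists (n : nat) (a : 'I_n -> A) (y : 'I_n -> M),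
      (forall i, Fil (y i)) /\ x = \sum_i a i *: Phi (y i);
  ma_fil_tf : forall x : M, Fil (p%:R *: x) -> Fil x
}.

Lemma row_scalar_EX d (i : 'I_d) : row i (E ^+ r)%:M = E ^+ r *: delta_mx 0 i.
Proof. by apply/rowP => j; rewrite !mxE eqxx /= mulr_natr eq_sym. Qed.

Section Presented.
Variables (M : lmodType A) (Fil : M -> Prop) (Phi : M -> M) (d : nat).
Variables (Am Bm X X' : 'M[A]_d) (e : {linear 'rV[A]_d -> M}).
Hypothesis pres : presentation Fil Phi Am Bm X X' e.

Lemma std_fil_row i : std_fil Bm (row i Am).
Proof. by rewrite /std_fil -row_mul (pres_AB pres) row_scalar_EX; apply: mfil_EX. Qed.

Lemma std_phi_row i : std_phi Bm X (row i Am) = row i X.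
Proof.
rewrite /std_phi -row_mul (pres_AB pres) row_scalar_EX mphir_sZ; last exact: ffil_EX.
rewrite phir_EX -scalemxAl scalerA cinvX_K scale1r.
by apply/rowP => j; rewrite map_delta_mx -rowE.
Qed.

Lemma presentation_module : module_axioms Fil Phi.
Proof.
have [AB BA XX' inj surj hfil hphi] := pres.
split.
- exists d, (fun i => e (delta_mx 0 i)) => x; have [v <-] := surj x.
  have eE (a : 'rV_d) : e a = \sum_i a 0 i *: e (delta_mx 0 i).
    by rewrite {1}(row_sum_delta a) linear_sum; apply: eq_bigr => i _; rewrite linearZ.
  exists v; split=> [|a]; rewrite -?eE // => ha; exact: inj.
- move=> a x y; have [v <-] := surj x; have [w <-] := surj y.
  rewrite -linearP !hfil => hv hw; rewrite /std_fil mulmxDl -scalemxAl.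
  by apply: mfilD => //; apply: mfilZ.
- move=> x [n [s [y [hs ->]]]].
  have /choice[f hf] := fun i => surj (y i).
  have -> : \sum_i s i *: y i = e (\sum_i s i *: f i).
    by rewrite linear_sum; apply: eq_bigr => i _; rewrite linearZ hf.
  apply/hfil; rewrite /std_fil mulmx_suml => i j; rewrite summxE; apply: ffil_sum => i' _.
  by rewrite -scalemxAl mxE mulrC; apply: ffilM.
- move=> x y; have [v <-] := surj x; have [w <-] := surj y.
  rewrite -linearD !hfil => hv hw.
  have hvw : std_fil Bm (v + w) by rewrite /std_fil mulmxDl; apply: mfilD.
  by rewrite !hphi // -linearD /std_phi mulmxDl mphirD // mulmxDl scalerDr.
- move=> a x; have [v <-] := surj x; rewrite hfil => hv.
  have hav : std_fil Bm (a *: v) by rewrite /std_fil -scalemxAl; apply: mfilZ.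
  rewrite -linearZ !hphi // -linearZ /std_phi -scalemxAl mphirZ //.
  by rewrite -scalemxAl !scalerA mulrC.
- move=> s x hs; have [v <-] := surj x.
  rewrite -!linearZ !hphi; last 2 first.
  + by rewrite /std_fil -scalemxAl; apply: mfil_EX.
  + by rewrite /std_fil -scalemxAl; apply: mfil_sZ.
  by rewrite -linearZ std_phi_sZ.
- move=> x; have [v <-] := surj x.
  exists d, (fun i => (v *m X') 0 i), (fun i => e (row i Am)).
  split=> [i|]; first by apply/hfil; apply: std_fil_row.
  transitivity (e (v *m X' *m X)); first by rewrite -mulmxA (mulmx1C XX') mulmx1.
  rewrite mulmx_sum_row linear_sum; apply: eq_bigr => i _.
  by rewrite linearZ hphi ?std_phi_row //; apply: std_fil_row.
- by move=> x; have [v <-] := surj x; rewrite -linearZ !hfil /std_fil -scalemxAl; apply: mfil_tf.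
Qed.

End Presented.

(** $X$ collects the coordinates of $\varphi_r$ on the rows of $A$. On the remaining part $Yw$, the
    compatibility axiom reduces to $\varphi_r(E^rw)$, and $E^rw=(wB)A$. So every value of
    $\varphi_r$ lies in the row span of $X$, which is everything because these values generate. *)
Lemma module_presentation (M : lmodType A) (Fil : M -> Prop) (Phi : M -> M) :
  module_axioms Fil Phi -> exists d (Am Bm X X' : 'M[A]_d) (e : {linear 'rV[A]_d -> M}),
    presentation Fil Phi Am Bm X X' e.
Proof.
move=> [[d [b free]] sub ge phiD phiZ compat gen tf].
have [|e he] := @linear_exists A 'rV[A]_d M (fun v => \sum_i v 0 i *: b i).
  move=> a v w; rewrite scaler_sumr -big_split; apply: eq_bigr => i _ /=.
  by rewrite !mxE scalerDl scalerA.
have inj : injective e.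
  move=> v w; rewrite !he => h; have [u [_ hu]] := free (\sum_i v 0 i *: b i).
  by rewrite -(hu v) // -(hu w).
have surj x : exists v, e v = x by have [v [hv _]] := free x; exists v; rewrite he.
have span1 s x : ffil s -> Fil (s *: x).
  by move=> hs; apply: ge; exists 1%N, (fun=> s), (fun=> x); rewrite big_ord1.
have [||||Am [Bm [AB BA hL]]] := @adapted_basis _ _ _ F p_prime k_char r d (fun v => Fil (e v)) rp.
- split=> [|a x y hx hy]; last by rewrite linearP; apply: sub.
  by rewrite linear0 -(scale0r 0); apply: span1; apply: ffil0.
- by move=> x; rewrite linearZ; apply: tf.
- by move=> x; rewrite linearZ; apply: span1; apply: ffil_Y.
- by move=> x; rewrite linearZ; apply: span1; apply: ffil_EX.
have FilA i : Fil (e (row i Am)).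
  by apply/hL; exists (delta_mx 0 i), 0; rewrite scaler0 addr0 -rowE.
have /choice[f hf] := fun i => surj (Phi (e (row i Am))).
pose X := \matrix_i f i : 'M_d.
have phi_sum n (a : 'I_n -> A) (y : 'I_n -> M) : (forall i, Fil (y i)) ->
    Fil (\sum_i a i *: y i) /\ Phi (\sum_i a i *: y i) = \sum_i phi (a i) *: Phi (y i).
  elim: n a y => [|n IH] a y hy.
    rewrite !big_ord0; have F0 : Fil 0 by rewrite -(scale0r 0); apply: span1; apply: ffil0.
    by split=> //; rewrite -{1}(scale0r 0) phiZ // rmorph0 scale0r.
  rewrite !big_ord_recl; have [h1 h2] := IH (fun i => a (lift ord0 i)) (fun i => y (lift ord0 i)) (fun i => hy _).
  have h0 := hy ord0; split; first exact: sub.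
  have h3 : Fil (a ord0 *: y ord0).
    rewrite -[_ *: _]addr0; apply: sub => //.
    by rewrite -(scale0r 0); apply: span1; apply: ffil0.
  by rewrite phiD // phiZ // h2.
have phi_row (a : 'rV_d) : Fil (e (a *m Am)) /\ Phi (e (a *m Am)) = e (map_mx phi a *m X).
  have [h1 h2] := phi_sum _ (fun i => a 0 i) (fun i => e (row i Am)) FilA.
  have -> : e (a *m Am) = \sum_i a 0 i *: e (row i Am).
    by rewrite mulmx_sum_row linear_sum; apply: eq_bigr => i _; rewrite linearZ.
  split=> //; rewrite h2 mulmx_sum_row linear_sum; apply: eq_bigr => i _.
  by rewrite linearZ mxE rowK hf.
have phi_EX v : Phi (E ^+ r *: e v) = e (map_mx phi v *m (map_mx phi Bm *m X)).
  have -> : E ^+ r *: e v = e (v *m Bm *m Am) by rewrite -mulmxA BA mul_mx_scalar linearZ.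
  have [_ ->] := phi_row (v *m Bm).
  by rewrite map_mxM mulmxA.
have phi_all v a w : v = a *m Am + Y *: w ->
    Phi (e v) = e ((map_mx phi a + (cinv ^+ r * phir Y) *: map_mx phi (w *m Bm)) *m X).
  move=> ->; have [h1 h2] := phi_row a.
  rewrite linearD phiD //; last by rewrite linearZ; apply: span1; apply: ffil_Y.
  rewrite h2 [e (Y *: w)]linearZ compat; last exact: ffil_Y.
  rewrite phi_EX -linearZ -linearD mulmxDl -scalemxAl map_mxM mulmxA.
  by [].
have [X' XX'] : exists X', X *m X' = 1%:M.
  suff /choice[g hg] : forall i, exists t : 'rV_d, row i 1%:M = t *m X.
    exists (\matrix_i g i); apply: mulmx1C; apply/row_matrixP => i.
    by rewrite row_mul rowK -hg.
  move=> i; have [n [a [y [hy ha]]]] := gen (e (row i 1%:M)).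
  have /choice[g hg] : forall j, exists t : 'rV_d, Phi (y j) = e (t *m X).
    move=> j; have [v hv] := surj (y j); have := hy j; rewrite -hv => /hL[a' [w h]].
    by rewrite (phi_all _ _ _ h); eexists.
  exists (\sum_j a j *: g j); apply: inj; rewrite ha mulmx_suml linear_sum.
  by apply: eq_bigr => j _; rewrite -scalemxAl linearZ hg.
exists d, Am, Bm, X, X', e.
have stdP v : std_fil Bm v <-> exists a w, v = a *m Am + Y *: w.
  split=> [/mfilE[a [b' h]]|[a [w ->]]].
    exact: (mx_fil_division p_prime k_char rp BA h).
  rewrite /std_fil mulmxDl -mulmxA AB mul_mx_scalar -scalemxAl.
  by apply/mfilE; exists a, (w *m Bm).
split=> //; first by move=> v; rewrite stdP.
move=> v /stdP[a [w h]]; rewrite (phi_all _ _ _ h); congr (e _).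
rewrite /std_phi h [(_ + _) *m Bm]mulmxDl -mulmxA AB mul_mx_scalar -scalemxAl mphirD; last 2 first.
- exact: mfil_EX.
- exact/mfil_sZ/ffil_Y.
rewrite !mphir_sZ; try exact: ffil_Y; try exact: ffil_EX.
by rewrite phir_EX !mulmxDl scalerDr -!scalemxAl !scalerA cinvX_K scale1r.
Qed.

Lemma phir0 : phir 0 = 0.
Proof. by apply: phir_eq; rewrite ?mulr0 ?rmorph0 //; apply: ffil0. Qed.

Lemma mphir0 m n : mphir (0 : 'M[A]_(m, n)) = 0.
Proof. by apply/matrixP => i j; rewrite !mxE phir0. Qed.

(** The induction principle on $N$ says that the image of [FN] generates $N$. Hence the coordinates
    of $f(x)$ lie in the row span of every twisted power of $C=\varphi(B)X$; one of these is
    divisible by $p$, and repetition gives divisibility by all $p^j$. *)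
Lemma presentation_hom_zero (M N : lmodType A) (Fil : M -> Prop) (Phi : M -> M) d
    (Am Bm X X' : 'M[A]_d) (e : {linear 'rV[A]_d -> M}) (FN : N -> N) (f : {linear N -> M}) :
  presentation Fil Phi Am Bm X X' e -> topnil F (map_mx phi Bm *m X) ->
  (forall Q : N -> Prop, Q 0 -> (forall a x y, Q x -> Q y -> Q (a *: x + y)) ->
     (forall y, Q (FN y)) -> forall x, Q x) ->
  (forall y, f (FN y) = Phi (E ^+ r *: f y)) -> forall x, f x = 0.
Proof.
move=> pres /topnil_p[n0 [M0 hM0]] gen hf.
have [g [eK gK]] := linear_inverse (pres_inj pres) (pres_surj pres).
set C := _ *m X in hM0.
have gF y : g (f (FN y)) = map_mx phi (g (f y)) *m C.
  rewrite hf -{1}[f y]gK -linearZ (pres_phi pres); first by rewrite eK std_phi_EX.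
  by rewrite /std_fil -scalemxAl; apply: mfil_EX.
have step j n : (forall x, exists w, g (f x) = p%:R ^+ j *: (w *m tpow phi C n)) ->
    forall x, exists w, g (f x) = p%:R ^+ j *: (w *m tpow phi C n.+1).
  move=> h; apply: gen.
  - by exists 0; rewrite !linear0 mul0mx scaler0.
  - move=> a x y [v hv] [w hw]; exists (a *: v + w).
    by rewrite !linearP hv hw mulmxDl -scalemxAl scalerDr !scalerA mulrC.
  - move=> y; have [w hw] := h y; exists (map_mx phi w).
    rewrite gF hw map_mxZ rmorphXn rmorph_nat map_mxM /= -!scalemxAl mulmxA.
    by [].
have h j : forall x, exists w, g (f x) = p%:R ^+ j *: w.
  elim: j => [|j IH] x; first by exists (g (f x)); rewrite scale1r.
  have hn n : forall y, exists w, g (f y) = p%:R ^+ j *: (w *m tpow phi C n).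
    elim: n => [|n IHn]; last exact: step.
    by move=> y; have [w hw] := IH y; exists w; rewrite mulmx1.
  have [w ->] := hn n0 x; rewrite hM0 -scalemxAr scalerA -exprSr.
  by eexists.
move=> x; rewrite -[f x]gK (_ : g (f x) = 0) ?linear0 //.
by apply: (mx_sep F) => j; apply: h.
Qed.

(** [P] changes the basis of $M$ and [Q] the generators of the filtration; [Q] enters $X$ through
    $\varphi$ because $\varphi_r$ is semilinear. *)
Lemma presentation_change (M : lmodType A) (Fil : M -> Prop) (Phi : M -> M) d m
    (Am Bm X X' : 'M[A]_d) (e : {linear 'rV[A]_d -> M})
    (P Q : 'M[A]_(m, d)) (P' Q' : 'M[A]_(d, m)) :
  presentation Fil Phi Am Bm X X' e ->
  P *m P' = 1%:M -> P' *m P = 1%:M -> Q *m Q' = 1%:M -> Q' *m Q = 1%:M ->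
  exists e' : {linear 'rV[A]_m -> M},
    presentation Fil Phi (Q *m Am *m P') (P *m Bm *m Q') (map_mx phi Q *m X *m P')
      (P *m X' *m map_mx phi Q') e'.
Proof.
move=> [AB BA XX' inj surj hfil hphi] PP' P'P QQ' Q'Q.
have [|e' he'] := @linear_exists A 'rV[A]_m M (fun v => e (v *m P)).
  by move=> a v w; rewrite mulmxDl -scalemxAl linearP.
have std v : std_fil (P *m Bm *m Q') v <-> std_fil Bm (v *m P).
  rewrite /std_fil !mulmxA; split=> h; last exact: mfilMr.
  by rewrite -[_ *m Bm]mulmx1 -Q'Q mulmxA; apply: mfilMr.
exists e'; split.
- transitivity (Q *m (Am *m (P' *m P) *m Bm) *m Q'); first by rewrite !mulmxA.
  by rewrite P'P mulmx1 AB mul_mx_scalar -scalemxAl QQ' scalemx1.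
- transitivity (P *m (Bm *m (Q' *m Q) *m Am) *m P'); first by rewrite !mulmxA.
  by rewrite Q'Q mulmx1 BA mul_mx_scalar -scalemxAl PP' scalemx1.
- transitivity (map_mx phi Q *m (X *m (P' *m P) *m X') *m map_mx phi Q').
    by rewrite !mulmxA.
  by rewrite P'P mulmx1 XX' mulmx1 -map_mxM QQ' map_mx1.
- move=> v w; rewrite !he' => /inj h.
  by rewrite -[v]mulmx1 -[w]mulmx1 -PP' !mulmxA h.
- move=> x; have [v <-] := surj x; exists (v *m P').
  by rewrite he' -mulmxA P'P mulmx1.
- by move=> v; rewrite he' hfil std.
- move=> v /std hv; rewrite !he' hphi //; congr (e _).
  rewrite /std_phi -scalemxAl !mulmxA (mphirMr (M := v *m P *m Bm) Q' hv).
  congr (_ *: _).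
  transitivity (mphir (v *m P *m Bm) *m map_mx phi (Q' *m Q) *m X *m (P' *m P)).
    by rewrite Q'Q map_mx1 P'P !mulmx1.
  by rewrite map_mxM !mulmxA.
Qed.

Lemma presentation_block (M : lmodType A) (Fil : M -> Prop) (Phi : M -> M) d
    (Am Bm X X' : 'M[A]_d) (e : {linear 'rV[A]_d -> M}) :
  presentation Fil Phi Am Bm X X' e ->
  exists h l (A2 B2 X2 X2' : 'M[A]_l) (X1 X1' : 'M[A]_h) X3
    Am' X4' (e' : {linear 'rV[A]_(h + l) -> M}),
    presentation Fil Phi Am' (block_mx 1%:M 0 0 B2) (block_mx X1 0 X3 X2) X4' e' /\
    [/\ A2 *m B2 = (E ^+ r)%:M, B2 *m A2 = (E ^+ r)%:M, X1 *m X1' = 1%:M, X2 *m X2' = 1%:M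
      & topnil F (map_mx phi B2 *m X2)].
Proof.
move=> pres; have [AB BA XX' _ _ _ _] := pres.
have [h [l [P [Q [P' [Q' [A2 [B2 [X1 [X2 [X3 [[PP' P'P QQ' Q'Q] [hB hX [AB2 BA2] [u1 u2] nil2]]]]]]]]]]]]] :=
  frame_block k_char AB BA XX'.
have [e'] := presentation_change pres PP' P'P QQ' Q'Q; rewrite hB hX => pres'.
have [X1' [XX1 _]] := mx_lift_unit u1; have [X2' [XX2 _]] := mx_lift_unit u2.
by exists h, l, A2, B2, X2, X2', X1, X1', X3, (Q *m Am *m P'), (P *m X' *m map_mx phi Q'), e'.
Qed.

Lemma std_presentation d (Am Bm X X' : 'M[A]_d) :
  Am *m Bm = (E ^+ r)%:M -> Bm *m Am = (E ^+ r)%:M -> X *m X' = 1%:M ->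
  presentation (std_fil Bm) (std_phi Bm X) Am Bm X X' (idfun : {linear 'rV[A]_d -> 'rV[A]_d}).
Proof. by move=> AB BA XX'; split=> // x; exists x. Qed.

Lemma mfil_row_mx m n l (M : 'M[A]_(m, n)) (N : 'M[A]_(m, l)) :
  mfil (row_mx M N) <-> mfil M /\ mfil N.
Proof.
split=> [h|[hM hN] i j]; last by case: (split_ordP j) => j' ->; rewrite ?row_mxEl ?row_mxEr.
by split=> i j; [have := h i (lshift l j) | have := h i (rshift n j)]; rewrite ?row_mxEl ?row_mxEr.
Qed.

Section Block.
Variables (h l : nat) (B2 X2 : 'M[A]_l) (X1 : 'M[A]_h) (X3 : 'M[A]_(l, h)).
Local Notation Bb := (block_mx (1%:M : 'M[A]_h) 0 0 B2).
Local Notation Xb := (block_mx X1 0 X3 X2).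

Lemma mul_row_block1 v1 v2 : row_mx v1 v2 *m Bb = row_mx v1 (v2 *m B2) :> 'rV_(h + l).
Proof. by rewrite mul_row_block !mulmx0 mulmx1 addr0 add0r. Qed.

Lemma std_fil_block v1 v2 :
  std_fil Bb (row_mx v1 v2) <-> std_fil 1%:M v1 /\ std_fil B2 v2.
Proof. by rewrite /std_fil mul_row_block1 mulmx1; apply: mfil_row_mx. Qed.

Lemma std_phi_block v1 v2 : std_phi Bb Xb (row_mx v1 v2) =
  row_mx (std_phi 1%:M X1 v1 + cinv ^+ r *: (mphir (v2 *m B2) *m X3)) (std_phi B2 X2 v2).
Proof.
rewrite /std_phi mul_row_block1 mulmx1 /mphir map_row_mx mul_row_block mulmx0 add0r.
by rewrite scale_row_mx scalerDr.
Qed.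

End Block.

Lemma std_fil1_span d (v : 'rV[A]_d) : std_fil 1%:M v ->
  exists n (s : 'I_n -> A) (y : 'I_n -> 'rV[A]_d),
    (forall i, ffil (s i)) /\ v = \sum_i s i *: y i.
Proof.
rewrite /std_fil mulmx1 => hv; exists d, (fun j => v 0 j), (fun j => delta_mx 0 j).
by split=> //; rewrite -row_sum_delta.
Qed.

(** The exact sequence read off from block coordinates, with a filtered retraction [t] of [i].
    Compatibility of [t] with [Phi] is not asked for: the lower left block of $X$ obstructs it. *)
Record block_split (M : lmodType A) (Fil : M -> Prop) (Phi : M -> M) h l
    (B2 X2 : 'M[A]_l) (X1 : 'M[A]_h) (i : {linear 'rV[A]_h -> M})
    (q : {linear M -> 'rV[A]_l}) (t : {linear M -> 'rV[A]_h}) : Prop := BlockSplit {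
  bs_inj : injective i;
  bs_mid : forall x, q x = 0 <-> exists y, i y = x;
  bs_surj : forall z, exists x, q x = z;
  bs_filsurj : forall z, std_fil B2 z -> exists2 x, Fil x & q x = z;
  bs_fili : forall v, Fil (i v) <-> std_fil 1%:M v;
  bs_filq : forall x, Fil x -> std_fil B2 (q x);
  bs_filt : forall x, Fil x -> std_fil 1%:M (t x);
  bs_ti : forall v, t (i v) = v;
  bs_phii : forall v, std_fil 1%:M v -> Phi (i v) = i (std_phi 1%:M X1 v);
  bs_phiq : forall x, Fil x -> q (Phi x) = std_phi B2 X2 (q x)
}.

Lemma presentation_split (M : lmodType A) (Fil : M -> Prop) (Phi : M -> M) h l
    (B2 X2 : 'M[A]_l) (X1 : 'M[A]_h) X3 Am' X4' (e : {linear 'rV[A]_(h + l) -> M}) :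
  presentation Fil Phi Am' (block_mx 1%:M 0 0 B2) (block_mx X1 0 X3 X2) X4' e ->
  exists i q t, block_split Fil Phi B2 X2 X1 i q t.
Proof.
move=> [_ _ _ inj surj hfil hphi]; have [g [eK gK]] := linear_inverse inj surj.
have [|i hi] := @linear_exists A 'rV[A]_h M (fun v => e (row_mx v 0)).
  by move=> a v w; rewrite -linearP scale_row_mx add_row_mx scaler0 addr0.
have [|q hq] := @linear_exists A M 'rV[A]_l (fun x => rsubmx (g x)).
  by move=> a v w; rewrite !linearP.
have [|t ht] := @linear_exists A M 'rV[A]_h (fun x => lsubmx (g x)).
  by move=> a v w; rewrite !linearP.
have fil0 m (N : 'M[A]_m) : std_fil N 0.
  by rewrite /std_fil mul0mx => i' j'; rewrite mxE; apply: ffil0.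
have filx x : Fil x <-> std_fil 1%:M (t x) /\ std_fil B2 (q x).
  by rewrite -{1}[x]gK hfil -[g x]hsubmxK std_fil_block ht hq.
have xE x : x = e (row_mx (t x) (q x)) by rewrite ht hq hsubmxK gK.
have ti v : t (i v) = v by rewrite ht hi eK row_mxKl.
have qi v : q (i v) = 0 by rewrite hq hi eK row_mxKr.
have qe v : q (e v) = rsubmx v by rewrite hq eK.
exists i, q, t; split=> //.
- by move=> v w h1; rewrite -[v]ti h1 ti.
- move=> x; split=> [h1|[y <-]//]; exists (t x).
  by rewrite hi {2}[x]xE h1.
- by move=> z; exists (e (row_mx 0 z)); rewrite qe row_mxKr.
- move=> z hz; exists (e (row_mx 0 z)); last by rewrite qe row_mxKr.
  by apply/hfil; apply/std_fil_block.
- by move=> v; rewrite filx ti qi; split=> [[]|].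
- by move=> x /filx[].
- by move=> x /filx[].
- move=> v hv; have hv' : std_fil (block_mx 1%:M 0 0 B2) (row_mx v 0) by apply/std_fil_block.
  rewrite !hi hphi // std_phi_block mul0mx mphir0 mul0mx scaler0 addr0.
  by rewrite [std_phi B2 X2 0]/std_phi mul0mx mphir0 mul0mx scaler0.
- move=> x /filx hx; have hx' : std_fil (block_mx 1%:M 0 0 B2) (row_mx (t x) (q x)) by apply/std_fil_block.
  by rewrite {1}[x]xE hphi // qe std_phi_block row_mxKr.
Qed.

(** * Duality in coordinates *)

Section Dual.
Variables (d : nat) (Am Bm X X' : 'M[A]_d).
Hypotheses (AB : Am *m Bm = (E ^+ r)%:M) (BA : Bm *m Am = (E ^+ r)%:M).
Hypothesis XX' : X *m X' = 1%:M.

(** The rows of $A$ lie in the filtration and generate it modulo $Y$, so it is enough to test $w$ on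
    them, that is, to look at $Aw^T$. *)
Lemma std_fil_dual (w : 'rV[A]_d) :
  std_fil Am^T w <-> forall v, std_fil Bm v -> ffil ((v *m w^T) 0 0).
Proof.
split=> [hw v /mfilE[a [b hv]]|hw i j].
  have [a' [t ->]] := mx_fil_division p_prime k_char rp BA hv.
  rewrite mulmxDl -mulmxA -scalemxAl mxE; apply: ffilD.
    by apply: mfilMl; move/mfil_tr: hw; rewrite trmx_mul trmxK.
  by rewrite mxE mulrC; apply: ffilM; apply: ffil_Y.
have : std_fil Bm (row j Am) by rewrite /std_fil -row_mul AB row_scalar_EX; apply: mfil_EX.
move/hw; rewrite -row_mul ord1; have -> : Am *m w^T = (w *m Am^T)^T by rewrite trmx_mul trmxK.
by rewrite !mxE.
Qed.

(** From $(vB)(Aw^T)=E^rvw^T$ and $\varphi(E^r)=p^rc^r$ one gets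
    $p^r\varphi_r(vB)\varphi_r(Aw^T)=c^r\varphi(vw^T)$. This $c^r$ cancels the $c^{-r}$ of [std_phi]
    for $v$; the factor $c^r$ in the dual matrix cancels the one for $w$. *)
Lemma std_phi_dual (v w : 'rV[A]_d) : std_fil Bm v -> std_fil Am^T w ->
  (std_phi Bm X v *m (std_phi Am^T (c ^+ r *: X'^T) w)^T) 0 0 = phir ((v *m w^T) 0 0).
Proof.
move=> hv hw; have hvw := (std_fil_dual w).1 hw v hv.
have hw' : mfil (Am *m w^T) by move/mfil_tr: hw; rewrite trmx_mul trmxK.
have -> : std_phi Am^T (c ^+ r *: X'^T) w = mphir (w *m Am^T) *m X'^T.
  by rewrite /std_phi -scalemxAr scalerA cinvX_K scale1r.
have -> : (mphir (w *m Am^T) *m X'^T)^T = X' *m mphir (Am *m w^T).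
  rewrite trmx_mul trmxK; congr (_ *m _).
  by rewrite /mphir map_trmx trmx_mul trmxK.
rewrite /std_phi -scalemxAl -mulmxA [X *m _]mulmxA XX' mul1mx.
apply/esym/phir_eq => //.
have hT : p%:R ^+ r *: (mphir (v *m Bm) *m mphir (Am *m w^T)) = c ^+ r *: map_mx phi (v *m w^T).
  apply: (@mx_p_inj _ _ _ F r); rewrite scalemxAl mphirE // scalemxAr mphirE //.
  rewrite -map_mxM mulmxA -[v *m Bm *m Am]mulmxA BA mul_mx_scalar -scalemxAl.
  rewrite scalerA -exprMn -(f_phiE F) -rmorphXn; apply/matrixP => i j.
  by rewrite !mxE rmorphM.
move/matrixP/(_ 0 0): hT; rewrite !mxE => hT.
by rewrite mulrCA hT mulrA cinvX_K mul1r.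
Qed.

Lemma dual_std_presentation :
  presentation (std_fil Am^T) (std_phi Am^T (c ^+ r *: X'^T)) Bm^T Am^T
    (c ^+ r *: X'^T) (cinv ^+ r *: X^T) (idfun : {linear 'rV[A]_d -> 'rV[A]_d}).
Proof.
apply: std_presentation; rewrite -?trmx_mul ?AB ?BA ?tr_scalar_mx //.
by rewrite -scalemxAl -scalemxAr -trmx_mul XX' trmx1 scalerA cX_K scale1r.
Qed.

End Dual.

End FrameModules.

(** * Exact sequences and duality *)

Section BreuilModules.
Variables (p : nat) (k : fieldType) (B : breuil_data p k) (r : nat).
Hypothesis p_prime : prime p.
Hypothesis k_char : p \in [pchar k].
Hypothesis rp : (r < p)%N.

Local Notation Sg := (Sigma p (Eu B)).
Local Notation F := (Sigma_frame B p_prime k_char).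
Local Notation phir := (@phi_r p k B r).
Local Notation fil := (fil_Sigma r).
Implicit Types M N : premod B.

Lemma fil_ffil (s : Sg) : fil s <-> ffil F r s.
Proof. exact: fil_SigmaP. Qed.

(** The choice in [pdiv_Sigma] is not the default here: $p^r$ divides $\varphi(E^r)=p^rc^r$ and
    $\varphi(Y)=p^{p-1}c^p$, as $r\le p-1$. *)
Lemma phi_rE (s : Sg) : ffil F r s -> p%:R ^+ r * phir s = phi_Sigma B s.
Proof.
move=> [a [b hs]]; have hs' : s = a * Sigma_E B ^+ r + b * Sigma_Y p (Eu B) by [].
suff [t ht] : exists t, p%:R ^+ r * t = phi_Sigma B s.
  rewrite /phi_r /pdiv_Sigma; case: xgetP => [x _ //|/(_ t)]; by case.
exists (phi_Sigma B a * c_Sigma B ^+ r + phi_Sigma B b * p%:R ^+ (p.-1 - r) * c_Sigma B ^+ p).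
rewrite hs' rmorphD !rmorphM rmorphXn (c_SigmaE B p_prime k_char) (phi_Sigma_Y B p_prime k_char).
have rp1 : (r <= p.-1)%N by rewrite -ltnS prednK // prime_gt0.
by rewrite -{2}(subnKC rp1) exprD exprMn; ring.
Qed.

Lemma is_Mod_axioms M : is_Mod r M -> module_axioms F r phir (@mod_fil _ _ _ M) (@mod_phi _ _ _ M).
Proof.
move=> [h1 h2 h3 h4 h5 h6 h7 h8]; split=> //.
  by move=> x [n [s [y [hs hx]]]]; apply: h3; exists n, s, y; split=> // i; apply/fil_ffil.
by move=> s x /fil_ffil; apply: h6.
Qed.

Lemma axioms_is_Mod M : module_axioms F r phir (@mod_fil _ _ _ M) (@mod_phi _ _ _ M) -> is_Mod r M.
Proof.
move=> [h1 h2 h3 h4 h5 h6 h7 h8]; split=> //.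
  by move=> x [n [s [y [hs hx]]]]; apply: h3; exists n, s, y; split=> // i; apply/fil_ffil.
by move=> s x /fil_ffil; apply: h6.
Qed.

Local Notation presented M := (presentation F r phir (@mod_fil _ _ _ M) (@mod_phi _ _ _ M)).

Lemma is_ModP M : is_Mod r M <->
  exists d (Am Bm X X' : 'M[Sg]_d) (e : {linear 'rV[Sg]_d -> M}), presented M Am Bm X X' e.
Proof.
split=> [/is_Mod_axioms h|[d [Am [Bm [X [X' [e h]]]]]]].
  exact: (module_presentation p_prime k_char rp phi_rE h).
exact/axioms_is_Mod/(presentation_module rp phi_rE h).
Qed.

Lemma dual_linear M (f : cartier_dual r M) a x y : f (a *: x + y) = a * f x + f y.
Proof. by case: f => f /= /asboolP; apply. Qed.

Lemma dual_ext M (f g : cartier_dual r M) : (forall x, f x = g x) -> f = g.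
Proof. by move=> h; apply: val_inj; apply/funext. Qed.

Lemma dual_exists M (f : M -> Sg) : (forall a x y, f (a *: x + y) = a * f x + f y) ->
  exists g : cartier_dual r M, forall x, g x = f x.
Proof.
move=> lf; have hf : dual_pred (f : M -> Sg^o) by apply/asboolP.
by exists (Dual hf).
Qed.

Lemma dual_addE M (f g : cartier_dual r M) a x : (a *: f + g) x = a * f x + g x.
Proof. by []. Qed.

Lemma lin_zero M (f : M -> Sg) : (forall a x y, f (a *: x + y) = a * f x + f y) ->
  f 0 = 0.
Proof. by move=> lf; have := lf (-1) 0 0; rewrite scaler0 addr0 mulN1r addNr. Qed.

Lemma lin_sum M (f : M -> Sg) : (forall a x y, f (a *: x + y) = a * f x + f y) ->
  forall n (a : 'I_n -> Sg) (y : 'I_n -> M), f (\sum_i a i *: y i) = \sum_i a i * f (y i).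
Proof.
move=> lf; have f0 := lin_zero lf; elim=> [|n IH] a y; first by rewrite !big_ord0.
by rewrite !big_ord_recl lf IH.
Qed.

Lemma dual_eq_on_phi M (f g : cartier_dual r M) : is_Mod r M ->
  (forall x, mod_fil x -> f (mod_phi x) = g (mod_phi x)) -> f = g.
Proof.
move=> hM h; apply: dual_ext => x; have [n [a [y [hy ->]]]] := mod_phi_gen hM x.
rewrite !lin_sum; try exact: dual_linear.
by apply: eq_bigr => i _; rewrite h.
Qed.

Lemma dual_phi_eq M (f g : cartier_dual r M) : is_Mod r M ->
  (forall x, mod_fil x -> g (mod_phi x) = phir (f x)) -> mod_phi f = g.
Proof.
move=> hM hg; rewrite /= /dual_phi; case: xgetP => [g' _ hg'|/(_ g)]; last by case.
by apply: dual_eq_on_phi => // x hx; rewrite hg // hg'.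
Qed.

Lemma dual_presented M d (Am Bm X X' : 'M[Sg]_d) (e : {linear 'rV[Sg]_d -> M}) :
  presented M Am Bm X X' e ->
  exists e' : {linear 'rV[Sg]_d -> cartier_dual r M},
    presented (cartier_dual r M) Bm^T Am^T (c_Sigma B ^+ r *: X'^T) (c_inv B ^+ r *: X^T) e' /\
    forall w v, e' w (e v) = (v *m w^T) 0 0.
Proof.
move=> pres; have hM : is_Mod r M by apply/is_ModP; exists d, Am, Bm, X, X', e.
have [AB BA XX' inj surj hfil hphi] := pres.
have [g [eK gK]] := linear_inverse inj surj.
have /choice[e0 he0] : forall w : 'rV[Sg]_d, exists f : cartier_dual r M,
    forall x, f x = (g x *m w^T) 0 0.
  move=> w; apply: dual_exists => a x y; rewrite linearP; exact: row_dot_linear.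
have [|e' he'] := @linear_exists _ _ _ e0.
  move=> a u w; apply: dual_ext => x; rewrite dual_addE !he0.
  exact: row_dot_linearr.
have hev w v : e' w (e v) = (v *m w^T) 0 0 by rewrite he' he0 eK.
have std w : std_fil F r Am^T w <-> forall v, std_fil F r Bm v -> ffil F r ((v *m w^T) 0 0).
  exact: (std_fil_dual p_prime k_char rp AB BA).
have [dAB dBA dXX _ _ _ _] := dual_std_presentation phir AB BA XX'.
have e'fil w : mod_fil (e' w) <-> std_fil F r Am^T w.
  rewrite std; split=> [h v hv|h x].
    by rewrite -hev; apply/fil_ffil; apply: h; apply/hfil.
  by rewrite -[x]gK hfil hev => hv; apply/fil_ffil; apply: h.
exists e'; split=> //; split=> //.
- move=> u w h; apply: row_dot_inj => v.
  exact: (etrans (esym (hev u v)) (etrans (congr1 (fun f : cartier_dual r M => f (e v)) h) (hev w v))).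
- move=> f; have [|w hw] := @row_functional _ _ (fun v => f (e v)).
    by move=> a u v; rewrite linearP dual_linear.
  by exists w; apply: dual_ext => x; rewrite -[x]gK hev hw.
- move=> w hw; apply: dual_phi_eq => // x.
  rewrite -[x]gK hfil => hv; rewrite hphi // !hev.
  exact: (std_phi_dual p_prime k_char rp phi_rE AB BA XX').
Qed.

Lemma dual_is_Mod M : is_Mod r M -> is_Mod r (cartier_dual r M).
Proof.
move=> /is_ModP[d [Am [Bm [X [X' [e /dual_presented[e' [h _]]]]]]]].
by apply/is_ModP; exists d, Bm^T, Am^T, (c_Sigma B ^+ r *: X'^T), (c_inv B ^+ r *: X^T), e'.
Qed.

(* A perfect duality of Breuil modules; it covers both M against its dual and
   the dual against M, so that biduality need not be made explicit. *)
Record pairing M N (b : M -> N -> Sg) : Prop := Pairing {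
  pair_Mod1 : is_Mod r M;
  pair_Mod2 : is_Mod r N;
  pair_lin1 : forall a x x' y, b (a *: x + x') y = a * b x y + b x' y;
  pair_lin2 : forall a x y y', b x (a *: y + y') = a * b x y + b x y';
  pair_inj1 : forall x x', (forall y, b x y = b x' y) -> x = x';
  pair_inj2 : forall y y', (forall x, b x y = b x y') -> y = y';
  pair_surj1 : forall h : N -> Sg, (forall a y y', h (a *: y + y') = a * h y + h y') ->
    exists x, forall y, b x y = h y;
  pair_surj2 : forall h : M -> Sg, (forall a x x', h (a *: x + x') = a * h x + h x') ->
    exists y, forall x, b x y = h x;
  pair_fil1 : forall x, mod_fil x <-> forall y, mod_fil y -> fil (b x y);
  pair_fil2 : forall y, mod_fil y <-> forall x, mod_fil x -> fil (b x y);
  pair_phi : forall x y, mod_fil x -> mod_fil y ->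
    b (mod_phi x) (mod_phi y) = phir (b x y)
}.

Lemma pairingC M N (b : M -> N -> Sg) : pairing b -> pairing (fun y x => b x y).
Proof. by case=> *; split=> //; auto. Qed.

Lemma dual_pairing M : is_Mod r M ->
  pairing (fun (f : cartier_dual r M) (x : M) => f x).
Proof.
move=> hM; have hD := dual_is_Mod hM.
have [d [Am [Bm [X [X' [e pres]]]]]] := (is_ModP M).1 hM.
have [e' [pres' hev]] := dual_presented pres.
have hevC w v : e' w (e v) = (w *m v^T) 0 0 := etrans (hev w v) (row_dotC v w).
have [AB BA XX' inj surj hfil hphi] := pres.
have [_ _ _ inj' surj' hfil' hphi'] := pres'.
split=> //.
- move=> a f x y; exact: dual_linear.
- exact: dual_ext.
- move=> x x'; have [v <-] := surj x; have [v' <-] := surj x' => h.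
  by congr (e _); apply: row_dot_inj => w; exact: (etrans (etrans (esym (hevC w v)) (h (e' w))) (hevC w v')).
- exact: dual_exists.
- move=> h lh; have [|v hv] := @row_functional _ _ (fun w => h (e' w)).
    by move=> a u w; rewrite linearP lh.
  exists (e v) => f; have [w <-] := surj' f; exact: (etrans (hevC w v) (esym (hv w))).
- move=> x; split=> [hx f hf|hx]; first exact: hf.
  have [v hv] := surj x; move: hx; rewrite -hv hfil => hx.
  (* The filtration of $M$ is recovered from that of its dual by the same criterion for the
     transposed pair, whose transpose is the original one. *)
  rewrite -(trmxK Bm); apply/(std_fil_dual p_prime k_char rp pres'.(pres_AB) pres'.(pres_BA)).
  move=> w /hfil' hw; apply/fil_ffil; rewrite -hevC; exact: hx.
- move=> f x hf hx; have [w hw] := surj' f; have [v hv] := surj x.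
  move: hf hx; rewrite -hw -hv hfil hfil' => hw' hv'.
  rewrite hphi // hphi' // !hev.
  exact: (std_phi_dual p_prime k_char rp phi_rE AB BA XX').
Qed.

(** If $M$ is étale with basis $e_i$ and dual basis $z_i$ in $N$, then $y=\sum_i b(e_i,y)z_i$, with
    coefficients in $\mathrm{Fil}^r\Sigma$ when $y\in\mathrm{Fil}^rN$. Conversely, every $x$ pairs
    $\mathrm{Fil}^r\Sigma\cdot N$ into $\mathrm{Fil}^r\Sigma$. *)
Lemma pairing_etale_mult M N (b : M -> N -> Sg) : pairing b ->
  is_etale M <-> is_multiplicative r N.
Proof.
move=> hb; split=> [et y|mu x].
  split=> [hy|]; last exact: mod_fil_ge (pair_Mod2 hb) y.
  have [n [e free]] := mod_free (pair_Mod1 hb).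
  have /choice[c hc] := free.
  have cE x : x = \sum_i c x 0 i *: e i by case: (hc x).
  have c_lin i a x x' : c (a *: x + x') 0 i = a * c x 0 i + c x' 0 i.
    have [_ uniq] := hc (a *: x + x'); rewrite (uniq (a *: c x + c x')) ?mxE //.
    rewrite {1}[x]cE {1}[x']cE scaler_sumr -big_split; apply: eq_bigr => j _ /=.
    by rewrite !mxE scalerDl scalerA.
  have /choice[z hz] : forall i, exists z, forall x, b x z = c x 0 i.
    by move=> i; apply: (pair_surj2 hb) => a x x'; apply: c_lin.
  exists n, (fun i => b (e i) y), z; split=> [i|].
    by apply: (pair_fil2 hb y).1.
  apply: (pair_inj2 hb) => x.
  rewrite {1}[x]cE (lin_sum (f := fun x => b x y)); last by move=> *; apply: (pair_lin1 hb).
  rewrite (lin_sum (f := fun y => b x y)); last by move=> *; apply: (pair_lin2 hb).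
  by apply: eq_bigr => i _; rewrite hz mulrC.
apply/(pair_fil1 hb) => y /mu[n [s [z [hs ->]]]].
rewrite (lin_sum (f := fun y => b x y)); last by move=> *; apply: (pair_lin2 hb).
elim/big_rec: _ => [|i t _ ht]; first by apply/fil_ffil; apply: ffil0.
by apply/fil_ffil/ffilD; [rewrite mulrC; apply: ffilM|]; apply/fil_ffil.
Qed.

(** When the filtration is $\mathrm{Fil}^r\Sigma\cdot N$, the compatibility axiom writes all values
    of $\varphi_r$ as combinations of the $\varphi_r(E^ry)$, which therefore generate $N$. Phrased
    as the induction principle that [presentation_hom_zero] consumes. *)
Lemma mult_phi_ind N : is_Mod r N -> is_multiplicative r N ->
  forall Q : N -> Prop, Q 0 -> (forall a x y, Q x -> Q y -> Q (a *: x + y)) ->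
  (forall y, Q (mod_phi (Sigma_E B ^+ r *: y))) -> forall x, Q x.
Proof.
move=> hN mu Q Q0 Qlin Qphi.
have Qsum n (a : 'I_n -> Sg) (y : 'I_n -> N) : (forall i, Q (y i)) -> Q (\sum_i a i *: y i).
  by move=> hy; elim/big_rec: _ => [|i t _ ht] //; apply: Qlin.
suff Qphi' y : mod_fil y -> Q (mod_phi y).
  by move=> x; have [n [a [y [hy ->]]]] := mod_phi_gen hN x; apply: Qsum => i; apply: Qphi'.
have fil1 s z : fil s -> mod_fil (s *: z : N).
  move=> hs; apply: (mod_fil_ge hN).
  by exists 1%N, (fun=> s), (fun=> z); rewrite big_ord1.
have F0 : mod_fil (0 : N).
  by rewrite -(scale0r 0); apply: fil1; apply/fil_ffil; apply: ffil0.
move=> /mu[n [s [z [hs ->]]]].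
suff : mod_fil (\sum_i s i *: z i) /\ Q (mod_phi (\sum_i s i *: z i)) by case.
elim: n s z hs => [|n IH] s z hs.
  by rewrite !big_ord0; split=> //; rewrite -(scale0r 0) (mod_phiZ hN) // rmorph0 scale0r.
have [h1 h2] := IH _ (fun i => z (lift ord0 i)) (fun i => hs (lift ord0 i)).
have h3 := fil1 _ (z ord0) (hs ord0).
rewrite !big_ord_recl; split; first by rewrite -[s _ *: _]scale1r; apply: (mod_fil_submod hN).
rewrite (mod_phiD hN) // (mod_phi_compat hN) //.
by apply: Qlin.
Qed.

(* For the objects of Mod this amounts to nilpotency. *)
Definition no_mult_hom M := forall N (f : {linear N -> M}), is_Mod r N ->
  is_multiplicative r N -> is_mod_morphism f -> forall x, f x = 0.

Lemma no_mult_hom_nilpotent M : no_mult_hom M -> is_nilpotent r M.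
Proof.
move=> h M1 M2 f g ses mu x; apply: (se_inj ses).
by rewrite linear0; apply: h => //; [exact: se_Mod1 ses | exact: se_morl ses].
Qed.

Lemma topnil_no_mult_hom M d (Am Bm X X' : 'M[Sg]_d) (e : {linear 'rV[Sg]_d -> M}) :
  presented M Am Bm X X' e -> topnil F (map_mx (phi_Sigma B) Bm *m X) -> no_mult_hom M.
Proof.
move=> pres nil N f hN mu [ffil fphi].
apply: (presentation_hom_zero phi_rE pres nil (mult_phi_ind hN mu)) => y.
have hy : mod_fil (Sigma_E B ^+ r *: y).
  apply: (mod_fil_ge hN).
  exists 1%N, (fun=> Sigma_E B ^+ r), (fun=> y); rewrite big_ord1; split=> // _.
  by apply/fil_ffil; apply: ffil_EX.
by rewrite fphi // linearZ.
Qed.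

(** The filtered retraction is exported with the sequence because dualizing needs it. *)
Lemma block_sequence M : is_Mod r M ->
  exists (Mm Mnil : premod B) (i : {linear Mm -> M}) (q : {linear M -> Mnil})
    (t : {linear M -> Mm}),
    [/\ short_exact r i q, is_multiplicative r Mm, no_mult_hom Mnil,
        forall v, t (i v) = v & forall x, mod_fil x -> mod_fil (t x)].
Proof.
move=> hM; have [d [Am [Bm [X [X' [e pres]]]]]] := (is_ModP M).1 hM.
have [h [l [A2 [B2 [X2 [X2' [X1 [X1' [X3 [Am' [X4' [e' [pres' [AB2 BA2 XX1 XX2 nil2]]]]]]]]]]]]]] :=
  presentation_block k_char phi_rE pres.
have [i [q [t [inj mid surj filsurj fili filq filt ti phii phiq]]]] := presentation_split phi_rE pres'.
pose Mm := @PreMod p k B 'rV[Sg]_h (std_fil F r 1%:M) (std_phi F r phir 1%:M X1).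
pose Mnil := @PreMod p k B 'rV[Sg]_l (std_fil F r B2) (std_phi F r phir B2 X2).
have presm : presented Mm (Sigma_E B ^+ r)%:M 1%:M X1 X1' (idfun : {linear 'rV[Sg]_h -> 'rV[Sg]_h}).
  by apply: std_presentation => //; rewrite ?mulmx1 ?mul1mx.
have presn : presented Mnil A2 B2 X2 X2' (idfun : {linear 'rV[Sg]_l -> 'rV[Sg]_l}).
  exact: std_presentation.
have hMm : is_Mod r Mm by apply/is_ModP; exists h, (Sigma_E B ^+ r)%:M, 1%:M, X1, X1', idfun.
have hMn : is_Mod r Mnil by apply/is_ModP; exists l, A2, B2, X2, X2', idfun.
exists Mm, Mnil, i, q, t; split=> //.
- split=> //.
  + by split=> v hv; [exact: (fili v).2 | rewrite phii].
  + move=> x hx /mid[v hv]; exists v => //; move: hx; rewrite -hv; exact: (fili v).1.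
- move=> v; split=> [/std_fil1_span[n [s [y [hs hv]]]]|]; last exact: (mod_fil_ge hMm).
  by exists n, s, y; split=> // j; apply/fil_ffil.
- exact: (topnil_no_mult_hom presn nil2).
Qed.

Lemma pairing_eq_on_phi M N (b : M -> N -> Sg) x x' : pairing b ->
  (forall y, mod_fil y -> b x (mod_phi y) = b x' (mod_phi y)) -> x = x'.
Proof.
move=> hb h; apply: (pair_inj1 hb) => y.
have [n [a [z [hz ->]]]] := mod_phi_gen (pair_Mod2 hb) y.
rewrite (lin_sum (f := b x)); last by move=> *; apply: (pair_lin2 hb).
rewrite (lin_sum (f := b x')); last by move=> *; apply: (pair_lin2 hb).
by apply: eq_bigr => i _; rewrite h.
Qed.

(** Perfectness represents $h\circ g$ by an element of $M$. Compatibility with $\varphi_r$ is tested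
    against $\varphi_r(\mathrm{Fil}^rN)$, which generates $N$. *)
Lemma pairing_adjoint M N (b : M -> N -> Sg) N2 (g : {linear N -> N2}) :
  pairing b -> is_Mod r N2 -> is_mod_morphism g ->
  exists a : {linear cartier_dual r N2 -> M},
    is_mod_morphism a /\ forall h y, b (a h) y = h (g y).
Proof.
move=> hb hN2 [gfil gphi].
have /choice[a0 ha0] : forall h : cartier_dual r N2, exists x, forall y, b x y = h (g y).
  by move=> h; apply: (pair_surj1 hb) => a y y'; rewrite linearP dual_linear.
have [|a ha] := @linear_exists _ _ _ a0.
  move=> c h h'; apply: (pair_inj1 hb) => y.
  by rewrite (pair_lin1 hb) !ha0 dual_addE.
have bE h y : b (a h) y = h (g y) by rewrite ha ha0.
have afil h : mod_fil h -> mod_fil (a h).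
  move=> hh; apply/(pair_fil1 hb) => y hy; rewrite bE; apply: hh; exact: gfil.
exists a; split=> //; split=> // h hh; apply: (pairing_eq_on_phi hb) => y hy.
rewrite bE gphi // (pair_phi (dual_pairing hN2)) //; last exact: gfil.
by rewrite (pair_phi hb) ?bE //; apply: afil.
Qed.

Lemma pairing_restriction M N (b : M -> N -> Sg) N1 (j : {linear N1 -> N}) :
  pairing b -> is_Mod r N1 -> is_mod_morphism j ->
  exists c : {linear M -> cartier_dual r N1},
    is_mod_morphism c /\ forall x y, c x y = b x (j y).
Proof.
move=> hb hN1 [jfil jphi].
have /choice[c0 hc0] : forall x, exists f : cartier_dual r N1, forall y, f y = b x (j y).
  by move=> x; apply: dual_exists => a y y'; rewrite linearP (pair_lin2 hb).
have [|c hc] := @linear_exists _ _ _ c0.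
  move=> a x x'; apply: dual_ext => y.
  by rewrite dual_addE !hc0 (pair_lin1 hb).
have cE x y : c x y = b x (j y) by rewrite hc hc0.
exists c; split=> //; split=> x hx.
  by move=> y hy; rewrite cE; apply: (pair_fil1 hb x).1 => //; apply: jfil.
apply/esym/dual_phi_eq => // y hy; rewrite !cE jphi // (pair_phi hb) //.
exact: jfil.
Qed.

(* The filtered retraction t is what makes the dual sequence exact on Fil^r. *)
Lemma dual_short_exact M N (b : M -> N -> Sg) N1 N2
    (j : {linear N1 -> N}) (s : {linear N -> N2}) (t : {linear N -> N1}) :
  pairing b -> short_exact r j s -> (forall v, t (j v) = v) ->
  (forall y, mod_fil y -> mod_fil (t y)) ->
  exists (a : {linear cartier_dual r N2 -> M}) (c : {linear M -> cartier_dual r N1}),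
    [/\ short_exact r a c, forall h y, b (a h) y = h (s y)
      & forall x y, c x y = b x (j y)].
Proof.
move=> hb ses tj tfil; have [hN1 hN hN2 jmor smor jinj mid surj filmid filsurj] := ses.
have [a [amor bE]] := pairing_adjoint hb hN2 smor.
have [c [cmor cE]] := pairing_restriction hb hN1 jmor.
have sj v : s (j v) = 0 by apply/mid; exists v.
have aker x : c x = 0 -> exists h, a h = x.
  (* A set-theoretic section only; $z\mapsto b(x,w(z))$ is still linear, because $x$ pairs to zero
     with the image of [j]. *)
  move=> cx; have [w hw] := choice surj.
  have bker y y' : s y = s y' -> b x y = b x y'.
    move=> h; have [v hv] : exists v, j v = y - y'.
      by apply/mid; rewrite linearB h subrr.
    have -> : y = 1 *: j v + y' by rewrite scale1r hv subrK.
    by rewrite (pair_lin2 hb) -cE cx mulr0 add0r.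
  have [|h hh] := @dual_exists N2 (fun z => b x (w z)).
    move=> d z z'; rewrite -(pair_lin2 hb); apply: bker.
    by rewrite linearP !hw.
  exists h; apply: (pair_inj1 hb) => y; rewrite bE hh; apply: bker.
  by rewrite hw.
(* The functional is extended along the retraction, which keeps it in the filtration. *)
have clift (z : cartier_dual r N1) : exists x, forall y, b x y = z (t y).
  by apply: (pair_surj1 hb) => d y y'; rewrite linearP dual_linear.
exists a, c; split=> //; split=> //.
- exact: dual_is_Mod.
- exact: pair_Mod1 hb.
- exact: dual_is_Mod.
- move=> h h' eh; apply: dual_ext => z; have [y <-] := surj z.
  by rewrite -!bE eh.
- move=> x; split=> [|[h <-]]; first exact: aker.
  by apply: dual_ext => y; rewrite cE bE sj (lin_zero (dual_linear h)).
- move=> z; have [x hx] := clift z; exists x; apply: dual_ext => y.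
  by rewrite cE hx tj.
- move=> x hx /aker[h hh]; exists h => // z /filsurj[y hy <-].
  by rewrite -bE hh; apply: (pair_fil1 hb x).1.
- move=> z hz; have [x hx] := clift z; exists x; last by apply: dual_ext => y; rewrite cE hx tj.
  by apply/(pair_fil1 hb) => y hy; rewrite hx; apply: hz; apply: tfil.
Qed.

(** Once [M1] vanishes, [q] is injective, so a morphism to $M$ is zero when its composite with [q]
    is. Applied to [block_sequence], this upgrades nilpotency to [no_mult_hom]. *)
Lemma short_exact_zero_no_mult_hom M1 M M2 (i : {linear M1 -> M}) (q : {linear M -> M2}) :
  short_exact r i q -> no_mult_hom M2 -> (forall v : M1, v = 0) -> no_mult_hom M.
Proof.
move=> ses h2 h1 N f hN mu [ffil fphi] x.
have [qfil qphi] := se_morr ses.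
have /(se_mid ses)[v <-] : q (f x) = 0.
  apply: (h2 N (q \o f : {linear N -> M2})) => //; split=> y hy.
    by apply: qfil; apply: ffil.
  by rewrite /= fphi // qphi //; apply: ffil.
by rewrite (h1 v) linear0.
Qed.

Lemma dual_zero N : is_Mod r N -> (forall h : cartier_dual r N, h = 0) -> forall z : N, z = 0.
Proof.
by move=> hN h z; apply: (pair_inj2 (dual_pairing hN)) => f; rewrite (h f).
Qed.

(** If $M$ is nilpotent, its multiplicative part vanishes and no multiplicative module maps
    nontrivially to $M$; an étale quotient of $N$ would give such a map by adjunction from its dual.
    Conversely, the dual of the multiplicative part of $M$ is an étale quotient of $N$, so it
    vanishes when $N$ is unipotent. *)
Lemma pairing_nilpotent_unipotent M N (b : M -> N -> Sg) : pairing b ->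
  is_nilpotent r M <-> is_unipotent r N.
Proof.
move=> hb; have [Mm [Mnil [i [q [t [ses mu hnil ti tfil]]]]]] := block_sequence (pair_Mod1 hb).
split=> [nil|uni].
  have hM := short_exact_zero_no_mult_hom ses hnil (nil _ _ _ _ ses mu).
  move=> N1 N2 f g ses2 et; have hN2 := se_Mod2 ses2.
  have [a [amor bE]] := pairing_adjoint hb hN2 (se_morr ses2).
  have mu2 := (pairing_etale_mult (pairingC (dual_pairing hN2))).1 et.
  apply: dual_zero => // h; apply: dual_ext => z; have [y <-] := se_surj ses2 z.
  rewrite -bE (hM _ a) //; last exact: dual_is_Mod.
  by apply: (lin_zero (f := fun x => b x y)) => *; apply: (pair_lin1 hb).
have [a [c [ses2 _ _]]] := dual_short_exact (pairingC hb) ses ti tfil.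
have et : is_etale (cartier_dual r Mm).
  by apply/(pairing_etale_mult (dual_pairing (se_Mod1 ses))).
have hz := dual_zero (se_Mod1 ses) (uni _ _ _ _ ses2 et).
exact/no_mult_hom_nilpotent/(short_exact_zero_no_mult_hom ses hnil hz).
Qed.

(** Maximality holds because a multiplicative submodule of $M$ maps to zero in [M2], hence lies in
    the kernel of [q]. *)
Lemma block_mult_nil_sequence M1 M M2 (i : {linear M1 -> M}) (q : {linear M -> M2}) :
  short_exact r i q -> is_multiplicative r M1 -> no_mult_hom M2 -> mult_nil_sequence r i q.
Proof.
move=> ses mu hnil; split=> //; first exact: no_mult_hom_nilpotent.
move=> N1 N2 f g ses2 mu2 y; apply/(se_mid ses).
have [ffil fphi] := se_morl ses2; have [qfil qphi] := se_morr ses.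
apply: (hnil N1 (q \o f : {linear N1 -> M2})) => //; first exact: se_Mod1 ses2.
split=> z hz; first by apply: qfil; apply: ffil.
by rewrite /= fphi // qphi //; apply: ffil.
Qed.

End BreuilModules.

Theorem theorem2p3p7 (p : nat) (p_prime : prime p) (r : nat)
    (r_le : (r <= p - 1)%N) (k : fieldType) (k_char : p \in [pchar k])
    (k_perfect : perfect_field p k) (B : breuil_data p k)
    (M : premod B) (M_Mod : is_Mod r M) :
  (exists (Mm Mnil : premod B)
      (i : {linear Mm -> M}) (q : {linear M -> Mnil})
      (Nm Nnil : premod B)
      (j : {linear Nm -> cartier_dual r M}) (s : {linear cartier_dual r M -> Nnil})
      (a : {linear cartier_dual r Nnil -> M})
      (b : {linear M -> cartier_dual r Nm}),
    [/\ mult_nil_sequence r i q,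
        mult_nil_sequence r j s,
        [/\ short_exact r a b,
            is_unipotent r (cartier_dual r Nnil)
          & is_etale (cartier_dual r Nm)]
      & dual_sequence j s a b])
  /\ [/\ (is_etale M <-> is_multiplicative r (cartier_dual r M)),
         (is_unipotent r M <-> is_nilpotent r (cartier_dual r M)),
         (is_multiplicative r M <-> is_etale (cartier_dual r M))
       & (is_nilpotent r M <-> is_unipotent r (cartier_dual r M))].
Proof.
have rp : (r < p)%N by have := prime_gt0 p_prime; lia.
have D := dual_pairing p_prime k_char rp M_Mod; have DC := pairingC D.
split.
  have [Mm [Mnil [i [q [t [ses mu hnil _ _]]]]]] := block_sequence p_prime k_char rp M_Mod.
  (* The same construction for the dual; [DC], the evaluation pairing read from the side of $M$,
     then carries its dual sequence onto $M$ itself rather than onto the bidual. *)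
  have [Nm [Nnil [j [s [u [ses' mu' hnil' uj ufil]]]]]] :=
    block_sequence p_prime k_char rp (pair_Mod1 D).
  have [a [b [ses2 aE bE]]] := dual_short_exact p_prime k_char rp DC ses' uj ufil.
  exists Mm, Mnil, i, q, Nm, Nnil, j, s, a, b; split.
  - exact: block_mult_nil_sequence.
  - exact: block_mult_nil_sequence.
  - split=> //.
    + apply/(pairing_nilpotent_unipotent p_prime k_char rp
        (pairingC (dual_pairing p_prime k_char rp (se_Mod2 ses')))).
      exact: no_mult_hom_nilpotent.
    + by apply/(pairing_etale_mult p_prime k_char rp
        (dual_pairing p_prime k_char rp (se_Mod1 ses'))).
  - by split.
split.
- exact: pairing_etale_mult p_prime k_char rp _ _ _ DC.
- by split=> /(pairing_nilpotent_unipotent p_prime k_char rp D).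
- by split=> /(pairing_etale_mult p_prime k_char rp D).
- exact: pairing_nilpotent_unipotent p_prime k_char rp _ _ _ DC.
Qed.
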